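(* Suppose two (leveled) shaped pseudo 3-manifolds $X$ and $Y$ are equivalent. Then there exist $D\subset\Delta_1(X)$ and $D'\subset\Delta_1(Y)$, a bijection $i\colon\Delta_1(X)\setminus D\to\Delta_1(Y)\setminus D'$, and a Poisson isomorphism $$R\colon\tilde\Omega_{X,r}(D)^{-1}(2\pi)\to\tilde\Omega_{Y,r}(D')^{-1}(2\pi),$$ which is covered by an affine $\mathbb R$-bundle isomorphism from $\widetilde{LS}_r(X)|_{\tilde\Omega_{X,r}(D)^{-1}(2\pi)}$ to $\widetilde{LS}_r(Y)|_{\tilde\Omega_{Y,r}(D')^{-1}(2\pi)}$, and such that $$i_\#\circ\mathrm{proj}\circ\tilde\Omega_{X,r}=\mathrm{proj}\circ\tilde\Omega_{Y,r}\circ R\quad\text{on }\tilde\Omega_{X,r}(D)^{-1}(2\pi),$$ where $\mathrm{proj}$ denotes the coordinate projections $\mathbb R^{\Delta_1(X)}\to\mathbb R^{\Delta_1(X)\setminus D}$ and $\mathbb R^{\Delta_1(Y)}\to\mathbb R^{\Delta_1(Y)\setminus D'}$, and $i_\#\colon\mathbb R^{\Delta_1(X)\setminus D}\to\mathbb R^{\Delta_1(Y)\setminus D'}$ is the isomorphism induced by the bijection $i$. Moreover, $R$ takes an open convex subset $U$ of $S_r(X)\cap\tilde\Omega_{X,r}(D)^{-1}(2\pi)$ onto an open convex subset $U'$ of $S_r(Y)\cap\tilde\Omega_{Y,r}(D')^{-1}(2\pi)$. If $S_r(X)$ (equivalently $S_r(Y)$) is non-empty, then so are $U$ and $U'$.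
   Context: Oriented triangulated pseudo 3-manifold: take a disjoint union of finitely many standard 3-simplices in $\mathbb R^3$, each with totally ordered vertices, and identify some of the codimension-1 faces in pairs by vertex-order-preserving, orientation-reversing affine homeomorphisms; the quotient CW-complex is $X$. $\Delta_i(X)$ is the set of $i$-cells; $\Delta_3^1(X)$ is the set of pairs (tetrahedron, edge of that tetrahedron), and $\phi^{3,1}\colon\Delta_3^1(X)\to\Delta_1(X)$ sends such a pair to the corresponding edge of $X$. A shape structure on $X$ is a map $\alpha_X\colon\Delta_3^1(X)\to\mathbb R_{>0}$ such that the three values at the edges from each vertex of each tetrahedron sum to $\pi$; a generalized shape structure is the same with values in $\mathbb R$. Opposite edges of a tetrahedron carry equal values. A shaped pseudo 3-manifold is one with a shape structure; a leveled shaped one is a pair $(X,\ell_X)$ with $\ell_X\in\mathbb R$. $\tilde S(X)$ is the set of generalized shape structures; the weight function is $\omega_X(e)=\sum_{a\in(\phi^{3,1})^{-1}(e)}\alpha_X(a)$, and $\tilde\Omega_X\colon\tilde S(X)\to\mathbb R^{\Delta_1(X)}$ sends $\alpha_X$ to $\omega_X$. An edge is balanced if it is internal and has weight $2\pi$. $p\colon\Delta_3^1(X)\to\Delta_3^{1/p}(X)$ is the quotient identifying opposite edges of each tetrahedron. The orientation induces a cyclic order on the three pairs of opposite edges of each tetrahedron (from the cyclic order of the three edges at a vertex). $\varepsilon_{a,b}=-\varepsilon_{b,a}\in\{0,\pm1\}$ is $0$ if the underlying tetrahedra are distinct and $+1$ if they coincide and $b$ is cyclically preceded by $a$. Gauge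 equivalence: $(X,\ell_X)$ and $(Y,\ell_Y)$ are gauge equivalent if there are an isomorphism $h\colon X\to Y$ of cellular structures and $g\colon\Delta_1(X)\to\mathbb R$ vanishing on $\Delta_1(\partial X)$ with $\alpha_Y(h(a))=\alpha_X(a)+\pi\sum_{b\in\Delta_3^1(X)}\varepsilon_{p(a),p(b)}g(\phi^{3,1}(b))$ for all $a\in\Delta_3^1(X)$ and $\ell_Y=\ell_X+\sum_{e}g(e)\sum_{a\in(\phi^{3,1})^{-1}(e)}(\frac13-\frac{\alpha_X(a)}\pi)$. It is based if $h$ is the identity. Forgetting levels gives gauge equivalence of shaped pseudo 3-manifolds; the same formulas apply to generalized shape structures. $S_r(X)$, $\tilde S_r(X)$, $\widetilde{LS}_r(X)$ are the sets of based gauge equivalence classes of shape structures, generalized shape structures and leveled generalized shape structures; $S_r(X)\subset\tilde S_r(X)$ is open and convex, and $\widetilde{LS}_r(X)\to\tilde S_r(X)$ is an affine $\mathbb R$-bundle. $\tilde\Omega_X$ is gauge invariant and descends to $\tilde\Omega_{X,r}\colon\tilde S_r(X)\to\mathbb R^{\Delta_1(X)}$. For $D\subset\Delta_1(X)$, $\tilde\Omega_{X,r}(D)^{-1}(2\pi)$ is the set of classes whose weight equals $2\pi$ on every edge of $D$. The Poisson structure on $\tilde S_r(X)$ is the one induced by reduction from the Neumann–Zagier symplectic structure on $\tilde S(X)$, whose Poisson bracket is $\{\alpha_a,\alpha_b\}=\varepsilon_{a,b}$, $a,b\in\Delta_3^{1/p}(X)$; its symplectic leaves are the fibers of $\tilde\Omega_{X,r}$.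 Shaped $3-2$ Pachner move: let $e$ be a balanced edge of $X$ shared by exactly three distinct tetrahedra $t_1,t_2,t_3$, forming a sub-pseudo-manifold $S$. Its underlying space has another triangulation $S_e$ with two tetrahedra, the same boundary triangulation, and $\Delta_1(S_e)=\Delta_1(S)\setminus\{e\}$. $X_e$ is obtained by replacing $S$ by $S_e$, with the unique shape structure on $S_e$ inducing the same weights as $S$. The move is leveled, from $(X,\ell_X)$ to $(X_e,\ell_{X_e})$, if moreover $\ell_{X_e}=\ell_X+\frac1{12\pi}\sum_{a\in(\phi^{3,1})^{-1}(e)}\sum_{b\in\Delta_3^1(X)}\varepsilon_{p(a),p(b)}\alpha_X(b)$. $X$ is a Pachner refinement of $Y$ if there is a finite sequence $X=X_1,\dots,X_n=Y$ where each $X_{i+1}$ is obtained from $X_i$ by a (leveled) shaped $3-2$ Pachner move. Two (leveled) shaped pseudo 3-manifolds $X,Y$ are equivalent if there are gauge equivalent (leveled) shaped pseudo 3-manifolds $X',Y'$ which are respective Pachner refinements of $X$ and $Y$. *)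

(* Defs.v *)
From HB Require Import structures.
From Stdlib Require Import Relation_Operators.
From mathcomp Require Import all_boot all_order all_algebra all_fingroup.
From mathcomp Require Import all_classical all_reals all_analysis.

Set Implicit Arguments.
Unset Strict Implicit.
Unset Printing Implicit Defensive.

Import Order.TTheory GRing.Theory Num.Theory.
Import numFieldNormedType.Exports.

Local Open Scope classical_set_scope.
Local Open Scope ring_scope.

(** * Oriented triangulated pseudo 3-manifolds

   A finite family of ordered 3-simplices whose vertices are named by 'I_4 in
   increasing order.  [positive t] says that the vertex order of [t] agrees
   with its orientation.  The pair [(t, i)] is the face of [t] opposite to the
   vertex [i]; with respect to its own vertex order, its boundary orientation
   is the sign of [t] times (-1)^i.  [glue] is the partial pairing of the faces;
   the identification of two paired faces is the unique vertex-order-preserving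
   affine map, so its reversing the orientation is the condition [glue_rev]. *)
Definition face_sign (T : finType) (pos : T -> bool) (f : T * 'I_4) : bool :=
  pos f.1 (+) odd f.2.

Record pseudo3 : Type := Pseudo3 {
  tet : finType;
  positive : tet -> bool;
  glue : tet * 'I_4 -> option (tet * 'I_4);
  glue_sym : forall f f', glue f = Some f' -> glue f' = Some f;
  glue_rev : forall f f', glue f = Some f' ->
    face_sign positive f' = ~~ face_sign positive f
}.

Definition edge4 : finType := {A : {set 'I_4} | #|A| == 2%N}.

Lemma edge4_img_proof (s : 'S_4) (A : edge4) : #|s @: val A| == 2%N.
Proof. by rewrite card_imset; [exact: (valP A) | exact: perm_inj]. Qed.

Definition edge4_img (s : 'S_4) (A : edge4) : edge4 :=
  exist (fun B : {set 'I_4} => #|B| == 2%N) (s @: val A) (edge4_img_proof s A).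

Section Cells.
Variable X : pseudo3.

(* Delta_3^1(X) *)
Definition corner : finType := (tet X * edge4)%type.

(* [lift_perm i j 1] maps 'I_4 minus i increasingly onto 'I_4 minus j: it is
   the vertex map of the identification of the face opposite to [i] with the
   face opposite to [j]. *)
Definition glue_corner : rel corner := fun a b =>
  [exists i : 'I_4, [exists j : 'I_4,
    [&& glue (a.1, i) == Some (b.1, j), i \notin val a.2
      & b.2 == edge4_img (lift_perm i j 1%g) a.2]]].

(* Delta_1(X); the block [val e] is the preimage of the edge [e] under
   phi^{3,1} : Delta_3^1(X) -> Delta_1(X). *)
Definition edge : finType :=
  {C : {set corner} |
    C \in equivalence_partition (connect glue_corner) [set: corner]}.

Lemma phi_proof (a : corner) :
  [set b in [set: corner] | connect glue_corner a b]%SET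
    \in equivalence_partition (connect glue_corner) [set: corner].
Proof. by apply/imsetP; exists a; rewrite ?inE. Qed.

Definition phi (a : corner) : edge :=
  exist (fun C => C \in equivalence_partition (connect glue_corner) [set: corner])
    _ (phi_proof a).

(* Delta_1(boundary of X): the edges contained in some unglued face *)
Definition bd_edge (e : edge) : bool :=
  [exists a in val e, [exists i : 'I_4,
    (i \notin val a.2) && (glue (a.1, i) == None)]].

(* The map p : Delta_3^1(X) -> Delta_3^{1/p}(X), a pair of opposite edges of a
   tetrahedron being given as the set of its two corners. *)
Definition opp_pair (a : corner) : {set corner} :=
  [set b : corner |
    (b.1 == a.1) && ((b.2 == a.2) || (val b.2 == ~: val a.2))]%SET.

(* If the order (s 0, s 1, s 2, s 3) of the vertices of a tetrahedron is
   compatible with its orientation, then the cyclic order of the edges at the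
   vertex s 0 is s0s1, s0s2, s0s3.  [cyc_next a b]: [b] follows [a] in the
   cyclic order at their common vertex. *)
Definition cyc_next (a b : corner) : bool :=
  (a.1 == b.1) && [exists s : 'S_4,
    [&& odd_perm s == ~~ positive a.1,
        val a.2 == [set s (inord 0); s (inord 1)]%SET
      & val b.2 == [set s (inord 0); s (inord 2)]%SET]].

Definition cyc_prec (c d : {set corner}) : bool :=
  [exists a in c, [exists b in d, cyc_next a b]].

Definition eps (c d : {set corner}) : int :=
  (cyc_prec c d)%:R - (cyc_prec d c)%:R.

End Cells.

(** * Shape structures, weights and gauge equivalence *)

Section Shapes.
Variable R : realType.

(* The space of real functions on Delta_3^1(X), as a space of row vectors in
   order to have its topology and its differential calculus. *)
Definition angles (X : pseudo3) := 'rV[R]_#|corner X|.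

Definition ang (X : pseudo3) (x : angles X) (a : corner X) : R :=
  x ord0 (enum_rank a).

Definition gshapes (X : pseudo3) : set (angles X) :=
  [set x | forall (t : tet X) (v : 'I_4),
    \sum_(A : edge4 | v \in val A) ang x (t, A) = pi].

Definition shapes (X : pseudo3) : set (angles X) :=
  [set x | gshapes x /\ forall a, 0 < ang x a].

Definition weight (X : pseudo3) (x : angles X) (e : edge X) : R :=
  \sum_(a in val e) ang x a.

Definition balanced (X : pseudo3) (x : angles X) (e : edge X) : Prop :=
  ~~ bd_edge e /\ weight x e = 2 * pi.

(* Isomorphisms of (oriented) cellular structures; the vertices of each
   tetrahedron may be permuted. *)
Record iso3 (X Y : pseudo3) : Type := Iso3 {
  iso_tet : tet X -> tet Y;
  iso_vtx : tet X -> 'S_4;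
  iso_bij : bijective iso_tet;
  iso_or : forall t,
    positive (iso_tet t) = positive t (+) odd_perm (iso_vtx t);
  iso_glue : forall t i,
    glue (iso_tet t, iso_vtx t i) =
    omap (fun f => (iso_tet f.1, iso_vtx f.1 f.2)) (glue (t, i));
  iso_face : forall t i t' j, glue (t, i) = Some (t', j) ->
    (lift_perm i j 1 * iso_vtx t' =
     iso_vtx t * lift_perm (iso_vtx t i) (iso_vtx t' j) 1)%g
}.

Definition iso_corner (X Y : pseudo3) (h : iso3 X Y) (a : corner X) : corner Y :=
  (iso_tet h a.1, edge4_img (iso_vtx h a.1) a.2).

Definition gauge_param (X : pseudo3) (g : edge X -> R) : Prop :=
  forall e, bd_edge e -> g e = 0.

Definition angle_shift (X : pseudo3) (g : edge X -> R) (a : corner X) : R :=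
  pi * \sum_(b : corner X) (eps (opp_pair a) (opp_pair b))%:~R * g (phi b).

Definition level_shift (X : pseudo3) (g : edge X -> R) (x : angles X) : R :=
  \sum_(e : edge X) g e * \sum_(a in val e) (3^-1 - ang x a / pi).

Definition based_gauge (X : pseudo3) (x y : angles X) : Prop :=
  exists2 g : edge X -> R, gauge_param g &
    forall a, ang y a = ang x a + angle_shift g a.

Definition based_lgauge (X : pseudo3) (x y : angles X * R^o) : Prop :=
  exists g : edge X -> R, [/\ gauge_param g,
    forall a, ang y.1 a = ang x.1 a + angle_shift g a &
    y.2 = x.2 + level_shift g x.1].

(** * Shaped pseudo 3-manifolds, Pachner moves and equivalence *)

Record shaped : Type := Shaped {
  base3 :> pseudo3;
  shape : angles base3;
  shapeP : shapes shape
}.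

Definition leveled : Type := (shaped * R)%type.

Definition gauge_equivalent (X Y : shaped) : Prop :=
  exists (h : iso3 X Y) (g : edge X -> R), gauge_param g /\
    forall a, ang (shape Y) (iso_corner h a) = ang (shape X) a + angle_shift g a.

Definition leveled_gauge_equivalent (X Y : leveled) : Prop :=
  exists (h : iso3 X.1 Y.1) (g : edge X.1 -> R), [/\ gauge_param g,
    forall a, ang (shape Y.1) (iso_corner h a)
              = ang (shape X.1) a + angle_shift g a &
    Y.2 = X.2 + level_shift g (shape X.1)].

(* For k <> l in 'I_5, the position of the vertex l in the facet opposite to k
   of the standard ordered 4-simplex, i.e. lift k (vpos k l) = l. *)
Definition vpos (k l : 'I_5) : 'I_4 := inord (unbump k l).

(* The 3-2 move along [e].  The bipyramid underlying S and S_e has five vertices,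
   ordered (the edges of S together with those of S_e contain all pairs) and
   hence named by 'I_5; its two triangulations are two complementary sets of
   facets of the standard 4-simplex.  The facets opposite to the elements of [K]
   form S, with [tau k] the corresponding tetrahedron of [X]; the two others
   form S_e, with tetrahedra [tau' k] of [Y].  The edge [e] joins the two
   vertices outside [K], and [rho] identifies the remaining tetrahedra. *)
Section Move.
Variables (X Y : pseudo3) (K : {set 'I_5}).
Variables (tau : 'I_5 -> tet X) (tau' : 'I_5 -> tet Y) (rho : tet X -> tet Y).

Let S : {set tet X} := tau @: K.
Let S' : {set tet Y} := tau' @: (~: K).

(* Correspondence of the faces of X which are not interior to S with the faces
   of Y which are not interior to S_e. *)
Definition outer_face (f : tet X * 'I_4) (f' : tet Y * 'I_4) : Prop :=
  (f.1 \notin S /\ f' = (rho f.1, f.2)) \/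
  (exists k l, [/\ k \in K, l \notin K,
     f = (tau k, vpos k l) & f' = (tau' l, vpos l k)]).

Definition replaces : Prop :=
  [/\ #|K| = 3%N,
      {in K &, injective tau} /\ {in ~: K &, injective tau'},
      {in ~: S &, injective rho} /\ rho @: (~: S) = ~: S',
      (exists s : bool,
        [/\ forall k, k \in K -> positive (tau k) = s (+) odd k,
            forall k, k \notin K -> positive (tau' k) = ~~ (s (+) odd k) &
            forall t, t \notin S -> positive (rho t) = positive t]) &
      [/\ forall k l, k \in K -> l \in K -> k != l ->
            glue (tau k, vpos k l) = Some (tau l, vpos l k),
          forall k l, k \notin K -> l \notin K -> k != l ->
            glue (tau' k, vpos k l) = Some (tau' l, vpos l k) &
          forall f f', outer_face f f' ->
            match glue f with
            | Some f1 => exists2 f1', outer_face f1 f1' & glue f' = Some f1'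
            | None => glue f' = None
            end]].

(* [e] is shared by the three tetrahedra of S and by no other *)
Definition central_edge (e : edge X) : Prop :=
  val e = [set a : corner X | [exists k in K,
            (a.1 == tau k) && (lift k @: val a.2 == ~: K)]]%SET.

(* The weight, in the triangulation of the bipyramid by the facets in [L], of
   the edge with vertex set [B] (there is no angle when B contains k). *)
Definition bipyramid_weight (Z : pseudo3) (z : angles Z) (L : {set 'I_5})
    (sigma : 'I_5 -> tet Z) (B : {set 'I_5}) : R :=
  \sum_(k in L) \sum_(A : edge4 | lift k @: val A == B) ang z (sigma k, A).

Definition same_angles (x : angles X) (y : angles Y) : Prop :=
  (forall t A, t \notin S -> ang y (rho t, A) = ang x (t, A)) /\
  (forall B : {set 'I_5}, #|B| = 2%N -> B != ~: K ->
    bipyramid_weight y (~: K) tau' B = bipyramid_weight x K tau B).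

End Move.

Definition pachner_along (X Y : shaped) (e : edge X) : Prop :=
  balanced (shape X) e /\
  exists (K : {set 'I_5}) (tau : 'I_5 -> tet X) (tau' : 'I_5 -> tet Y)
         (rho : tet X -> tet Y),
    [/\ replaces K tau tau' rho, central_edge K tau e &
        same_angles K tau tau' rho (shape X) (shape Y)].

Definition pachner (X Y : shaped) : Prop :=
  exists e : edge X, pachner_along Y e.

Definition leveled_pachner (X Y : leveled) : Prop :=
  exists2 e : edge X.1, pachner_along Y.1 e &
    Y.2 = X.2 + (12 * pi)^-1 *
      \sum_(a in val e) \sum_(b : corner X.1)
        (eps (opp_pair a) (opp_pair b))%:~R * ang (shape X.1) b.

Definition refines : shaped -> shaped -> Prop := clos_refl_trans_1n _ pachner.

Definition leveled_refines : leveled -> leveled -> Prop :=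
  clos_refl_trans_1n _ leveled_pachner.

Definition equivalent (X Y : shaped) : Prop :=
  exists X' Y', [/\ refines X' X, refines Y' Y & gauge_equivalent X' Y'].

Definition leveled_equivalent (X Y : leveled) : Prop :=
  exists X' Y', [/\ leveled_refines X' X, leveled_refines Y' Y &
    leveled_gauge_equivalent X' Y'].

(** * The reduced spaces

   A point of a reduced space is a based gauge equivalence class, i.e. a set of
   (leveled) angle assignments. *)

Definition gauge_class (X : pseudo3) (x : angles X) : set (angles X) :=
  [set y | based_gauge x y].

Definition lgauge_class (X : pseudo3) (x : angles X * R^o) :
    set (angles X * R^o) := [set y | based_lgauge x y].

(* [gen_classes], [shape_classes] and [lgen_classes] are the reduced spaces of
   generalized shape structures, shape structures (as a subset of the first)
   and leveled generalized shape structures. *)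
Definition gen_classes (X : pseudo3) : set (set (angles X)) :=
  @gauge_class X @` @gshapes X.

Definition shape_classes (X : pseudo3) : set (set (angles X)) :=
  @gauge_class X @` @shapes X.

Definition lgen_classes (X : pseudo3) : set (set (angles X * R^o)) :=
  @lgauge_class X @` [set x | gshapes x.1].

(* The weights being gauge invariant, they are computed on any representative. *)
Definition weight_r (X : pseudo3) (c : set (angles X)) : edge X -> R :=
  weight (get c).

Definition level_set (X : pseudo3) (D : {set edge X}) : set (set (angles X)) :=
  [set c | gen_classes c /\ forall e, e \in D -> weight_r c e = 2 * pi].

Definition edges_off (X : pseudo3) (D : {set edge X}) : finType :=
  {e : edge X | e \notin D}.

Definition proj_off (X : pseudo3) (D : {set edge X}) (w : edge X -> R) :
    edges_off D -> R := fun e => w (val e).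

(** * Smooth structures

   The reduced spaces and their level sets are quotients of affine subspaces of
   a normed space V: a function on them is smooth when, viewed as a function
   on this affine subspace, it extends to a smooth function on V. *)

Definition smooth (V : normedModType R) (f : V -> R^o) : Prop :=
  forall (vs : seq V) (x : V),
    differentiable (foldr (fun v (h : V -> R^o) => 'D_v h) f vs) x.

Definition smooth_lift (V : normedModType R) (Z : set (set V))
    (F : set V -> R) (f : V -> R^o) : Prop :=
  smooth f /\ forall c, Z c -> forall x, c x -> F c = f x.

Definition smooth_on (V : normedModType R) (Z : set (set V)) (F : set V -> R) :
    Prop := exists f, smooth_lift Z F f.

Definition smooth_map (V W : normedModType R) (Z : set (set V))
    (Z' : set (set W)) (Phi : set V -> set W) : Prop :=
  (forall c, Z c -> Z' (Phi c)) /\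
  (forall F, smooth_on Z' F -> smooth_on Z (F \o Phi)).

Definition diffeo (V W : normedModType R) (Z : set (set V)) (Z' : set (set W))
    (Phi : set V -> set W) : Prop :=
  exists Psi : set W -> set V,
    [/\ smooth_map Z Z' Phi, smooth_map Z' Z Psi,
        forall c, Z c -> Psi (Phi c) = c & forall c, Z' c -> Phi (Psi c) = c].

(** * The Poisson structure *)

Definition partial (X : pseudo3) (a : corner X) (f : angles X -> R^o) :
    angles X -> R^o := 'D_(delta_mx ord0 (enum_rank a)) f.

(* The bracket such that {ang a, ang b} = eps (opp_pair a) (opp_pair b).  The
   generalized shape structures form a symplectic leaf of it. *)
Definition nz_bracket (X : pseudo3) (f g : angles X -> R^o) : angles X -> R^o :=
  fun x => \sum_(a : corner X) \sum_(b : corner X)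
    (eps (opp_pair a) (opp_pair b))%:~R * partial a f x * partial b g x.

(* [H] is the bracket of [F] and [G] in the Poisson structure on [Z] obtained by
   reduction. *)
Definition is_bracket (X : pseudo3) (Z : set (set (angles X)))
    (F G H : set (angles X) -> R) : Prop :=
  forall f g, smooth_lift Z F f -> smooth_lift Z G g ->
    forall c, Z c -> forall x, c x -> H c = nz_bracket f g x.

(* The reduced bracket restricts to [Z]: in particular it depends neither on
   the lifts nor on the representatives. *)
Definition poisson_submanifold (X : pseudo3) (Z : set (set (angles X))) : Prop :=
  forall F G, smooth_on Z F -> smooth_on Z G ->
    exists2 H, smooth_on Z H & is_bracket Z F G H.

Definition poisson_iso (X Y : pseudo3) (Z : set (set (angles X)))
    (Z' : set (set (angles Y))) (Phi : set (angles X) -> set (angles Y)) : Prop :=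
  [/\ poisson_submanifold Z, poisson_submanifold Z', diffeo Z Z' Phi &
      forall F G H, smooth_on Z' F -> smooth_on Z' G -> is_bracket Z' F G H ->
        is_bracket Z (F \o Phi) (G \o Phi) (H \o Phi)].

(** * The affine R-bundle of levels *)

Definition forget_level (X : pseudo3) (c : set (angles X * R^o)) :
    set (angles X) := fst @` c.

(* The action of R on the fibres. *)
Definition translate (X : pseudo3) (s : R) (c : set (angles X * R^o)) :
    set (angles X * R^o) := (fun x => (x.1, x.2 + s)) @` c.

Definition levels_over (X : pseudo3) (Z : set (set (angles X))) :
    set (set (angles X * R^o)) :=
  [set c | lgen_classes c /\ Z (forget_level c)].

(* Isomorphisms of affine R-bundles, i.e. of bundles of R-torsors. *)
Definition affine_bundle_iso_over (X Y : pseudo3) (Z : set (set (angles X)))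
    (Z' : set (set (angles Y))) (Phi : set (angles X) -> set (angles Y))
    (Psi : set (angles X * R^o) -> set (angles Y * R^o)) : Prop :=
  [/\ diffeo (levels_over Z) (levels_over Z') Psi,
      forall c, levels_over Z c -> forget_level (Psi c) = Phi (forget_level c) &
      forall c s, levels_over Z c -> Psi (translate s c) = translate s (Psi c)].

(** * Open and convex sets of classes *)

Definition open_in (X : pseudo3) (Z U : set (set (angles X))) : Prop :=
  U `<=` Z /\ exists2 O : set (angles X), open O &
    forall c, Z c -> forall x, c x -> (U c <-> O x).

Definition convex_classes (X : pseudo3) (U : set (set (angles X))) : Prop :=
  forall c0 c1 x0 x1 (s : R), U c0 -> U c1 -> c0 x0 -> c1 x1 -> 0 <= s <= 1 ->
    U (gauge_class ((1 - s) *: x0 + s *: x1)).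

End Shapes.

Arguments gshapes : clear implicits.
Arguments shapes : clear implicits.
Arguments gen_classes : clear implicits.
Arguments shape_classes : clear implicits.
Arguments lgen_classes : clear implicits.
Arguments level_set R [X] D.
Arguments proj_off [R X] D w _.

(* Main.v *)
(** A gauge transformation translates the angles along the Hamiltonian direction of a
    combination of weights of internal edges; these directions preserve all weights because
    the contributions of two glued faces to the bracket of two weights cancel.

    A 3-2 move along e expresses each angle of the two new tetrahedra as a sum of two angles
    of the old ones.  This linear map is Poisson, matches the weights of the remaining edges
    on the locus where e has weight 2pi, and only forgets the gauge direction of e; both facts
    come from one identity: over the five facets of a 4-simplex, the brackets of two given
    edges add up to zero.  Hence the move identifies the reduced space of X_e with the level
    set of e in that of X, and a linear function of the angles corrects the levels.

    A chain of moves and gauge equivalences connecting X to Y therefore identifies the level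
    sets of the edges destroyed on either side inside a common refinement.  All
    identifications are induced by linear maps of the angles, which gives smoothness and
    convexity, and the classes of the two given shape structures correspond to each other. *)
From HB Require Import structures.
From mathcomp Require Import all_classical.
From mathcomp Require Import all_boot all_order all_algebra all_fingroup.
From mathcomp Require Import all_reals all_analysis.
From mathcomp Require Import zify ring lra.
Require Import Defs.
Set Implicit Arguments.
Unset Strict Implicit.
Unset Printing Implicit Defensive.
Import Order.TTheory GRing.Theory Num.Theory.
Local Open Scope ring_scope.

(** * One tetrahedron *)

(** The linear map of a move is not invertible and its section depends on a choice, so statements
    about inverses hold only modulo gauge directions. This is why the Poisson property is required
    only for covectors that vanish on gauge directions, and why for the section it is deduced
    instead of computed: the round trip moves tangent vectors of a level set along gauge directions
    only, hence changes such a covector by one that vanishes on tangent vectors. The latter is a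
    combination of vertex sums and of weights of constrained edges, and its bracket with
    gauge-invariant covectors is 0. Identifications of different level sets compose only after their
    constraints are made equal. The given shapes are carried along as base points for this purpose:
    they keep the restricted level sets non-empty, and in the end they provide a point of [U]. The
    constant 12 comes from the double bracket with the central edge. Inside one tetrahedron it is -4
    at that edge and its opposite and 2 elsewhere; divided by -12 this is 1/3 and -1/6, which
    corrects the terms 1/3 of the level formula when three tetrahedra become two. *)

Definition edge4C_subproof (A : edge4) : #|~: val A| == 2%N.
Proof. by rewrite cardsCs setCK card_ord (eqP (valP A)). Qed.

Definition edge4C (A : edge4) : edge4 :=
  exist (fun B : {set 'I_4} => #|B| == 2%N) (~: val A) (edge4C_subproof A).

Lemma edge4CK : involutive edge4C.
Proof. by move=> A; apply/val_inj; rewrite /= setCK. Qed.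

Lemma edge4_imgM (r s : 'S_4) (A : edge4) :
  edge4_img (r * s)%g A = edge4_img s (edge4_img r A).
Proof.
apply/val_inj => /=; rewrite -imset_comp; apply: eq_imset => x.
by rewrite /= permM.
Qed.

Lemma edge4_img1 (A : edge4) : edge4_img 1%g A = A.
Proof.
apply/val_inj => /=; rewrite -[RHS]imset_id; apply: eq_imset => x.
by rewrite perm1.
Qed.

Lemma edge4_imgK (r : 'S_4) : cancel (edge4_img r) (edge4_img r^-1%g).
Proof. by move=> A; rewrite -edge4_imgM mulgV edge4_img1. Qed.

Lemma edge4_imgKV (r : 'S_4) : cancel (edge4_img r^-1%g) (edge4_img r).
Proof. by move=> A; rewrite -edge4_imgM mulVg edge4_img1. Qed.

Lemma mem_edge4_img (r : 'S_4) (A : edge4) x :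
  (r x \in val (edge4_img r A)) = (x \in val A).
Proof. by rewrite /= mem_imset //; exact: perm_inj. Qed.

(** The relation [cyc_next] inside one tetrahedron, with the orientation as a parameter: a
    relabelling of the vertices then acts on this parameter through its sign. *)
Definition cyc4 (pos : bool) (A B : edge4) : bool :=
  [exists s : 'S_4, [&& odd_perm s == ~~ pos,
        val A == [set s (inord 0); s (inord 1)]
      & val B == [set s (inord 0); s (inord 2)]]].

Lemma cyc4_img pos (r : 'S_4) A B :
  cyc4 pos (edge4_img r A) (edge4_img r B) = cyc4 (pos (+) odd_perm r) A B.
Proof.
have H : forall pos (r : 'S_4) A B, cyc4 (pos (+) odd_perm r) A B ->
    cyc4 pos (edge4_img r A) (edge4_img r B).
  move=> {}pos {}r {}A {}B /existsP[s /and3P[/eqP so /eqP sA /eqP sB]].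
  apply/existsP; exists (s * r)%g; rewrite odd_permM so /= sA sB !imsetU1 !imset_set1.
  by rewrite !permM !eqxx !andbT; case: pos {so} (odd_perm r) => [] [].
apply/idP/idP; last exact: H.
move=> Hc; rewrite -[A](edge4_imgK r) -[B](edge4_imgK r); apply: H.
by rewrite odd_permV -addbA addbb addbF.
Qed.

Definition i4 (k : nat) : 'I_4 := inord k.

Lemma i4E k : (k < 4)%N -> val (i4 k) = k.
Proof. exact: inordK. Qed.

Lemma ord4P (P : 'I_4 -> Prop) :
  P (i4 0) -> P (i4 1) -> P (i4 2) -> P (i4 3) -> forall x, P x.
Proof.
move=> P0 P1 P2 P3 [k hk].
have -> : Ordinal hk = i4 k by apply/val_inj; rewrite /= i4E.
by case: k hk => [|[|[|[|]]]].
Qed.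

Lemma i4_eq k l : (k < 4)%N -> (l < 4)%N -> (i4 k == i4 l) = (k == l).
Proof. by move=> hk hl; rewrite -val_eqE /= !i4E. Qed.

(** Precomposing the witness with the transposition of 1 and 2 exchanges the two edges and changes
    the parity. *)
Lemma cyc4N pos A B : cyc4 (~~ pos) A B = cyc4 pos B A.
Proof.
have H : forall pos A B, cyc4 (~~ pos) A B -> cyc4 pos B A.
  move=> {}pos {}A {}B /existsP[s /and3P[/eqP so /eqP sA /eqP sB]].
  apply/existsP; exists (tperm (i4 1) (i4 2) * s)%g.
  rewrite odd_permM odd_tperm !permM so tpermL tpermR tpermD ?i4_eq //.
  by rewrite sA sB !eqxx; case: pos {so}.
by apply/idP/idP => [/H//|h]; apply: H; rewrite negbK.
Qed.

(** An even permutation that carries the edge 01 to its opposite 23 and preserves 02. Precomposing a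
    witness with it replaces one edge of a cyclic pair by the opposite one without changing the
    orientation. *)
Definition klein : 'S_4 := (tperm (i4 0) (i4 2) * tperm (i4 1) (i4 3))%g.

Lemma set_perm4 (s : 'S_4) : 
  [set s (i4 0); s (i4 1)] = ~: [set s (i4 2); s (i4 3)].
Proof.
apply/setP => x; rewrite -(permKV s x) !inE.
by move: (s^-1%g x); apply: ord4P; rewrite !(inj_eq (@perm_inj _ s)) !i4_eq.
Qed.

Lemma cyc4Cl pos A B : cyc4 pos (edge4C A) B = cyc4 pos A B.
Proof.
have H : forall A, cyc4 pos A B -> cyc4 pos (edge4C A) B.
  move=> {}A /existsP[s /and3P[/eqP so /eqP sA /eqP sB]].
  apply/existsP; exists (klein * s)%g.
  rewrite !permM !odd_permM !odd_tperm -!/(i4 _) !i4_eq //= so eqxx /=.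
  have [-> ->]: tperm (i4 0) (i4 2) (i4 0) = i4 2 /\ tperm (i4 1) (i4 3) (i4 2) = i4 2.
    by rewrite tpermL tpermD ?i4_eq.
  have [-> ->]: tperm (i4 0) (i4 2) (i4 1) = i4 1 /\ tperm (i4 1) (i4 3) (i4 1) = i4 3.
    by rewrite tpermL tpermD ?i4_eq.
  have [-> ->]: tperm (i4 0) (i4 2) (i4 2) = i4 0 /\ tperm (i4 1) (i4 3) (i4 0) = i4 0.
    by rewrite tpermR tpermD ?i4_eq.
  by rewrite sA sB -!/(i4 _) set_perm4 setCK eqxx /= setUC.
by apply/idP/idP => [/H|/H//]; rewrite edge4CK.
Qed.

Lemma cyc4Cr pos A B : cyc4 pos A (edge4C B) = cyc4 pos A B.
Proof. by rewrite -cyc4N cyc4Cl cyc4N. Qed.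

Lemma cyc4_irr pos A : cyc4 pos A A = false.
Proof.
apply/existsP => -[s /and3P[_ /eqP -> /eqP /setP /(_ (s (inord 1)))]].
by rewrite !inE !(inj_eq (@perm_inj _ s)) !i4_eq // eqxx.
Qed.

(** Witnesses [s] and [r] for the two orders agree at 0, the common vertex, and at 3, and have their
    values at 1 and 2 exchanged; so their parities differ. *)
Lemma cyc4_asym pos A B : cyc4 pos A B -> cyc4 pos B A = false.
Proof.
move=> /existsP[s /and3P[/eqP so /eqP sA /eqP sB]].
apply/existsP => -[r /and3P[/eqP ro /eqP rB /eqP rA]].
have e0 : s (i4 0) = r (i4 0).
  have /setP E : val A :&: val B = val A :&: val B by [].
  have := E (r (i4 0)); rewrite {1}sA {1}sB {1}rA {1}rB !inE !eqxx /=.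
  case: (eqVneq (r (i4 0)) (s (i4 0))) => [->//|_] /=.
  have [->|//] := eqVneq (r (i4 0)) (s (i4 1)).
  by rewrite (inj_eq perm_inj) i4_eq.
have e1 : s (i4 1) = r (i4 2).
  have := congr1 (fun S : {set 'I_4} => s (i4 1) \in S) (etrans (esym sA) rA).
  rewrite !inE eqxx orbT -/(i4 0) -/(i4 2) -e0 (inj_eq perm_inj) i4_eq //= => h.
  exact/eqP/esym.
have e2 : s (i4 2) = r (i4 1).
  have := congr1 (fun S : {set 'I_4} => s (i4 2) \in S) (etrans (esym sB) rB).
  rewrite !inE eqxx orbT -/(i4 0) -/(i4 1) -e0 (inj_eq perm_inj) i4_eq //= => h.
  exact/eqP/esym.
have e3 : s (i4 3) = r (i4 3).
  suff H : forall x, r x = s (i4 3) -> x = i4 3.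
    by rewrite -[LHS](permKV r) (H _ (permKV r _)).
  apply: ord4P => //.
  - by rewrite -e0 => /perm_inj/eqP; rewrite i4_eq.
  - by rewrite -e2 => /perm_inj/eqP; rewrite i4_eq.
  - by rewrite -e1 => /perm_inj/eqP; rewrite i4_eq.
have E : r = (tperm (i4 1) (i4 2) * s)%g.
  apply/permP => x; rewrite permM; move: x; apply: ord4P.
  - by rewrite tpermD ?i4_eq.
  - by rewrite tpermL.
  - by rewrite tpermR.
  - by rewrite tpermD ?i4_eq.
by move: ro; rewrite E odd_permM so odd_tperm i4_eq //; case: pos {so}.
Qed.

(** The common vertex, the two other ends and the fourth vertex define a permutation; either it or
    its composite with the transposition of 1 and 2 has the required parity. *)
Lemma cyc4_total pos (a b c : 'I_4) (A B : edge4) :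
  a != b -> a != c -> b != c -> val A = [set a; b] -> val B = [set a; c] ->
  cyc4 pos A B (+) cyc4 pos B A.
Proof.
move=> ab ac bc hA hB.
suff: cyc4 pos A B || cyc4 pos B A.
  by case/orP => h; rewrite h (cyc4_asym h).
have [s [s0 s1 s2]] : exists s : 'S_4, [/\ s (i4 0) = a, s (i4 1) = b & s (i4 2) = c].
  have [d [da db dc]] : exists d : 'I_4, [/\ d != a, d != b & d != c].
    have : (0 < #|~: [set a; b; c]|)%N.
      by rewrite cardsCs setCK setUC cardsU1 cards2 card_ord !inE ab !(eq_sym c) (negPf bc) (negPf ac).
    case/card_gt0P => d; rewrite !inE !negb_or => /andP[/andP[? ?] ?].
    by exists d.
  pose f (x : 'I_4) := nth d [:: a; b; c; d] x.
  have fi : injective f.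
    have : uniq [:: a; b; c; d] by rewrite /= !inE !negb_or ab ac bc ![_ == d]eq_sym da db dc.
    move=> u x y /eqP; rewrite nth_uniq //; [by move=> /eqP/val_inj | exact: ltn_ord..].
  exists (perm fi); rewrite !permE /f !i4E //.
have [so|so] := eqVneq (odd_perm s) (~~ pos).
  apply/orP; left; apply/existsP; exists s.
  by rewrite so hA hB -/(i4 0) -/(i4 1) -/(i4 2) s0 s1 s2 !eqxx.
apply/orP; right; apply/existsP; exists (tperm (i4 1) (i4 2) * s)%g.
rewrite odd_permM odd_tperm !permM -/(i4 0) -/(i4 1) -/(i4 2) tpermL tpermR tpermD ?i4_eq //.
by rewrite s0 s1 s2 hA hB !eqxx !andbT; case: pos (odd_perm s) so => [] [].
Qed.

Section Eps.
Variable (R : realType).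

(** Defined on single edges; [eps4Cl] and [eps4Cr] show that only the pairs of opposite edges
    matter, and [epsE] identifies it with [eps]. *)
Definition eps4 (pos : bool) (A B : edge4) : R :=
  (cyc4 pos A B)%:R - (cyc4 pos B A)%:R.

Lemma eps4_img pos (r : 'S_4) A B :
  eps4 pos (edge4_img r A) (edge4_img r B) = eps4 (pos (+) odd_perm r) A B.
Proof. by rewrite /eps4 !cyc4_img. Qed.

Lemma eps4N pos A B : eps4 (~~ pos) A B = - eps4 pos A B.
Proof. by rewrite /eps4 !cyc4N opprB. Qed.

Lemma eps4_asym pos A B : eps4 pos A B = - eps4 pos B A.
Proof. by rewrite /eps4 opprB. Qed.

Lemma eps4Cl pos A B : eps4 pos (edge4C A) B = eps4 pos A B.
Proof. by rewrite /eps4 cyc4Cl cyc4Cr. Qed.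

Lemma eps4Cr pos A B : eps4 pos A (edge4C B) = eps4 pos A B.
Proof. by rewrite /eps4 cyc4Cl cyc4Cr. Qed.

Lemma eps4_irr pos A : eps4 pos A A = 0.
Proof. by rewrite /eps4 cyc4_irr subrr. Qed.

Lemma eps4_opp pos A : eps4 pos A (edge4C A) = 0.
Proof. by rewrite eps4Cr eps4_irr. Qed.

Lemma eps4_sqr pos (a b c : 'I_4) (A B : edge4) :
  a != b -> a != c -> b != c -> val A = [set a; b] -> val B = [set a; c] ->
  eps4 pos A B ^+ 2 = 1.
Proof.
move=> ab ac bc hA hB; have := cyc4_total pos ab ac bc hA hB; rewrite /eps4.
by case: cyc4; case: cyc4 => //= _; rewrite ?subr0 ?sub0r ?sqrrN expr1n.
Qed.

(* The three edges at a vertex are cyclically permuted by an even permutation. *)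
Lemma eps4_cyc pos (a b c d : 'I_4) (A B C : edge4) :
  uniq [:: a; b; c; d] ->
  val A = [set a; b] -> val B = [set a; c] -> val C = [set a; d] ->
  eps4 pos B C = eps4 pos A B.
Proof.
rewrite /= !inE !negb_or andbT.
move=> /andP[/and3P[ab ac ad] /andP[/andP[bc bd] cd]] hA hB hC.
pose r : 'S_4 := (tperm b c * tperm b d)%g.
have ra : r a = a by rewrite permM !tpermD // eq_sym.
have rb : r b = c by rewrite permM tpermL tpermD // eq_sym.
have rc : r c = d by rewrite permM tpermR tpermL.
have -> : B = edge4_img r A.
  by apply/val_inj; rewrite /= hA imsetU1 imset_set1 ra rb.
have -> : C = edge4_img r B.
  by apply/val_inj; rewrite /= hB imsetU1 imset_set1 ra rc.
have -> : B = edge4_img r A.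
  by apply/val_inj; rewrite /= hA imsetU1 imset_set1 ra rb.
by rewrite eps4_img odd_permM !odd_tperm bc bd addbF.
Qed.

End Eps.

(** Distinctness does not depend on the order of the vertices: the two lists are compared through
    counts, which [lia] decides. *)
Ltac reorder u := clear - u; move: u;
  match goal with |- is_true (uniq ?l) -> is_true (uniq ?l') =>
    rewrite (@perm_uniq _ l l') //; apply/seq.permP => Q /=; lia end.

Fact edge01_subproof : #|[set i4 0; i4 1]| == 2%N.
Proof. by rewrite cards2 i4_eq. Qed.

(** Total in both arguments: for [a = b] the value is the default edge 01. Locked so that
    simplification does not unfold [insubd]. *)
Definition mkedge : 'I_4 -> 'I_4 -> edge4 := locked (fun a b =>
  insubd (exist (fun B : {set 'I_4} => #|B| == 2%N) _ edge01_subproof) [set a; b]).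

Lemma val_mkedge a b : a != b -> val (mkedge a b) = [set a; b].
Proof. by move=> ab; rewrite /mkedge -lock val_insubd cards2 ab. Qed.

Lemma mkedgeC a b : mkedge a b = mkedge b a.
Proof. by rewrite /mkedge -lock (setUC [set a]). Qed.

Lemma mkedge_val (A : edge4) a b : val A = [set a; b] -> A = mkedge a b.
Proof.
move=> h; apply/val_inj; rewrite h val_mkedge //; apply: contraTneq (valP A).
by rewrite h => ->; rewrite cards2 eqxx.
Qed.

Lemma edge4P (A : edge4) : exists a b, a != b /\ A = mkedge a b.
Proof.
have /cards2P[a [b [ab h]]] := valP A.
by exists a, b; split => //; exact: mkedge_val.
Qed.

Lemma uniq4_mem (a b c d x : 'I_4) : uniq [:: a; b; c; d] -> x \in [:: a; b; c; d].
Proof.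
move=> u; have [] // := @uniq_min_size _ [:: a; b; c; d] (enum 'I_4) u.
- by move=> y _; rewrite mem_enum.
- by rewrite size_enum_ord.
by move=> _ ->; rewrite mem_enum.
Qed.

Lemma mem_pairs4 (I T : eqType) (m : I -> I -> T) (a b c d x y : I) :
  (forall i j, m i j = m j i) -> x \in [:: a; b; c; d] -> y \in [:: a; b; c; d] ->
  x != y -> m x y \in [:: m a b; m a c; m a d; m c d; m b d; m b c].
Proof.
move=> mC; rewrite !inE => /or4P[] /eqP -> /or4P[] /eqP ->; rewrite ?eqxx ?orbT // => _;
by rewrite mC ?eqxx ?orbT.
Qed.

Lemma mkedgeP (a b c d : 'I_4) (A : edge4) : uniq [:: a; b; c; d] ->
  A \in [:: mkedge a b; mkedge a c; mkedge a d; mkedge c d; mkedge b d; mkedge b c].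
Proof.
move=> u; have [x [y [xy ->]]] := edge4P A.
exact: mem_pairs4 mkedgeC (uniq4_mem x u) (uniq4_mem y u) xy.
Qed.

Lemma uniq_mkedge (a b c d : 'I_4) : uniq [:: a; b; c; d] ->
  uniq [:: mkedge a b; mkedge a c; mkedge a d; mkedge c d; mkedge b d; mkedge b c].
Proof.
move=> u; apply: (leq_size_uniq (enum_uniq edge4) (fun A _ => mkedgeP A u)).
by rewrite -cardE card_sig -cardsE card_draws card_ord.
Qed.

(** The three edges at [a] come first, followed by their opposites in the same order; [eps4_square]
    relies on this. *)
Lemma sum_edge4 (R : nmodType) (F : edge4 -> R) (a b c d : 'I_4) :
  uniq [:: a; b; c; d] ->
  \sum_A F A = F (mkedge a b) + (F (mkedge a c) + (F (mkedge a d) +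
    (F (mkedge c d) + (F (mkedge b d) + F (mkedge b c))))).
Proof.
move=> u; transitivity (\sum_(A <- [:: mkedge a b; mkedge a c; mkedge a d;
     mkedge c d; mkedge b d; mkedge b c]) F A); last first.
  by rewrite !big_cons big_nil addr0.
rewrite [RHS]big_uniq ?uniq_mkedge //.
by apply: eq_bigl => A; rewrite (mkedgeP A u).
Qed.

Lemma sum_edge4_at (R : nmodType) (F : edge4 -> R) (a b c d : 'I_4) :
  uniq [:: a; b; c; d] ->
  \sum_(A : edge4 | a \in val A) F A =
    F (mkedge a b) + (F (mkedge a c) + F (mkedge a d)).
Proof.
move=> u; rewrite big_mkcond (sum_edge4 _ u).
move: u; rewrite /= !inE !negb_or andbT.
move=> /andP[/and3P[ab ac ad] /andP[/andP[bc bd] cd]].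
rewrite !val_mkedge // !inE eqxx /= !(negPf ab) !(negPf ac) !(negPf ad) /=.
by rewrite !addr0.
Qed.

Lemma mkedgeC4 (a b c d : 'I_4) : uniq [:: a; b; c; d] ->
  edge4C (mkedge a b) = mkedge c d.
Proof.
move=> u; apply/mkedge_val => /=; apply/setP => x.
have := u; rewrite /= !inE !negb_or andbT.
move=> /andP[/and3P[ab ac ad] /andP[/andP[bc bd] cd]].
rewrite val_mkedge // !inE.
have := u; rewrite -rev_uniq /= !inE !negb_or andbT.
move=> /andP[/and3P[dc db da] /andP[/andP[cb ca] ba]].
by have := uniq4_mem x u; rewrite !inE => /or4P[] /eqP ->;
  rewrite ?eqxx ?(negPf ab) ?(negPf ac) ?(negPf ad) ?(negPf bc) ?(negPf bd) ?(negPf cd)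
    ?(negPf ba) ?(negPf ca) ?(negPf da) ?(negPf cb) ?(negPf db) ?(negPf dc).
Qed.

Lemma ex_uniq4 (a b : 'I_4) : a != b -> exists c d, uniq [:: a; b; c; d].
Proof.
move=> ab.
have /cards2P[c [d [cd h]]] := edge4C_subproof (mkedge a b).
exists c, d; rewrite /= !inE !negb_or ab cd !andbT /=.
have hc : c \in ~: val (mkedge a b) by rewrite h !inE eqxx.
have hd : d \in ~: val (mkedge a b) by rewrite h !inE eqxx orbT.
move: hc hd; rewrite val_mkedge // !inE !negb_or ![c == _]eq_sym ![d == _]eq_sym.
by move=> /andP[-> ->] /andP[-> ->].
Qed.

Section EpsSums.
Variable (R : realType).
Implicit Type pos : bool.

Lemma eps4_turn pos a b c d : uniq [:: a; b; c; d] ->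
  eps4 R pos (mkedge a c) (mkedge a d) = eps4 R pos (mkedge a b) (mkedge a c).
Proof.
move=> u; have := u; rewrite /= !inE !negb_or andbT.
move=> /andP[/and3P[ab ac ad] _].
by apply: (eps4_cyc _ _ u); rewrite val_mkedge.
Qed.

(** [B] may be replaced by its opposite, hence assumed to contain [v]; then one of the other edges
    at [v] follows [B] in the cyclic order and the other precedes it, with opposite signs. Thus the
    angle sum at a vertex is a Casimir. *)
Lemma eps4_vertex pos v (B : edge4) :
  \sum_(A : edge4 | v \in val A) eps4 R pos A B = 0.
Proof.
suff H : forall B : edge4, v \in val B -> \sum_(A : edge4 | v \in val A) eps4 R pos A B = 0.
  have [/H//|h] := boolP (v \in val B).
  rewrite -[RHS](H (edge4C B)) /= ?inE //.
  by apply: eq_bigr => A _; rewrite eps4Cr.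
move=> {}B; have [x [b [xb ->]]] := edge4P B.
rewrite val_mkedge // !inE => vB.
have {x xb vB} [w [vw ->]] : exists w, v != w /\ mkedge x b = mkedge v w.
  case/orP: vB => /eqP E; subst; first by exists b.
  by exists x; rewrite mkedgeC eq_sym.
have [c [d u]] := ex_uniq4 vw.
rewrite (sum_edge4_at _ u) eps4_irr add0r (eps4_asym _ _ (mkedge v c)).
have u' : uniq [:: v; c; d; w].
  move: u; rewrite /= !inE !negb_or !andbT (eq_sym c w) (eq_sym d w).
  by move=> /andP[/and3P[-> -> ->] /andP[/andP[-> ->] ->]].
by rewrite (eps4_turn pos u') (eps4_turn pos u) addNr.
Qed.

(* Two distinct non-opposite edges lie in exactly one face. *)
Lemma eps4_faces pos (A B : edge4) :
  \sum_(i : 'I_4 | (i \notin val A) && (i \notin val B)) eps4 R pos A B = eps4 R pos A B.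
Proof.
rewrite sumr_const.
have H : forall A B : edge4, cyc4 pos A B ->
    #|[pred i : 'I_4 | (i \notin val A) && (i \notin val B)]| = 1%N.
  move=> {}A {}B /existsP[s /and3P[_ /eqP -> /eqP ->]].
  rewrite -/(i4 0) -/(i4 1) -/(i4 2) -[RHS](card1 (s (i4 3))); apply: eq_card => x.
  rewrite -(permKV s x) !inE !(inj_eq perm_inj).
  by move: (s^-1%g x); apply: ord4P; rewrite !i4_eq.
rewrite /eps4; case hA: (cyc4 pos A B); first by rewrite (H _ _ hA).
case hB: (cyc4 pos B A); last by rewrite subrr mul0rn.
rewrite (eq_card (B := [pred i : 'I_4 | (i \notin val B) && (i \notin val A)])).
  by rewrite (H _ _ hB).
by move=> i; rewrite !inE andbC.
Qed.

End EpsSums.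

(** * Edges and gauge directions *)

Section Gluing.
Variable X : pseudo3.

Lemma lift_perm1M n (i j k : 'I_n.+1) :
  (lift_perm i j 1 * lift_perm j k 1)%g = lift_perm i k 1%g.
Proof. by rewrite lift_permM mulg1. Qed.

Lemma lift_perm1_id n (i : 'I_n.+1) : lift_perm i i 1%g = 1%g.
Proof. exact: lift_perm1. Qed.

Lemma notin_lift_img (i j : 'I_4) (A : edge4) :
  (j \notin val (edge4_img (lift_perm i j 1%g) A)) = (i \notin val A).
Proof. by rewrite -{1}(lift_perm_id i j 1%g) mem_edge4_img. Qed.

Lemma glue_cornerP (a b : corner X) :
  reflect (exists i j, [/\ glue (a.1, i) = Some (b.1, j), i \notin val a.2 &
    b.2 = edge4_img (lift_perm i j 1%g) a.2]) (glue_corner a b).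
Proof.
apply: (iffP existsP) => [[i /existsP[j /and3P[/eqP h1 h2 /eqP h3]]]|[i [j [h1 h2 h3]]]].
  by exists i, j.
by exists i; apply/existsP; exists j; rewrite h1 h2 h3 !eqxx.
Qed.

Lemma glue_corner_sym : symmetric (@glue_corner X).
Proof.
have H a b : glue_corner a b -> @glue_corner X b a.
  case/glue_cornerP => i [j [h1 h2 h3]]; apply/glue_cornerP; exists j, i.
  rewrite (glue_sym h1) h3 notin_lift_img h2 -edge4_imgM lift_perm1M lift_perm1_id.
  by rewrite edge4_img1.
by move=> a b; apply/idP/idP; exact: H.
Qed.

Lemma connect_corner_sym : connect_sym (@glue_corner X).
Proof. exact: sym_connect_sym glue_corner_sym. Qed.

Lemma mem_val_phi (a b : corner X) : (b \in val (phi a)) = connect (@glue_corner X) a b.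
Proof. by rewrite /= !inE. Qed.

Lemma phi_eq (a b : corner X) : (phi a == phi b) = connect (@glue_corner X) a b.
Proof.
apply/eqP/idP => [h|h].
  by rewrite -mem_val_phi h mem_val_phi connect0.
apply/val_inj/setP => c; rewrite !mem_val_phi.
exact: (same_connect connect_corner_sym h).
Qed.

Lemma phiP (e : edge X) : exists a, e = phi a.
Proof.
case: e => C hC; have /imsetP[a _ h] := hC.
exists a; apply/val_inj; rewrite /= h; apply/setP => b; by rewrite !inE.
Qed.

Lemma mem_edge (e : edge X) (a : corner X) : (a \in val e) = (phi a == e).
Proof. by have [b ->] := phiP e; rewrite mem_val_phi phi_eq connect_corner_sym. Qed.

Lemma glue_corner_phi (a b : corner X) : glue_corner a b -> phi a = phi b.
Proof. by move=> h; apply/eqP; rewrite phi_eq connect1. Qed.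

Lemma bd_edgeP (e : edge X) :
  reflect (exists a i, [/\ phi a = e, i \notin val a.2 & glue (a.1, i) = None]) (bd_edge e).
Proof.
apply: (iffP existsP) => [[a /andP[ae /existsP[i /andP[h1 /eqP h2]]]]|[a [i [h1 h2 h3]]]].
  by exists a, i; split => //; apply/eqP; rewrite -mem_edge.
by exists a; rewrite mem_edge h1 eqxx; apply/existsP; exists i; rewrite h2 h3 eqxx.
Qed.

Lemma cyc_nextE (a b : corner X) :
  cyc_next a b = (a.1 == b.1) && cyc4 (positive a.1) a.2 b.2.
Proof. by []. Qed.

(** A witness of [cyc_prec] may use either edge of each opposite pair; [cyc4Cl] and [cyc4Cr] move it
    to the given representatives. *)
Lemma epsE (R : realType) (a b : corner X) :
  (eps (opp_pair a) (opp_pair b))%:~R =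
    (a.1 == b.1)%:R * eps4 R (positive a.1) a.2 b.2.
Proof.
have H (c d : corner X) : cyc_prec (opp_pair c) (opp_pair d) =
    (c.1 == d.1) && cyc4 (positive c.1) c.2 d.2 :> bool.
  have opC (A B : edge4) : (A == B) || (val A == ~: val B) -> A = B \/ A = edge4C B.
    by case/orP => /eqP h; [left|right; apply/val_inj].
  apply/existsP/andP => [[a' /andP[]]|[/eqP h1 h2]].
    rewrite inE => /andP[/eqP e1 /opC h1] /existsP[b' /andP[]].
    rewrite inE => /andP[/eqP e2 /opC h2]; rewrite cyc_nextE e1 e2 => /andP[-> h].
    by split=> //; move: h; case: h1 => ->; case: h2 => ->; rewrite ?(cyc4Cl, cyc4Cr).
  exists c; rewrite inE !eqxx /=; apply/existsP; exists d.
  by rewrite inE !eqxx /= cyc_nextE h1 eqxx -h1.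
rewrite /eps !H [b.1 == _]eq_sym; case: eqVneq => [->|_] /=; last by rewrite subrr mul0r.
by rewrite mul1r rmorphB /= !mulrz_nat /eps4.
Qed.

End Gluing.

Section Gauge.
Variables (R : realType) (X : pseudo3).
Implicit Types (x y : angles R X) (a b : corner X) (g : edge X -> R).

Definition ang_row (u : corner X -> R) : angles R X := \row_i u (enum_val i).

Lemma ang_rowE u a : ang (ang_row u) a = u a.
Proof. by rewrite /ang mxE enum_rankK. Qed.

Lemma angP x y : (forall a, ang x a = ang y a) -> x = y.
Proof.
by move=> h; apply/rowP => i; have := h (enum_val i); rewrite /ang enum_valK.
Qed.

Lemma angD x y a : ang (x + y) a = ang x a + ang y a.
Proof. by rewrite /ang mxE. Qed.

Lemma angZ s x a : ang (s *: x) a = s * ang x a.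
Proof. by rewrite /ang mxE. Qed.

Definition bracket a b : R := (a.1 == b.1)%:R * eps4 R (positive a.1) a.2 b.2.

Lemma sum_corner (F : corner X -> R) : \sum_a F a = \sum_t \sum_A F (t, A).
Proof. by rewrite pair_bigA; apply: eq_bigr => -[]. Qed.

Lemma bracket_asym a b : bracket a b = - bracket b a.
Proof.
rewrite /bracket [b.1 == _]eq_sym; case: eqVneq => [->|_]; last by rewrite !mul0r oppr0.
by rewrite !mul1r eps4_asym.
Qed.

Lemma sum_bracket a (F : corner X -> R) :
  \sum_b bracket a b * F b = \sum_B eps4 R (positive a.1) a.2 B * F (a.1, B).
Proof.
rewrite sum_corner (bigD1 a.1) //= [X in _ + X]big1 ?addr0 => [|t ta].
  by apply: eq_bigr => B _; rewrite /bracket eqxx mul1r.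
by apply: big1 => B _; rewrite /bracket /= eq_sym (negPf ta) !mul0r.
Qed.

Lemma angle_shiftE g a : angle_shift g a = pi * \sum_b bracket a b * g (phi b).
Proof. by congr (_ * _); apply: eq_bigr => b _; rewrite epsE. Qed.

Definition gauge_dir g : angles R X := ang_row (angle_shift g).

Lemma ang_gauge_dir g a : ang (gauge_dir g) a = pi * \sum_b bracket a b * g (phi b).
Proof. by rewrite ang_rowE angle_shiftE. Qed.

Lemma gauge_dirD g1 g2 : gauge_dir (fun e => g1 e + g2 e) = gauge_dir g1 + gauge_dir g2.
Proof.
apply: angP => a; rewrite angD !ang_gauge_dir -mulrDr -big_split /=.
by congr (_ * _); apply: eq_bigr => b _; rewrite mulrDr.
Qed.

Lemma gauge_dirZ s g : gauge_dir (fun e => s * g e) = s *: gauge_dir g.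
Proof.
apply: angP => a; rewrite angZ !ang_gauge_dir [RHS]mulrCA; congr (_ * _); rewrite mulr_sumr.
by apply: eq_bigr => b _; rewrite mulrCA.
Qed.


Lemma gauge_dirN g : gauge_dir (fun e => - g e) = - gauge_dir g.
Proof.
rewrite -scaleN1r -gauge_dirZ; congr gauge_dir.
by apply/funext => e; rewrite mulN1r.
Qed.

Lemma gauge_dir0 : gauge_dir (fun=> 0) = 0.
Proof.
apply: angP => a; rewrite ang_gauge_dir big1 ?mulr0 ?/ang ?mxE // => b _.
by rewrite mulr0.
Qed.

Lemma gauge_paramD g1 g2 : gauge_param g1 -> gauge_param g2 ->
  gauge_param (fun e => g1 e + g2 e).
Proof. by move=> h1 h2 e he; rewrite h1 // h2 // addr0. Qed.

Lemma gauge_paramZ s g : gauge_param g -> gauge_param (fun e => s * g e).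
Proof. by move=> h e he; rewrite h // mulr0. Qed.

Lemma gauge_paramN g : gauge_param g -> gauge_param (fun e => - g e).
Proof. by move=> h e he; rewrite h // oppr0. Qed.

Lemma based_gaugeP x y :
  based_gauge x y <-> exists2 g, gauge_param g & y = x + gauge_dir g.
Proof.
split=> [[g hg h]|[g hg ->]]; exists g => //.
  by apply: angP => a; rewrite h angD ang_rowE.
by move=> a; rewrite angD ang_rowE.
Qed.

Definition vertex_sum (t : tet X) (v : 'I_4) x : R :=
  \sum_(A : edge4 | v \in val A) ang x (t, A).

Lemma vertex_sum_gauge_dir t v g : vertex_sum t v (gauge_dir g) = 0.
Proof.
rewrite /vertex_sum.
under eq_bigr => A _ do rewrite ang_gauge_dir sum_bracket /=.
rewrite -mulr_sumr exchange_big /= big1 ?mulr0 // => B _.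
by rewrite -mulr_suml eps4_vertex mul0r.
Qed.

Lemma vertex_sumD t v x y : vertex_sum t v (x + y) = vertex_sum t v x + vertex_sum t v y.
Proof. by rewrite -big_split; apply: eq_bigr => A _; rewrite angD. Qed.

Lemma vertex_sumZ t v s x : vertex_sum t v (s *: x) = s * vertex_sum t v x.
Proof. by rewrite mulr_sumr; apply: eq_bigr => A _; rewrite angZ. Qed.

Lemma weightE x (e : edge X) : weight x e = \sum_(a | phi a == e) ang x a.
Proof. by apply: eq_bigl => a; rewrite mem_edge. Qed.

Lemma weightD x y e : weight (x + y) e = weight x e + weight y e.
Proof. by rewrite -big_split; apply: eq_bigr => A _; rewrite angD. Qed.

Lemma weightZ s x e : weight (s *: x) e = s * weight x e.
Proof. by rewrite mulr_sumr; apply: eq_bigr => A _; rewrite angZ. Qed.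

(** The share of the face [f] in the bracket of the two combinations of weights with coefficients
    [h] and [g]. *)
Definition face_sum (h g : edge X -> R) (f : tet X * 'I_4) : R :=
  \sum_(A : edge4 | f.2 \notin val A) \sum_(B : edge4 | f.2 \notin val B)
    eps4 R (positive f.1) A B * (h (phi (f.1, A)) * g (phi (f.1, B))).

(** The gluing respects the edges of [X]. The parity of its extension [r] to all four vertices,
    combined with the orientation condition [glue_rev], negates the sign of the tetrahedron. *)
Lemma face_sum_glue h g f f' : glue f = Some f' -> face_sum h g f' = - face_sum h g f.
Proof.
case: f f' => [t i] [t' j] hf; rewrite /face_sum /=.
set r := lift_perm i j 1%g.
have rI : injective (edge4_img r) := can_inj (edge4_imgK r).
have phi_img (A : edge4) : i \notin val A -> phi (t', edge4_img r A) = phi (t, A).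
  by move=> iA; apply/esym/glue_corner_phi/glue_cornerP; exists i, j.
have hpos : positive t' (+) odd_perm r = ~~ positive t.
  have := glue_rev hf; rewrite /face_sign /= odd_lift_perm odd_perm1 addbF.
  by case: (positive t) (positive t') (odd i) (odd j) => [] [] [] [].
rewrite (reindex_inj rI) /= -sumrN; apply: eq_big => [A|A]; first exact: notin_lift_img.
rewrite notin_lift_img => iA.
rewrite (reindex_inj rI) /= -sumrN; apply: eq_big => [B|B]; first exact: notin_lift_img.
rewrite notin_lift_img => iB.
by rewrite !phi_img // eps4_img hpos eps4N mulNr.
Qed.

(* Each bracket of two edges of a tetrahedron is carried by the face containing both, and
   the contributions of two glued faces cancel. *)
Lemma bracket_gauge h g : gauge_param g ->
  \sum_a \sum_b bracket a b * (h (phi a) * g (phi b)) = 0.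
Proof.
move=> hg; transitivity (\sum_f face_sum h g f).
  rewrite sum_corner -(pair_bigA _ (fun t i => face_sum h g (t, i))) /=.
  apply: eq_bigr => t _.
  under eq_bigr => A _.
    rewrite (sum_bracket (t, A) (fun b => h (phi (t, A)) * g (phi b))) /=.
    over.
  under [RHS]eq_bigr => i _ do rewrite /face_sum big_mkcond /=.
  rewrite [RHS]exchange_big /=; apply: eq_bigr => A _.
  rewrite -big_mkcond /=.
  under [RHS]eq_bigr => i _ do rewrite big_mkcond /=.
  rewrite [RHS]exchange_big /=; apply: eq_bigr => B _.
  by rewrite -big_mkcondr -mulr_suml eps4_faces.
(* Exchanges glued faces and fixes the unglued ones. The latter contribute 0 because [g] vanishes on
   boundary edges, so the sum equals its own negative. *)
pose inv (f : tet X * 'I_4) := if glue f is Some f' then f' else f.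
have invK : involutive inv.
  move=> f; rewrite /inv; case E: (glue f) => [f'|]; last by rewrite E.
  by rewrite (glue_sym E).
suff H : \sum_f face_sum h g f = - \sum_f face_sum h g f by lra.
rewrite [LHS](reindex_inj (can_inj invK)) -sumrN; apply: eq_bigr => f _.
rewrite /inv; case E: (glue f) => [f'|]; first exact: face_sum_glue.
suff -> : face_sum h g f = 0 by rewrite oppr0.
apply: big1 => A iA; apply: big1 => B iB; rewrite (hg (phi (f.1, B))) ?mulr0 //.
by apply/bd_edgeP; exists (f.1, B), f.2; rewrite -surjective_pairing.
Qed.

(** This is [bracket_gauge] with [h] the indicator function of [e]. *)
Lemma weight_gauge_dir g e : gauge_param g -> weight (gauge_dir g) e = 0.
Proof.
move=> hg; rewrite weightE.
under eq_bigr => a _ do rewrite ang_gauge_dir.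
rewrite -mulr_sumr; apply/eqP; rewrite mulf_eq0; apply/orP; right; apply/eqP.
apply: etrans (bracket_gauge (fun e' => (e' == e)%:R) hg).
rewrite big_mkcond /=; apply: eq_bigr => a _ /=.
case: eqP => _; first by apply: eq_bigr => b _; rewrite mul1r.
by rewrite big1 // => b _; rewrite mul0r mulr0.
Qed.

(** The representatives of the classes in [level_set D]; see [level_setP]. *)
Definition wset (D : {set edge X}) : set (angles R X) :=
  [set x | gshapes R X x /\ forall e, e \in D -> weight x e = 2 * pi]%classic.

Lemma gshapes_gauge x g : gshapes R X (x + gauge_dir g) <-> gshapes R X x.
Proof.
by split=> h t v; have := h t v; rewrite -!/(vertex_sum _ _ _) vertex_sumD
  vertex_sum_gauge_dir addr0.
Qed.

Lemma wset_gauge D x g : gauge_param g -> wset D x -> wset D (x + gauge_dir g).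
Proof.
move=> hg [h1 h2]; split; first exact/gshapes_gauge.
by move=> e eD; rewrite weightD weight_gauge_dir // addr0 h2.
Qed.

(** The shape enters only through its weights, which are gauge invariant; hence the level shifts of
    successive gauge transformations add up. *)
Lemma level_shiftE g x : level_shift g x =
  \sum_e g e * ((#|val e|)%:R / 3 - weight x e / pi).
Proof.
apply: eq_bigr => e _; congr (_ * _).
by rewrite big_split /= sumrN -mulr_suml sumr_const -[3^-1 *+ _]mulr_natl.
Qed.

Lemma level_shift_gauge g g' x : gauge_param g' ->
  level_shift g (x + gauge_dir g') = level_shift g x.
Proof.
move=> hg; rewrite !level_shiftE; apply: eq_bigr => e _.
by rewrite weightD weight_gauge_dir // addr0.
Qed.

Lemma level_shiftD g1 g2 x :
  level_shift (fun e => g1 e + g2 e) x = level_shift g1 x + level_shift g2 x.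
Proof. by rewrite -big_split; apply: eq_bigr => e _; rewrite mulrDl. Qed.

Lemma level_shiftN g x : level_shift (fun e => - g e) x = - level_shift g x.
Proof. by rewrite -sumrN; apply: eq_bigr => e _; rewrite mulNr. Qed.

Lemma level_shift0 x : level_shift (fun=> 0) x = 0.
Proof. by apply: big1 => e _; rewrite mul0r. Qed.

Lemma based_gauge_refl x : based_gauge x x.
Proof. by apply/based_gaugeP; exists (fun=> 0) => //; rewrite gauge_dir0 addr0. Qed.

Lemma based_gauge_sym x y : based_gauge x y -> based_gauge y x.
Proof.
case/based_gaugeP => g hg ->; apply/based_gaugeP; exists (fun e => - g e).
  exact: gauge_paramN.
by rewrite gauge_dirN addrK.
Qed.

Lemma based_gauge_trans x y z : based_gauge x y -> based_gauge y z -> based_gauge x z.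
Proof.
case/based_gaugeP => g hg -> /based_gaugeP[g' hg' ->]; apply/based_gaugeP.
exists (fun e => g e + g' e); first exact: gauge_paramD.
by rewrite gauge_dirD addrA.
Qed.

End Gauge.

(** * The Poisson form on covectors *)

Section PoissonForm.
Variables (R : realType) (X : pseudo3).
Implicit Types (phi psi : 'cV[R]_#|corner X|).

Definition pairing (x : angles R X) phi : R := (x *m phi) ord0 ord0.

Lemma pairingE x phi : pairing x phi = \sum_a ang x a * phi (enum_rank a) ord0.
Proof.
rewrite /pairing mxE (reindex (@enum_rank (corner X))) //=.
exact/onW_bij/enum_rank_bij.
Qed.

(** The bracket, at a point, of two functions with differentials [phi] and [psi] there. *)
Definition pform phi psi : R :=
  \sum_a \sum_b bracket R a b * phi (enum_rank a) ord0 * psi (enum_rank b) ord0.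

Lemma pform_asym phi psi : pform phi psi = - pform psi phi.
Proof.
rewrite /pform exchange_big -sumrN; apply: eq_bigr => a _; rewrite -sumrN.
by apply: eq_bigr => b _; rewrite bracket_asym !mulNr mulrAC.
Qed.

Lemma pformBl phi phi' psi : pform (phi - phi') psi = pform phi psi - pform phi' psi.
Proof.
rewrite -sumrB; apply: eq_bigr => a _; rewrite -sumrB.
by apply: eq_bigr => b _; rewrite !mxE; ring.
Qed.

Definition tangent (D : {set edge X}) (v : angles R X) : Prop :=
  (forall t i, vertex_sum t i v = 0) /\ forall e, e \in D -> weight v e = 0.

(** Satisfied by the differentials of gauge-invariant functions; see [lift_kills_gauge]. *)
Definition kills_gauge psi : Prop :=
  forall g : edge X -> R, gauge_param g -> pairing (gauge_dir g) psi = 0.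

Lemma wsetD D x v : wset D x -> tangent D v -> wset D (x + v).
Proof.
move=> [x1 x2] [v1 v2]; split=> [t i|e eD].
  rewrite -/(vertex_sum _ _ _) vertex_sumD v1 addr0; exact: x1.
by rewrite weightD v2 // addr0 x2.
Qed.

(* A covector vanishing on the tangent directions is a combination of the Casimirs
   [vertex_sum] and of the weights of D, which generate gauge directions. *)
Lemma pform_conormal (D : {set edge X}) phi psi :
  (forall e, e \in D -> ~~ bd_edge e) ->
  (forall v, tangent D v -> pairing v phi = 0) -> kills_gauge psi -> pform phi psi = 0.
Proof.
move=> Dint hphi hpsi.
pose J : finType := ((tet X * 'I_4) + edge X)%type.
(* The generators: the angle sum at each vertex of each tetrahedron, and the weight of each edge of
   [D] (the zero covector for the other edges). *)
pose co (j : J) (a : corner X) : R := match j with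
  | inl ti => ((a.1 == ti.1) && (ti.2 \in val a.2))%:R
  | inr e => ((e \in D) && (Defs.phi a == e))%:R end.
pose A : 'M[R]_(#|corner X|, #|J|) := \matrix_(i, j) co (enum_val j) (enum_val i).
(* Duality: the row vectors killed by [A] are tangent, [phi] vanishes on them, so it lies in the
   column space of [A]. *)
have [c ->] : exists c, phi = A *m c.
  have sub : (phi^T <= A^T)%MS.
    rewrite submxE; apply/eqP/trmx_inj; rewrite trmx_mul trmxK trmx0.
    apply/row_matrixP => k; rewrite row0 row_mul.
    set v := row k _; apply/matrixP => i j; rewrite !ord1 [RHS]mxE.
    apply: (hphi v).
    have vA j' : \sum_a ang v a * co j' a = 0.
      have vA0 : v *m A = 0.
        by rewrite /v -row_mul -[A in _ *m A]trmxK -trmx_mul mulmx_coker trmx0 row0.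
      have := congr1 (fun M : 'rV_#|J| => M ord0 (enum_rank j')) vA0; rewrite !mxE; apply: etrans.
      rewrite [RHS](reindex (@enum_rank (corner X))) /=; last exact/onW_bij/enum_rank_bij.
      by apply: eq_bigr => a _; rewrite [A _ _]mxE !enum_rankK.
    split=> [t q|e eD].
      apply: etrans (vA (inl (t, q))); rewrite sum_corner [RHS](bigD1 t) //= [X in _ = _ + X]big1 ?addr0.
        rewrite /vertex_sum big_mkcond /=; apply: eq_bigr => B _.
        by rewrite eqxx; case: ifP => _ /=; rewrite ?mulr1 ?mulr0.
      by move=> t' tt'; apply: big1 => B _; rewrite (negPf tt') /= mulr0.
    apply: etrans (vA (inr e)); rewrite weightE big_mkcond /=; apply: eq_bigr => a _.
    by rewrite eD /=; case: ifP => _; rewrite ?mulr1 ?mulr0.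
  have [c hc] := submxP sub; exists c^T.
  by apply: trmx_inj; rewrite trmx_mul trmxK.
(* A vertex sum is a Casimir by [eps4_vertex]. The weight of an internal edge [e] generates the
   gauge direction of the indicator of [e], which [psi] kills. *)
have hco j : \sum_a \sum_b bracket R a b * co j a * psi (enum_rank b) ord0 = 0.
  rewrite exchange_big /=; case: j => [[t i]|e] /=.
    apply: big1 => b _; rewrite -mulr_suml [X in X * _](_ : _ = 0) ?mul0r //.
    rewrite sum_corner (bigD1 t) //= [X in _ + X]big1 ?addr0; last first.
      by move=> t' tt'; apply: big1 => B _; rewrite (negPf tt') /= mulr0.
    apply: etrans (_ : (t == b.1)%:R * \sum_(B : edge4 | i \in val B)
      eps4 R (positive t) B b.2 = 0); last by rewrite eps4_vertex mulr0.
    rewrite /bracket /= mulr_sumr [RHS]big_mkcond /=; apply: eq_bigr => B _.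
    by rewrite eqxx; case: ifP => _ /=; rewrite ?mulr1 ?mulr0.
  have [eD|eD] := boolP (e \in D); last first.
    by apply: big1 => b _; apply: big1 => a _; rewrite mulr0 mul0r.
  have ge : gauge_param (fun e' : edge X => (e' == e)%:R : R).
    by move=> e' he'; case: eqP he' => // ->; rewrite (negPf (Dint e eD)).
  have h : \sum_b (\sum_a bracket R b a * (Defs.phi a == e)%:R) * psi (enum_rank b) ord0 = 0.
    apply: (mulfI (x := pi : R)); first by rewrite gt_eqF ?pi_gt0.
    rewrite mulr0 mulr_sumr; apply: etrans (hpsi _ ge); rewrite pairingE.
    by apply: eq_bigr => b _; rewrite ang_gauge_dir mulrA.
  apply: oppr_inj; rewrite oppr0; apply: etrans h; rewrite -sumrN; apply: eq_bigr => b _.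
  rewrite -mulr_suml -mulNr; congr (_ * _); rewrite -sumrN.
  by apply: eq_bigr => a _; rewrite /= -mulNr -bracket_asym.
rewrite /pform.
under eq_bigr => a _ do under eq_bigr => b _ do
  rewrite mxE mulr_sumr mulr_suml.
under eq_bigr => a _ do rewrite exchange_big /=.
rewrite exchange_big /=; apply: big1 => j _.
apply: etrans (_ : c j ord0 * \sum_a \sum_b bracket R a b * co (enum_val j) a *
  psi (enum_rank b) ord0 = 0); last by rewrite hco mulr0.
rewrite mulr_sumr; apply: eq_bigr => a _; rewrite mulr_sumr; apply: eq_bigr => b _.
by rewrite mxE enum_rankK; ring.
Qed.

End PoissonForm.

(** * Isomorphisms of reduced spaces *)

Section ReducedIso.
Variable R : realType.

Lemma pairingD X (x y : angles R X) phi : pairing (x + y) phi = pairing x phi + pairing y phi.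
Proof. by rewrite /pairing mulmxDl mxE. Qed.

Lemma pairingZ X s (x : angles R X) phi : pairing (s *: x) phi = s * pairing x phi.
Proof. by rewrite /pairing -scalemxAl mxE. Qed.

Lemma pairingM X Y (x : angles R X) (M : 'M[R]_(#|corner X|, #|corner Y|)) phi :
  pairing x (M *m phi) = pairing (x *m M) phi.
Proof. by rewrite /pairing mulmxA. Qed.

Lemma pairingDr X (x : angles R X) phi psi :
  pairing x (phi + psi) = pairing x phi + pairing x psi.
Proof. by rewrite /pairing mulmxDr mxE. Qed.

Lemma pairingNr X (x : angles R X) phi : pairing x (- phi) = - pairing x phi.
Proof. by rewrite /pairing mulmxN mxE. Qed.

(* A linear map [M] and a linear level shift [q] inducing an isomorphism between the
   level sets of D and D' in the reduced spaces, with inverse induced by [M'] and [q'];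
   [x0] and [y0] are representatives of corresponding points. *)
Record half_iso (X Y : pseudo3) (D : {set edge X}) (D' : {set edge Y})
    (i : edge X -> edge Y) (i' : edge Y -> edge X)
    (M : 'M[R]_(#|corner X|, #|corner Y|)) (M' : 'M[R]_(#|corner Y|, #|corner X|))
    (q : 'cV[R]_#|corner X|) (q' : 'cV[R]_#|corner Y|)
    (x0 : angles R X) (y0 : angles R Y) : Prop := HalfIso {
  half_edge : forall e, e \notin D ->
    [/\ i e \notin D', i' (i e) = e & bd_edge (i e) = bd_edge e];
  half_internal : forall e, e \in D -> ~~ bd_edge e;
  half_wset : forall x, wset D x -> wset D' (x *m M);
  half_weight : forall x e, wset D x -> e \notin D -> weight (x *m M) (i e) = weight x e;
  half_gauge : forall g : edge X -> R, gauge_param g -> exists g',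
    [/\ gauge_param g', gauge_dir g *m M = gauge_dir g' &
        forall x, wset D x ->
          pairing (gauge_dir g) q + level_shift g x = level_shift g' (x *m M)];
  half_round : forall x, wset D x -> exists g,
    [/\ gauge_param g, x *m M *m M' = x + gauge_dir g &
        pairing x q + pairing (x *m M) q' = level_shift g x];
  half_pform : forall phi psi, kills_gauge phi -> kills_gauge psi ->
    pform (M *m phi) (M *m psi) = pform phi psi;
  half_base : wset D x0;
  half_base_map : based_gauge (x0 *m M) y0
}.

Definition reduced_iso X Y (D : {set edge X}) (D' : {set edge Y}) i i' M M' q q' x0 y0 :=
  half_iso D D' i i' M M' q q' x0 y0 /\ half_iso D' D i' i M' M q' q y0 x0.

Lemma reduced_iso_sym X Y (D : {set edge X}) (D' : {set edge Y}) i i' M M' q q' x0 y0 :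
  reduced_iso D D' i i' M M' q q' x0 y0 -> reduced_iso D' D i' i M' M q' q y0 x0.
Proof. by case. Qed.

(** The return trip through the second map ends with a gauge direction on [Y]; the inverse [h1'] of
    the first map carries it back to a gauge direction on [X], together with its level shift. *)
Lemma half_iso_comp X Y Z (D1 : {set edge X}) (D2 : {set edge Y}) (D3 : {set edge Z})
    i1 j1 i2 j2 M1 N1 M2 N2 q1 r1 q2 r2 x0 y0 z0 :
  half_iso D1 D2 i1 j1 M1 N1 q1 r1 x0 y0 -> half_iso D2 D1 j1 i1 N1 M1 r1 q1 y0 x0 ->
  half_iso D2 D3 i2 j2 M2 N2 q2 r2 y0 z0 ->
  half_iso D1 D3 (i2 \o i1) (j1 \o j2) (M1 *m M2) (N2 *m N1)
    (q1 + M1 *m q2) (r2 + N2 *m r1) x0 z0.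
Proof.
move=> h1 h1' h2; split.
- move=> e eD; have [e1 e2 e3] := half_edge h1 eD; have [f1 f2 f3] := half_edge h2 e1.
  by rewrite /= f1 f2 e2 f3 e3.
- exact: half_internal h1.
- by move=> x xD; rewrite mulmxA; apply/(half_wset h2)/(half_wset h1).
- move=> x e xD eD; rewrite mulmxA /= (half_weight h2) ?(half_weight h1) //.
    exact: half_wset h1 _ xD.
  by have [] := half_edge h1 eD.
- move=> g hg; have [g1 [g11 g12 g13]] := half_gauge h1 hg.
  have [g2 [g21 g22 g23]] := half_gauge h2 g11; exists g2; split => //.
    by rewrite mulmxA g12 g22.
  move=> x xD; rewrite mulmxA -g23; last exact: half_wset h1 _ xD.
  by rewrite -g13 // pairingDr pairingM g12; ring.
- move=> x xD; have xD2 := half_wset h1 xD.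
  have [g1 [g11 g12 g13]] := half_round h1 xD.
  have [g2 [g21 g22 g23]] := half_round h2 xD2.
  have [g3 [g31 g32 g33]] := half_gauge h1' g21.
  exists (fun e => g1 e + g3 e); split; first exact: gauge_paramD.
    by rewrite !mulmxA g22 mulmxDl g12 g32 gauge_dirD addrA.
  rewrite !pairingDr !pairingM !mulmxA g22 pairingD level_shiftD -g13.
  have := g33 _ xD2; rewrite g12 level_shift_gauge // => <-; rewrite -g23.
  by ring.
- move=> phi psi hphi hpsi; rewrite -!mulmxA (half_pform h1) ?(half_pform h2) //.
    by move=> g hg; have [g' [? e _]] := half_gauge h2 hg; rewrite pairingM e hphi.
  by move=> g hg; have [g' [? e _]] := half_gauge h2 hg; rewrite pairingM e hpsi.
- exact: half_base h1.
- apply: based_gauge_trans (half_base_map h2).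
  have /based_gaugeP[g hg ->] := half_base_map h1.
  have [g' [hg' e _]] := half_gauge h2 hg.
  by apply/based_gaugeP; exists g' => //; rewrite mulmxDl e mulmxA.
Qed.

Lemma reduced_iso_trans X Y Z (D1 : {set edge X}) (D2 : {set edge Y}) (D3 : {set edge Z})
    i1 j1 i2 j2 M1 N1 M2 N2 q1 r1 q2 r2 x0 y0 z0 :
  reduced_iso D1 D2 i1 j1 M1 N1 q1 r1 x0 y0 ->
  reduced_iso D2 D3 i2 j2 M2 N2 q2 r2 y0 z0 ->
  reduced_iso D1 D3 (i2 \o i1) (j1 \o j2) (M1 *m M2) (N2 *m N1)
    (q1 + M1 *m q2) (r2 + N2 *m r1) x0 z0.
Proof.
move=> [h1 h1'] [h2 h2']; split; first exact: half_iso_comp h1 h1' h2.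
exact: half_iso_comp h2' h2 h1'.
Qed.

(** Weights outside [D] and [D'] correspond, so a constraint on an edge of [E] is a constraint on
    its image. The condition on [x0] keeps both base points inside the smaller level sets. *)
Lemma reduced_iso_restrict X Y (D : {set edge X}) (D' : {set edge Y})
    i i' M M' q q' x0 y0 (E : {set edge X}) :
  reduced_iso D D' i i' M M' q q' x0 y0 ->
  (forall e, e \in E -> [/\ e \notin D, ~~ bd_edge e & weight x0 e = 2 * pi]) ->
  reduced_iso (D :|: E) (D' :|: i @: E) i i' M M' q q' x0 y0.
Proof.
move=> [h h'] hE.
have subD (x : angles R X) : wset (D :|: E) x -> wset D x.
  by move=> [h1 h2]; split=> // e eD; apply: h2; rewrite inE eD.
have subD' (x : angles R Y) : wset (D' :|: i @: E) x -> wset D' x.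
  by move=> [h1 h2]; split=> // e eD; apply: h2; rewrite inE eD.
have iE e : e \notin D -> (i e \in i @: E) = (e \in E).
  move=> eD; apply/imsetP/idP => [[e' e'E ee']|]; last by exists e.
  have [_ <- _] := half_edge h eD; rewrite ee'; have [e'D _ _] := hE _ e'E.
  by have [_ -> _] := half_edge h e'D.
split; split.
- move=> e; rewrite !inE !negb_or => /andP[eD eE].
  by have [h1 h2 h3] := half_edge h eD; rewrite h1 iE.
- move=> e; rewrite inE => /orP[/(half_internal h)//|/hE[]//].
- move=> x xDE; have [h1 h2] := half_wset h (subD _ xDE); split=> // e'.
  rewrite inE => /orP[/h2//|/imsetP[e eE ->]]; have [eD _ _] := hE _ eE.
  by rewrite (half_weight h) //; [apply xDE.2; rewrite inE eE orbT | exact: subD].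
- move=> x e /subD xD; rewrite inE negb_or => /andP[eD _]; exact: half_weight h _ _ xD eD.
- move=> g /(half_gauge h)[g' [h1 h2 h3]]; exists g'; split=> // x /subD; exact: h3.
- by move=> x /subD; apply: half_round h _.
- exact: half_pform h.
- have [h1 h2] := half_base h; split=> // e; rewrite inE => /orP[/h2//|/hE[]//].
- exact: half_base_map h.
- move=> e; rewrite !inE !negb_or => /andP[eD eE].
  have [h1 h2 h3] := half_edge h' eD; rewrite h1 h2; split=> //.
  by rewrite -iE // h2.
- move=> e; rewrite inE => /orP[/(half_internal h')//|/imsetP[e' e'E ->]].
  by have [e'D ? _] := hE _ e'E; have [_ _ ->] := half_edge h e'D.
- move=> x xDE; have [h1 h2] := half_wset h' (subD' _ xDE); split=> // e.
  rewrite inE => /orP[/h2//|eE]; have [eD _ _] := hE _ eE.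
  have [h3 h4 _] := half_edge h eD.
  rewrite -{1}h4 (half_weight h') //; last exact: subD'.
  by apply xDE.2; rewrite inE imset_f ?orbT.
- move=> x e /subD' xD; rewrite inE negb_or => /andP[eD _]; exact: half_weight h' _ _ xD eD.
- move=> g /(half_gauge h')[g' [h1 h2 h3]]; exists g'; split=> // x /subD'; exact: h3.
- by move=> x /subD'; apply: half_round h' _.
- exact: half_pform h'.
- have [h1 h2] := half_base h'; split=> // e.
  rewrite inE => /orP[/h2//|/imsetP[e' e'E ->]].
  have [e'D _ <-] := hE _ e'E.
  have /based_gaugeP[g hg ->] := half_base_map h.
  by rewrite weightD weight_gauge_dir // addr0 (half_weight h) //; exact: half_base h.
- exact: half_base_map h'.
Qed.

(* The inverse data of an isomorphism onto an unconstrained reduced space come from a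
   section [M'] of [M] and the fact that [M] only forgets gauge directions. *)
Lemma reduced_iso_section X Y (D : {set edge X}) i i' M M' (q : 'cV[R]_#|corner X|) x0 y0 :
  (forall e, e \in D -> ~~ bd_edge e) ->
  (forall e, e \notin D -> i' (i e) = e /\ bd_edge (i e) = bd_edge e) ->
  (forall e, i' e \notin D /\ i (i' e) = e) ->
  (forall x, wset D x -> gshapes R Y (x *m M)) ->
  (forall y, gshapes R Y y -> wset D (y *m M') /\ y *m M' *m M = y) ->
  (forall x e, wset D x -> e \notin D -> weight (x *m M) (i e) = weight x e) ->
  (forall (g : edge X -> R) (g' : edge Y -> R),
      (forall e, e \notin D -> g' (i e) = g e) ->
      gauge_dir g *m M = gauge_dir g' /\
      forall x, wset D x ->
        pairing (gauge_dir g) q + level_shift g x = level_shift g' (x *m M)) ->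
  (forall x x', wset D x -> wset D x' -> x *m M = x' *m M -> exists g,
      [/\ gauge_param g, forall e, e \notin D -> g e = 0 & x' = x + gauge_dir g]) ->
  (forall phi psi, pform (M *m phi) (M *m psi) = pform phi psi) ->
  wset D x0 -> x0 *m M = y0 ->
  reduced_iso D set0 i i' M M' q (- (M' *m q)) x0 y0.
Proof.
move=> Dint i1 i2 Mw M'w Mwt Mg Mker Mp x0D x0y0.
have W0 y : gshapes R Y y -> wset (set0 : {set edge Y}) y.
  by move=> h; split=> // e; rewrite inE.
have bd' e : bd_edge (i' e) = bd_edge e.
  by have [eD {2}<-] := i2 e; have [_ ->] := i1 _ eD.
have half1 : half_iso D set0 i i' M M' q (- (M' *m q)) x0 y0.
  split=> //.
  - by move=> e eD; have [-> ->] := i1 _ eD; rewrite inE.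
  - by move=> x /Mw/W0.
  - move=> g hg; exists (g \o i').
    have [|h1 h2] := Mg g (g \o i') _; first by move=> e /i1[/= -> _].
    by split=> // e he; apply: hg; rewrite bd'.
  - move=> x xD; have [h1 h2] := M'w _ (Mw _ xD).
    have [g [hg g0 e]] := Mker _ _ xD h1 (esym h2).
    exists g; split=> //; rewrite pairingNr pairingM e pairingD opprD addrA subrr sub0r.
    (* [g] vanishes outside [D], so it may be paired with the zero parameter on [Y]: the correction
       [q] along [gauge_dir g] then cancels [level_shift g]. *)
    have [|_ h3] := Mg g (fun=> 0) _; first by move=> e' /g0 ->.
    by have := h3 _ xD; rewrite level_shift0; lra.
  - by rewrite x0y0; exact: based_gauge_refl.
split=> //.
have gauge' (g' : edge Y -> R) : gauge_param g' -> exists g,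
    [/\ gauge_param g, gauge_dir g' *m M' = gauge_dir g &
        forall y, wset set0 y -> pairing (gauge_dir g') (- (M' *m q)) +
          level_shift g' y = level_shift g (y *m M')].
  (* [Mg] leaves the values on [D] free; they are set to 0. *)
  move=> hg'; pose g e := if e \in D then 0 else g' (i e).
  have hg : gauge_param g.
    by move=> e he; rewrite /g; case: ifPn => // /i1[_ bde]; rewrite hg' // bde.
  have [|h1 h2] := Mg g g' _; first by move=> e eD; rewrite /g (negPf eD).
  (* The translate of [a] by [gauge_dir g], and the section applied to the image of the same
     translate of [x0], lie in one fibre of [M]; [Mker] gives the gauge direction [t] between
     them. *)
  pose a := x0 *m M *m M'.
  have [aD aM] := M'w _ (Mw _ x0D); rewrite -/a in aD aM.
  have [bD bM] := M'w _ (Mw _ (wset_gauge hg x0D)).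
  have [|t [ht t0 e]] := Mker _ _ (wset_gauge hg aD) bD.
    by rewrite bM !mulmxDl aM.
  have E : gauge_dir g' *m M' = gauge_dir (fun e => g e + t e).
    move/eqP: e; rewrite !mulmxDl h1 -/a -addrA (inj_eq (addrI a)) => /eqP ->.
    by rewrite gauge_dirD.
  exists (fun e => g e + t e); split=> //; first exact: gauge_paramD.
  move=> y yw; rewrite pairingNr pairingM E gauge_dirD pairingD level_shiftD.
  have [yD yM] := M'w _ yw.1.
  have := h2 _ yD; rewrite yM => <-.
  have [|_ h3] := Mg t (fun=> 0) _; first by move=> e' /t0 ->.
  by have := h3 _ yD; rewrite level_shift0; lra.
have round' y : wset set0 y -> exists g,
    [/\ gauge_param g, y *m M' *m M = y + gauge_dir g &
        pairing y (- (M' *m q)) + pairing (y *m M') q = level_shift g y].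
  move=> [/M'w[_ yM] _]; exists (fun=> 0).
  by rewrite gauge_dir0 addr0 yM pairingNr pairingM level_shift0 addNr.
have base' : based_gauge (y0 *m M') x0.
  rewrite -x0y0; have [h1 h2] := M'w _ (Mw _ x0D).
  have [g [hg _ e]] := Mker _ _ h1 x0D h2.
  by apply/based_gaugeP; exists g.
split=> //.
- by move=> e _; have [-> ->] := i2 e; rewrite bd'.
- by move=> e; rewrite inE.
- by move=> y [/M'w[]].
- move=> y e [/M'w[h1 h2] _] _; have [eD ie] := i2 e.
  by rewrite -[in RHS]ie -[in RHS]h2 (Mwt _ _ h1 eD).
(* Both sides now live on [X]. The round trip through [M] and [M'] changes a gauge-killing covector
   by one that vanishes on tangent vectors; [pform_conormal] removes this difference in one argument
   at a time. *)
- move=> phi psi hphi hpsi; rewrite -Mp.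
  have conormal chi : kills_gauge chi ->
      forall v, tangent D v -> pairing v (M *m (M' *m chi) - chi) = 0.
    move=> hchi v vD; have [g [hg _ e]] := Mker _ _ x0D (M'w _ (Mw _ x0D)).1
       (esym (M'w _ (Mw _ x0D)).2).
    have x0v := wsetD x0D vD.
    have [g1 [hg1 _ e1]] := Mker _ _ x0v (M'w _ (Mw _ x0v)).1
       (esym (M'w _ (Mw _ x0v)).2).
    have ev : v *m M *m M' = v + (gauge_dir g1 - gauge_dir g).
      have -> : v = (x0 + v) - x0 by rewrite addrC addKr.
      by rewrite !mulmxBl e1 e opprD addrACA.
    rewrite pairingDr pairingNr !pairingM ev !pairingD -scaleN1r pairingZ.
    by rewrite !hchi // mulr0 !addr0 subrr.
  have kill chi : kills_gauge chi -> kills_gauge (M *m (M' *m chi)).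
    move=> hchi g hg; have [g1 [hg1 e1 _]] := half_gauge half1 hg.
    have [g2 [hg2 e2 _]] := gauge' _ hg1.
    by rewrite !pairingM e1 e2 hchi.
  have split1 phi1 phi2 chi : pform (phi1 - phi2) chi = 0 -> pform phi1 chi = pform phi2 chi.
    by rewrite pformBl => /eqP; rewrite subr_eq0 => /eqP.
  transitivity (pform phi (M *m (M' *m psi))).
    by apply: split1; apply: pform_conormal Dint (conormal _ hphi) (kill _ hpsi).
  rewrite pform_asym [RHS]pform_asym; congr (- _).
  by apply: split1; apply: pform_conormal Dint (conormal _ hpsi) hphi.
- by apply: W0; rewrite -x0y0; exact: Mw.
Qed.

End ReducedIso.

(** * Maps of edges, relation matrices and cellular isomorphisms *)

Section EdgeMaps.
Variables (R : realType).

Lemma edge_lift (X : pseudo3) (T : Type) (f : corner X -> T) :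
  (forall a b, glue_corner a b -> f a = f b) ->
  exists F : edge X -> T, forall a, F (phi a) = f a.
Proof.
move=> hf.
have fc a b : connect (@glue_corner X) a b -> f a = f b.
  move=> /connectP[p]; elim: p a => [|c p IHp] a /=; first by move=> _ ->.
  by move=> /andP[/hf -> /IHp h] /h.
have hP (e : edge X) : exists a, e == phi a by have [a ->] := phiP e; exists a.
exists (fun e => f (xchoose (hP e))) => a; apply: fc.
by rewrite connect_corner_sym -phi_eq; exact: xchooseP (hP (phi a)).
Qed.

Lemma sum_edges (X : pseudo3) (F : corner X -> R) (g : edge X -> R) :
  \sum_e g e * (\sum_(a in val e) F a) = \sum_a g (phi a) * F a.
Proof.
rewrite [RHS](partition_big (@phi X) xpredT) //=; apply: eq_bigr => e _.
by rewrite mulr_sumr; apply: eq_big => [a|a]; rewrite mem_edge // => /eqP ->.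
Qed.

Lemma level_shift_corners (X : pseudo3) (g : edge X -> R) x :
  level_shift g x = \sum_a g (phi a) * (3^-1 - ang x a / pi).
Proof. exact: sum_edges. Qed.

Section RelMatrix.
Variables (X Y : pseudo3) (r : corner X -> corner Y -> bool).

Definition rel_mx : 'M[R]_(#|corner X|, #|corner Y|) :=
  \matrix_(k, l) (r (enum_val k) (enum_val l))%:R.

Lemma ang_rel_mx x b : ang (x *m rel_mx) b = \sum_(a | r a b) ang x a.
Proof.
rewrite /ang mxE (reindex (@enum_rank (corner X))) /=; last exact/onW_bij/enum_rank_bij.
rewrite [RHS]big_mkcond /=; apply: eq_bigr => a _; rewrite mxE !enum_rankK.
by case: (r a b); rewrite ?mulr1 ?mulr0.
Qed.

(** The hypothesis is the Poisson property on coordinates: the sums of angles of [X] that make up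
    the coordinates of [Y] have the same brackets as these coordinates. *)
Lemma pform_rel_mx phi psi :
  (forall b b', \sum_(a | r a b) \sum_(a' | r a' b') bracket R a a' = bracket R b b') ->
  pform (rel_mx *m phi) (rel_mx *m psi) = pform phi psi.
Proof.
move=> hr.
have E chi a : (rel_mx *m chi) (enum_rank a) ord0 =
    \sum_b (r a b)%:R * chi (enum_rank b) ord0.
  rewrite mxE (reindex (@enum_rank (corner Y))) /=; last exact/onW_bij/enum_rank_bij.
  by apply: eq_bigr => b _; rewrite mxE !enum_rankK.
rewrite /pform.
transitivity (\sum_a \sum_a' \sum_b \sum_b' (r a b)%:R * (r a' b')%:R * bracket R a a' *
    phi (enum_rank b) ord0 * psi (enum_rank b') ord0).
  apply: eq_bigr => a _; apply: eq_bigr => a' _; rewrite !E.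
  rewrite [X in X * _]mulr_sumr mulr_suml; apply: eq_bigr => b _.
  by rewrite mulr_sumr; apply: eq_bigr => b' _; ring.
under eq_bigr => a _ do rewrite exchange_big /=.
rewrite exchange_big /=; apply: eq_bigr => b _.
under eq_bigr => a _ do rewrite exchange_big /=.
under eq_bigr => a _ do under eq_bigr => b' _ do rewrite -!mulr_suml.
rewrite exchange_big /=; apply: eq_bigr => b' _.
rewrite -!mulr_suml -hr; congr (_ * _ * _).
rewrite [RHS]big_mkcond /=; apply: eq_bigr => a _.
case: (r a b) => /=; last by apply: big1 => a' _; rewrite !mul0r.
by rewrite [RHS]big_mkcond /=; apply: eq_bigr => a' _; case: ifP => _; rewrite !(mul1r, mul0r).
Qed.

Lemma gauge_dir_rel_mx (g : edge X -> R) (g' : edge Y -> R) :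
  (forall b, \sum_c (\sum_(a | r a b) bracket R a c) * g (Defs.phi c) =
     \sum_d bracket R b d * g' (Defs.phi d)) ->
  gauge_dir g *m rel_mx = gauge_dir g'.
Proof.
move=> hg; apply: angP => b; rewrite ang_rel_mx [RHS]ang_gauge_dir -hg.
under eq_bigr => a _ do rewrite ang_gauge_dir.
rewrite -mulr_sumr exchange_big /=; congr (_ * _).
by apply: eq_bigr => c _; rewrite mulr_suml.
Qed.

End RelMatrix.

Lemma reduced_iso_base X Y (D : {set edge X}) (D' : {set edge Y}) i i' M M'
    (q : 'cV[R]_#|corner X|) (q' : 'cV[R]_#|corner Y|) x0 y0 y1 :
  reduced_iso D D' i i' M M' q q' x0 y0 -> based_gauge y0 y1 ->
  reduced_iso D D' i i' M M' q q' x0 y1.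
Proof.
move=> [h h'] y01; split.
  case: h => h1 h2 h3 h4 h5 h6 h7 h8 h9; split=> //.
  exact: based_gauge_trans h9 y01.
have /based_gaugeP[g hg e] := based_gauge_sym y01.
have [g' [hg' e' _]] := half_gauge h' hg.
have [g2 hg2 e2] : exists2 g2, gauge_param g2 & y1 = y0 + gauge_dir g2 by apply/based_gaugeP.
case: h' => h1 h2 h3 h4 h5 h6 h7 h8 h9; split=> //; first by rewrite e2; exact: wset_gauge.
apply: based_gauge_trans h9; apply/based_gaugeP; exists g' => //.
by rewrite e mulmxDl e'.
Qed.

Section Iso.
Variables (X Y : pseudo3) (h : iso3 X Y).
Let hc := iso_corner h.

Lemma iso_corner_bij : bijective hc.
Proof.
have [k kh hk] := iso_bij h.
exists (fun b => (k b.1, edge4_img (iso_vtx h (k b.1))^-1%g b.2)) => [[t A]|[t A]].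
  by rewrite /hc /iso_corner /= kh edge4_imgK.
by rewrite /hc /iso_corner /= hk edge4_imgKV.
Qed.

Lemma iso_bracket a b : bracket R (hc a) (hc b) = bracket R a b.
Proof.
rewrite /bracket /hc /iso_corner /= (inj_eq (bij_inj (iso_bij h))).
case: eqVneq => [ab|_]; last by rewrite !mul0r.
by rewrite -ab eps4_img iso_or -addbA addbb addbF.
Qed.

Lemma iso_unglued t i : (glue (iso_tet h t, iso_vtx h t i) == None) = (glue (t, i) == None).
Proof. by rewrite iso_glue; case: glue. Qed.

Lemma iso_glue_corner a b : glue_corner (hc a) (hc b) = glue_corner a b.
Proof.
apply/glue_cornerP/glue_cornerP => -[i [j [h1 h2 h3]]].
  move: h1 h2 h3; rewrite -[i](permKV (iso_vtx h a.1)) /=; move: (_ i) => {}i.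
  rewrite iso_glue; case E: (glue (a.1, i)) => [[t' j']|//] /= [].
  move=> /(bij_inj (iso_bij h)) et; rewrite et in E * => ej; rewrite -ej mem_edge4_img => iA.
  rewrite -!edge4_imgM -(iso_face h E) edge4_imgM => hb.
  exists i, j'; split=> //.
  by rewrite -[b.2](edge4_imgK (iso_vtx h b.1)) hb edge4_imgK.
exists (iso_vtx h a.1 i), (iso_vtx h b.1 j); split.
- by rewrite /= iso_glue h1.
- by rewrite /= mem_edge4_img.
- by rewrite /= h3 -!edge4_imgM (iso_face h h1).
Qed.

(** The corners are permuted, so the matrix is invertible: nothing is forgotten and the level
    correction is 0. *)
Lemma iso_reduced (x0 : angles R X) y0 : gshapes R X x0 -> 
  (forall a, ang y0 (hc a) = ang x0 a) ->
  exists i i' M M' q q',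
    reduced_iso (set0 : {set edge X}) (set0 : {set edge Y}) i i' M M' q q' x0 y0.
Proof.
move=> x0g xy0; have [k kh hk] := iso_corner_bij.
have [i iP] : exists i : edge X -> edge Y, forall a, i (phi a) = phi (hc a).
  by apply: edge_lift => a b ab; apply: glue_corner_phi; rewrite iso_glue_corner.
have [i' i'P] : exists i' : edge Y -> edge X, forall b, i' (phi b) = phi (k b).
  apply: edge_lift => a b ab; apply: glue_corner_phi.
  by rewrite -iso_glue_corner !hk.
have angM x a : ang (x *m rel_mx (fun a b => hc a == b)) (hc a) = ang x a.
  rewrite ang_rel_mx (big_pred1 a) // => a'; rewrite /= (inj_eq (bij_inj iso_corner_bij)) //.
have angM' y b : ang (y *m rel_mx (fun b a => hc a == b)) b = ang y (hc b).
  by rewrite ang_rel_mx (big_pred1 (hc b)) // => b'; rewrite eq_sym.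
have gM x : gshapes R Y (x *m rel_mx (fun a b => hc a == b)) <-> gshapes R X x.
  have E t v : \sum_(A : edge4 | iso_vtx h t v \in val A)
       ang (x *m rel_mx (fun a b => hc a == b)) (iso_tet h t, A) =
     \sum_(A : edge4 | v \in val A) ang x (t, A).
    rewrite (reindex_inj (can_inj (edge4_imgK (iso_vtx h t)))) /=.
    by apply: eq_big => [A|A _]; [exact: mem_edge4_img | rewrite -(angM x (t, A))].
  have [l lh hl] := iso_bij h.
  split=> H t v; first by rewrite -E.
  by rewrite -(hl t) -(permKV (iso_vtx h (l t)) v) E.
pose M' := rel_mx (fun b a => hc a == b).
exists i, i', (rel_mx (fun a b => hc a == b)), M', 0, (- (M' *m 0)).
apply: reduced_iso_section.
- by move=> e; rewrite inE.
- move=> e _; have [a ->] := phiP e; rewrite iP i'P kh; split=> //.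
  apply/bd_edgeP/bd_edgeP => -[b [f [h1 h2 h3]]].
    exists (k b), ((iso_vtx h (k b).1)^-1%g f).
    rewrite -(kh a) -!i'P h1; split=> //.
      by rewrite -(mem_edge4_img (iso_vtx h (k b).1)) permKV; move: h2; rewrite -{1}(hk b).
    apply/eqP; rewrite -iso_unglued permKV; apply/eqP.
    by rewrite -[iso_tet h _]/((hc (k b)).1) hk.
  exists (hc b), (iso_vtx h b.1 f); rewrite -!iP h1; split=> //.
    by rewrite /= mem_edge4_img.
  by apply/eqP; rewrite /= iso_unglued h3.
- by move=> e; have [b ->] := phiP e; rewrite i'P iP hk inE.
- by move=> x [] xg _; apply/gM.
- move=> y yg; have yE : y *m rel_mx (fun b a => hc a == b) *m rel_mx (fun a b => hc a == b) = y.
    by apply: angP => b; rewrite -(hk b) angM angM'.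
  by split=> //; split=> [|e]; [apply/gM; rewrite yE | rewrite inE].
- move=> x e _ _; have [a ->] := phiP e; rewrite iP !weightE.
  rewrite (reindex hc (onW_bij _ iso_corner_bij)) /=; apply: eq_big => [b|b _]; last exact: angM.
  by rewrite -!iP; apply/eqP/eqP => [/(congr1 i')|->//]; rewrite !iP !i'P !kh.
- move=> g g' hg; split.
    apply: gauge_dir_rel_mx => b; rewrite -(hk b).
    rewrite [RHS](reindex hc (onW_bij _ iso_corner_bij)) /=; apply: eq_bigr => c _.
    rewrite iso_bracket -iP hg ?inE // (big_pred1 (k b)) //.
    by move=> a; rewrite /= (inj_eq (bij_inj iso_corner_bij)).
  move=> x _; rewrite /pairing mulmx0 mxE add0r !level_shift_corners.
  rewrite [RHS](reindex hc (onW_bij _ iso_corner_bij)) /=; apply: eq_bigr => c _.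
  by rewrite -iP hg ?inE // angM.
- move=> x x' _ _ e; exists (fun=> 0); split=> //; rewrite gauge_dir0 addr0.
  by apply: angP => a; rewrite -!angM e.
- move=> phi psi; apply: pform_rel_mx => b b'; rewrite -(hk b) -(hk b') iso_bracket.
  rewrite (big_pred1 (k b)) => [|a]; last by rewrite /= (inj_eq (bij_inj iso_corner_bij)).
  by rewrite (big_pred1 (k b')) // => a; rewrite /= (inj_eq (bij_inj iso_corner_bij)).
- by split=> // e; rewrite inE.
- by apply: angP => b; rewrite -(hk b) angM xy0.
Qed.

End Iso.

(** The cellular isomorphism is applied to the gauge translate of the shape of [X]; the translation
    itself is absorbed into the choice of base point. *)
Lemma gauge_equivalent_reduced (X Y : shaped R) : gauge_equivalent X Y ->
  exists i i' M M' q q', reduced_iso (set0 : {set edge X}) (set0 : {set edge Y})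
    i i' M M' q q' (shape X) (shape Y).
Proof.
move=> [h [g [hg e]]].
have [|a|i [i' [M [M' [q [q' H]]]]]] := iso_reduced (h := h) (x0 := shape X + gauge_dir g)
  (y0 := shape Y).
- by apply/gshapes_gauge; have [] := shapeP X.
- by rewrite e angD ang_rowE.
exists i, i', M, M', q, q'; apply: reduced_iso_sym.
apply: (reduced_iso_base (reduced_iso_sym H)); apply: based_gauge_sym.
by apply/based_gaugeP; exists g.
Qed.

End EdgeMaps.

(** * The correspondence of edges in a Pachner move *)

Lemma vposK (k l : 'I_5) : l != k -> lift k (vpos k l) = l.
Proof.
move=> lk; apply/val_inj; rewrite /= /vpos inordK.
  by rewrite unbumpKcond; move: lk; rewrite -val_eqE /= => /negPf ->.
rewrite /unbump; have := ltn_ord l; have := ltn_ord k.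
by move: lk; rewrite -val_eqE /=; case: ltngtP => //; lia.
Qed.

Lemma lift_vpos (k : 'I_5) (x : 'I_4) : vpos k (lift k x) = x.
Proof. by apply/val_inj; rewrite /vpos /= bumpK inordK. Qed.

(** The simplicial identity: the common face of the facets opposite to [k] and [l] has the same
    ordered vertices seen from either facet. *)
Lemma vpos_lift2 (k l : 'I_5) (y : 'I_3) : k != l ->
  lift k (lift (vpos k l) y) = lift l (lift (vpos l k) y).
Proof.
move=> kl; have h1 := vposK kl; have h2 : lift k (vpos k l) = l by apply: vposK; rewrite eq_sym.
apply/val_inj; rewrite /=; move: (congr1 val h1) (congr1 val h2) kl; rewrite -val_eqE /= /bump.
by move: (val (vpos k l)) (val (vpos l k)) => /= p r; lia.
Qed.

(** This parity is why the facets of a 4-simplex, taken with alternating signs, induce opposite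
    orientations on their common faces. *)
Lemma odd_vpos (k l : 'I_5) : k != l ->
  odd (vpos k l) (+) odd (vpos l k) = ~~ (odd k (+) odd l).
Proof.
move=> kl; have h1 := vposK kl; have h2 : lift k (vpos k l) = l by apply: vposK; rewrite eq_sym.
move: (congr1 val h1) (congr1 val h2) kl; rewrite -val_eqE /= /bump.
by move: (val (vpos k l)) (val (vpos l k)) => /= p r; lia.
Qed.

(** Names the edges of a facet by pairs of vertices of the 4-simplex, so that edges of different
    facets, and of the two triangulations, can be compared. *)
Definition label (k : 'I_5) (A : edge4) : {set 'I_5} := lift k @: val A.

Lemma label_inj k : injective (label k).
Proof. by move=> A B /(imset_inj lift_inj)/val_inj. Qed.

Lemma card_label k A : #|label k A| = 2%N.
Proof. by rewrite card_imset ?(eqP (valP A)) //; exact: lift_inj. Qed.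

Lemma notin_label k A : k \notin label k A.
Proof. by apply/imsetP => -[x _ /eqP]; rewrite (negPf (neq_lift k x)). Qed.

Lemma mem_label k l (A : edge4) : l != k -> (l \in label k A) = (vpos k l \in val A).
Proof. by move=> lk; rewrite -{1}(vposK lk) mem_imset //; exact: lift_inj. Qed.

Lemma label_ex k (B : {set 'I_5}) : #|B| = 2%N -> k \notin B -> exists A, label k A = B.
Proof.
move=> B2 kB.
have cA : #|vpos k @: B| == 2%N.
  rewrite card_in_imset ?B2 // => x y xB yB e.
  by rewrite -(@vposK k x) ?e ?vposK //; apply: contraNneq kB => <-.
exists (exist (fun S : {set 'I_4} => #|S| == 2%N) _ cA).
rewrite /label /= -imset_comp -[RHS]imset_id; apply: eq_in_imset => x xB /=.
by apply: vposK; apply: contraNneq kB => <-.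
Qed.

Lemma label_face k l (A : edge4) : k != l -> vpos k l \notin val A ->
  label l (edge4_img (lift_perm (vpos k l) (vpos l k) 1%g) A) = label k A.
Proof.
move=> kl kA; rewrite /label /= -imset_comp; apply: eq_in_imset => x xA /=.
have [y ->] : exists y, x = lift (vpos k l) y.
  case: (unliftP (vpos k l) x) => [y ->|e]; first by exists y.
  by rewrite -e xA in kA.
by rewrite lift_perm_lift perm1 -vpos_lift2.
Qed.

(** The part of [replaces] that is symmetric under the exchange of [X] with [Y] and of [K] with its
    complement; [move3_sym] then gives each statement on corners in both directions. *)
Record move3 (X Y : pseudo3) (K : {set 'I_5}) (tau : 'I_5 -> tet X) (tau' : 'I_5 -> tet Y)
    (rho : tet X -> tet Y) : Prop := Move3 {
  move_inj : {in K &, injective tau};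
  move_inj' : {in ~: K &, injective tau'};
  move_outer_inj : {in ~: (tau @: K) &, injective rho};
  move_outer_im : rho @: (~: (tau @: K)) = ~: (tau' @: (~: K));
  move_glue : forall k l, k \in K -> l \in K -> k != l ->
    glue (tau k, vpos k l) = Some (tau l, vpos l k);
  move_glue' : forall k l, k \notin K -> l \notin K -> k != l ->
    glue (tau' k, vpos k l) = Some (tau' l, vpos l k);
  move_outer : forall f f', outer_face K tau tau' rho f f' ->
    match glue f with
    | Some f1 => exists2 f1', outer_face K tau tau' rho f1 f1' & glue f' = Some f1'
    | None => glue f' = None
    end
}.

Section Corr.
Variables (X Y : pseudo3) (K : {set 'I_5}).
Variables (tau : 'I_5 -> tet X) (tau' : 'I_5 -> tet Y) (rho : tet X -> tet Y).
Hypothesis H : move3 K tau tau' rho.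

(** A relation and not a function, since an edge of the bipyramid may lie in several tetrahedra on
    either side; [corr_same] shows that the edge of [Y] is nevertheless determined. *)
Definition corr (a : corner X) (b : corner Y) : Prop :=
  (a.1 \notin tau @: K /\ b = (rho a.1, a.2)) \/
  exists k l, [/\ k \in K, l \notin K, a.1 = tau k, b.1 = tau' l &
                  label k a.2 = label l b.2].

Lemma corr_tau k a b : k \in K -> a.1 = tau k -> corr a b ->
  exists2 l, l \notin K & b.1 = tau' l /\ label k a.2 = label l b.2.
Proof.
move=> kK ak [[]|[k' [l [k'K lK e1 e2 e3]]]]; first by rewrite ak imset_f.
by exists l => //; rewrite (move_inj H kK k'K) // -ak e1.
Qed.

Lemma corr_same a b b' : corr a b -> corr a b' -> phi b = phi b'.
Proof.
have [/imsetP[k kK ak]|tS] := boolP (a.1 \in tau @: K); last first.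
  move=> [[_ ->]|[k [l [kK _ e]]]]; last by rewrite e imset_f in tS.
  by move=> [[_ ->]//|[k [l [kK _ e]]]]; rewrite e imset_f in tS.
move=> /(corr_tau kK ak)[l lK [e1 e2]] /(corr_tau kK ak)[l' l'K [e1' e2']].
case: b b' e1 e2 e1' e2' => [t1 A1] [t2 A2] /= -> e2 -> e2'.
rewrite e2 in e2'; have [ll'|ll'] := eqVneq l l'.
  by move: e2'; rewrite ll' => /label_inj ->.
have h : vpos l l' \notin val A1.
  by rewrite -mem_label ?e2' ?notin_label // eq_sym.
apply: glue_corner_phi; apply/glue_cornerP; exists (vpos l l'), (vpos l' l); split=> //=.
  exact: move_glue' H _ _ _ _ _.
by apply: (@label_inj l'); rewrite label_face.
Qed.

Lemma corr_face f f' (a : corner X) : outer_face K tau tau' rho f f' -> a.1 = f.1 -> f.2 \notin val a.2 ->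
  corr a (f'.1, edge4_img (lift_perm f.2 f'.2 1%g) a.2).
Proof.
case: a f f' => t A [t1 i] [t' i'] /= [[h1 [-> ->]]|[k [l [kK lK [-> ->] [-> ->]]]]] /= -> iA.
  by left; rewrite lift_perm1_id edge4_img1.
have kl : k != l by apply: contraNneq lK => <-.
by right; exists k, l; split=> //=; rewrite label_face.
Qed.

(** A gluing along an outer face is matched by one in [Y]. Along an interior face of the bipyramid
    the label does not change, so the same [b] corresponds to both corners. *)
Lemma corr_glue a a' b b' : corr a b -> corr a' b' -> glue_corner a a' -> phi b = phi b'.
Proof.
move=> ab a'b' /glue_cornerP[i [j [h1 h2 h3]]].
have outer f' : outer_face K tau tau' rho (a.1, i) f' -> phi b = phi b'.
  move=> o; have := move_outer H o; rewrite h1 => -[f1' o' g'].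
  have c := corr_face (a := a) o erefl h2.
  have iA' : j \notin val a'.2 by rewrite h3 notin_lift_img.
  have c' := corr_face (a := a') o' erefl iA'.
  rewrite (corr_same ab c) (corr_same a'b' c').
  apply: glue_corner_phi; apply/glue_cornerP; exists f'.2, f1'.2; split=> /=.
  - by rewrite -surjective_pairing g' -surjective_pairing.
  - by rewrite notin_lift_img.
  - by rewrite h3 -!edge4_imgM !lift_perm1M.
have [/imsetP[k kK ak]|aS] := boolP (a.1 \in tau @: K); last first.
  by apply: (outer (rho a.1, i)); left.
have [l kl ei] : exists2 l, l != k & i = vpos k l.
  by exists (lift k i); rewrite ?lift_vpos // eq_sym neq_lift.
have [lK|lK] := boolP (l \in K); last first.
  by apply: (outer (tau' l, vpos l k)); right; exists k, l; split=> //; rewrite ak ei.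
move: h1; rewrite ak ei (move_glue H) 1?eq_sym // => -[e1 e2].
have [m mK [em lm]] := corr_tau kK ak ab.
suff a'b : corr a' b by exact: corr_same a'b a'b'.
right; exists l, m; split=> //.
by rewrite h3 -e2 ei -lm label_face // -?ei // eq_sym.
Qed.

Lemma corr_unglued a b i : corr a b -> i \notin val a.2 -> glue (a.1, i) = None ->
  bd_edge (phi b).
Proof.
move=> ab iA ga.
have outer f' : outer_face K tau tau' rho (a.1, i) f' -> bd_edge (phi b).
  move=> o; have := move_outer H o; rewrite ga => g'.
  rewrite (corr_same ab (corr_face (a := a) o erefl iA)).
  apply/bd_edgeP; exists (f'.1, edge4_img (lift_perm i f'.2 1%g) a.2), f'.2; split=> //=.
    by rewrite notin_lift_img.
  by rewrite -surjective_pairing.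
have [/imsetP[k kK ak]|aS] := boolP (a.1 \in tau @: K); last first.
  by apply: (outer (rho a.1, i)); left.
have [l kl ei] : exists2 l, l != k & i = vpos k l.
  by exists (lift k i); rewrite ?lift_vpos // eq_sym neq_lift.
have [lK|lK] := boolP (l \in K).
  by move: ga; rewrite ak ei (move_glue H) // eq_sym.
by apply: (outer (tau' l, vpos l k)); right; exists k, l; split=> //; rewrite ak ei.
Qed.

End Corr.

Lemma move3_sym (X Y : pseudo3) (K : {set 'I_5}) (tau : 'I_5 -> tet X) (tau' : 'I_5 -> tet Y)
    (rho : tet X -> tet Y) :
  move3 K tau tau' rho ->
  exists2 rho', move3 (~: K) tau' tau rho' &
    forall a b, corr (~: K) tau' tau rho' b a <-> corr K tau tau' rho a b.
Proof.
move=> H.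
have ex t' : exists t, t' \notin tau' @: (~: K) -> t \notin tau @: K /\ rho t = t'.
  have [h|h] := boolP (t' \in tau' @: (~: K)); first by exists (tau ord0).
  have : t' \in rho @: ~: (tau @: K) by rewrite (move_outer_im H) inE.
  by case/imsetP => t; rewrite inE => tS ->; exists t.
have [rho' hr] := choice ex.
have rK t : t \notin tau @: K -> rho t \notin tau' @: (~: K) /\ rho' (rho t) = t.
  move=> tS; have h : rho t \notin tau' @: (~: K).
    by rewrite -in_setC -(move_outer_im H) imset_f // inE.
  split=> //; have [h1 h2] := hr _ h.
  by apply: (move_outer_inj H) => //; rewrite inE.
have outE f f' : outer_face (~: K) tau' tau rho' f' f <-> outer_face K tau tau' rho f f'.
  split=> -[[h ->]|[k [l [h1 h2 -> ->]]]].
  - by left; have [h1 h2] := hr _ h; rewrite /= h2 -surjective_pairing.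
  - by right; exists l, k; rewrite !inE negbK in h1 h2 *.
  - by left; have [h1 h2] := rK _ h; rewrite /= h2 -surjective_pairing.
  - by right; exists l, k; rewrite !inE negbK.
exists rho'; first split.
- exact: move_inj' H.
- by rewrite setCK; exact: move_inj H.
- move=> t1 t2; rewrite !inE => h1 h2 e.
  by have [_ <-] := hr _ h1; have [_ <-] := hr _ h2; rewrite e.
- rewrite setCK; apply/setP => t; rewrite inE; apply/imsetP/idP => [[t']|tS].
    by rewrite inE => /hr[h _] ->.
  by have [h1 h2] := rK _ tS; exists (rho t); rewrite ?inE.
- by move=> k l; rewrite !inE; exact: move_glue' H _ _.
- by move=> k l; rewrite !inE !negbK; exact: move_glue H _ _.
- move=> f' f /outE o; have := move_outer H o.
  case E: (glue f) => [f1|]; last by move=> ->.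
  by move=> [f1' o' ->]; exists f1 => //; apply/outE.
move=> a b; split=> -[[h e]|[k [l [h1 h2 h3 h4 h5]]]].
- by left; have [h1 h2] := hr _ h; rewrite e /= h2 -surjective_pairing.
- by right; exists l, k; rewrite !inE negbK in h1 h2 *.
- by left; have [h1 h2] := rK _ h; rewrite e /= h2 -surjective_pairing.
- by right; exists l, k; rewrite !inE negbK.
Qed.

Section MoveEdges.
Variables (R : realType) (X Y : pseudo3) (K : {set 'I_5}).
Variables (tau : 'I_5 -> tet X) (tau' : 'I_5 -> tet Y) (rho : tet X -> tet Y).
Hypothesis H : move3 K tau tau' rho.
Hypothesis K3 : #|K| = 3%N.
Variable e0 : edge X.
Hypothesis e0E : central_edge K tau e0.

Lemma cardCK : #|~: K| = 2%N.
Proof. by rewrite cardsCs setCK K3 card_ord. Qed.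

Lemma phi_central a : phi a = e0 <-> exists k, [/\ k \in K, a.1 = tau k & label k a.2 = ~: K].
Proof.
split=> [/eqP|[k [kK ak lk]]].
  rewrite -mem_edge e0E inE => /existsP[k /and3P[kK /eqP ak /eqP lk]].
  by exists k.
apply/eqP; rewrite -mem_edge e0E inE; apply/existsP; exists k.
by rewrite kK ak -/(label k a.2) lk !eqxx.
Qed.

Lemma corr_not_central a b : corr K tau tau' rho a b -> phi a <> e0.
Proof.
move=> ab /phi_central[k [kK ak lk]].
have [l lK [_ e]] := corr_tau H kK ak ab.
by have := notin_label l b.2; rewrite -e lk inE lK.
Qed.

(** Inside the bipyramid, a label other than the complement of [K] misses some [l] outside [K], both
    being pairs; so it occurs in the new tetrahedron [tau' l]. *)
Lemma corr_exX a : phi a <> e0 -> exists b, corr K tau tau' rho a b.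
Proof.
move=> ae; have [/imsetP[k kK ak]|tS] := boolP (a.1 \in tau @: K); last first.
  by exists (rho a.1, a.2); left.
have [l lK lB] : exists2 l, l \notin K & l \notin label k a.2.
  have : ~~ (~: K \subset label k a.2).
    apply/negP => sub; apply: ae; apply/phi_central; exists k; split=> //.
    by apply/esym/eqP; rewrite eqEcard sub card_label cardCK.
  by case/subsetPn => l; rewrite inE; exists l.
have [B hB] := label_ex (card_label k a.2) lB.
by exists (tau' l, B); right; exists k, l.
Qed.

Lemma corr_exY b : exists a, corr K tau tau' rho a b.
Proof.
have [/imsetP[l lK bl]|tS] := boolP (b.1 \in tau' @: (~: K)).
  have [k kK kB] : exists2 k, k \in K & k \notin label l b.2.
    by apply/subsetPn/negP => /subset_leq_card; rewrite card_label K3.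
  have [A hA] := label_ex (card_label l b.2) kB.
  by exists (tau k, A); right; exists k, l; rewrite inE in lK.
have : b.1 \in rho @: ~: (tau @: K) by rewrite (move_outer_im H) inE.
case/imsetP => t; rewrite inE => tS' e; exists (t, b.2); left; split=> //=.
by rewrite -e -surjective_pairing.
Qed.

Lemma move_edges : exists (i : edge X -> edge Y) (i' : edge Y -> edge X),
  forall a b, corr K tau tau' rho a b -> i (phi a) = phi b /\ i' (phi b) = phi a.
Proof.
have [rho' H' HC] := move3_sym H.
have exX a : exists b, phi a <> e0 -> corr K tau tau' rho a b.
  have [ae|ae] := pselect (phi a <> e0); first by have [b ?] := corr_exX ae; exists b.
  by exists (tau' ord0, mkedge ord0 ord0).
have [c hc] := choice exX; have [c' hc'] := choice corr_exY.
(* The central edge has no counterpart; its image is an arbitrary edge. *)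
have [i iP] : exists i : edge X -> edge Y,
    forall a, i (phi a) = if phi a == e0 then phi (tau' ord0, mkedge ord0 ord0) else phi (c a).
  apply: edge_lift => a b ab; rewrite (glue_corner_phi ab); case: eqP => // be.
  have ae : phi a <> e0 by rewrite (glue_corner_phi ab).
  exact: (corr_glue H (hc _ ae) (hc _ be) ab).
have [i' i'P] : exists i' : edge Y -> edge X, forall b, i' (phi b) = phi (c' b).
  apply: edge_lift => a b ab.
  exact: (corr_glue H' (proj2 (HC _ _) (hc' a)) (proj2 (HC _ _) (hc' b)) ab).
exists i, i' => a b ab; have ae := corr_not_central ab.
rewrite iP i'P; split; first by case: eqP => // _; exact: (corr_same H (hc _ ae) ab).
exact: (corr_same H' (proj2 (HC _ _) (hc' b)) (proj2 (HC _ _) ab)).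
Qed.

Variables (i : edge X -> edge Y) (i' : edge Y -> edge X).
Hypothesis ii : forall a b, corr K tau tau' rho a b -> i (phi a) = phi b /\ i' (phi b) = phi a.

Lemma move_edgeK e : e <> e0 -> i' (i e) = e.
Proof.
by have [a ->] := phiP e => /corr_exX[b /ii[-> ->]].
Qed.

Lemma move_edgeK' e : i' e <> e0 /\ i (i' e) = e.
Proof.
have [b ->] := phiP e; have [a ab] := corr_exY b; have [h ->] := ii ab.
by split=> //; exact: corr_not_central ab.
Qed.

Lemma move_bd e : e <> e0 -> bd_edge (i e) = bd_edge e.
Proof.
have [rho' H' HC] := move3_sym H.
move=> ee; apply/bd_edgeP/bd_edgeP => -[b [f [h1 h2 h3]]].
  have [a ab] := corr_exY b; have [h4 h5] := ii ab.
  have ae : phi a = e by rewrite -h5 h1 move_edgeK.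
  apply/bd_edgeP; rewrite -ae; apply: (corr_unglued H' _ h2 h3); exact/HC.
apply/bd_edgeP; have [a ba] : exists a, corr K tau tau' rho b a by apply: corr_exX; rewrite h1.
have [h4 h5] := ii ba; rewrite -h1 h4; exact: (corr_unglued H ba h2 h3).
Qed.

(** At most one term, since [label k] is injective: this extends [u] from the edges of the facet [k]
    by 0 to all sets of vertices. *)
Definition facet_val (Z : pseudo3) (u : corner Z -> R) (t : tet Z) k (B : {set 'I_5}) : R :=
  \sum_(A : edge4 | label k A == B) u (t, A).

Lemma sum_facet_val (Z : pseudo3) (u : corner Z -> R) t k (G : {set 'I_5} -> R) :
  \sum_A G (label k A) * u (t, A) = \sum_B G B * facet_val u t k B.
Proof.
rewrite (partition_big (label k) xpredT) //=; apply: eq_bigr => B _.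
by rewrite mulr_sumr; apply: eq_bigr => A /eqP ->.
Qed.

Lemma facet_val0 (Z : pseudo3) (u : corner Z -> R) t k (B : {set 'I_5}) :
  #|B| <> 2%N -> facet_val u t k B = 0.
Proof.
by move=> B2; apply: big1 => A /eqP e; case: B2; rewrite -e card_label.
Qed.

Lemma sum_split (Z : pseudo3) (L : {set 'I_5}) (sigma : 'I_5 -> tet Z) (F : corner Z -> R) :
  {in L &, injective sigma} ->
  \sum_a F a = \sum_(t | t \notin sigma @: L) \sum_A F (t, A) +
    \sum_(k in L) \sum_A F (sigma k, A).
Proof.
move=> inj; rewrite sum_corner (bigID [in sigma @: L]) /= addrC; congr (_ + _).
by rewrite big_imset.
Qed.

(** Grouping the corners of the bipyramid by label turns both sums into sums over its edges, which
    differ only at the central one. Applied below to angles, to brackets and to the level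
    correction. *)
Lemma move_sum (g : edge X -> R) (g' : edge Y -> R) (u : corner X -> R) (v : corner Y -> R) :
  (forall e, e <> e0 -> g' (i e) = g e) ->
  (forall t A, t \notin tau @: K -> v (rho t, A) = u (t, A)) ->
  (forall B : {set 'I_5}, #|B| = 2%N -> B != ~: K ->
    \sum_(l in ~: K) facet_val v (tau' l) l B = \sum_(k in K) facet_val u (tau k) k B) ->
  \sum_a g (phi a) * u a = \sum_b g' (phi b) * v b +
    g e0 * \sum_(k in K) facet_val u (tau k) k (~: K).
Proof.
move=> gg' uvout uvin.
have gc a b : corr K tau tau' rho a b -> g' (phi b) = g (phi a).
  by move=> ab; have [<- _] := ii ab; apply: gg'; exact: corr_not_central ab.
(* The value of [g'] at the edge named [B], and [g e0] if no new tetrahedron has such an edge. *)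
pose G (B : {set 'I_5}) : R :=
  if [pick la : 'I_5 * edge4 | (la.1 \notin K) && (label la.1 la.2 == B)] is Some la
  then g' (phi (tau' la.1, la.2)) else g e0.
have GY l A : l \in ~: K -> g' (phi (tau' l, A)) = G (label l A).
  rewrite inE => lK; rewrite /G; case: pickP => [[m B] /= /andP[mK /eqP mB]|/(_ (l, A))].
    have [a ab] := corr_exY (tau' l, A).
    have [rho' H' HC] := move3_sym H.
    have lK' : l \in ~: K by rewrite inE.
    have [k kK [ak kA]] := corr_tau (a := (tau' l, A)) H' lK' erefl (proj2 (HC _ _) ab).
    rewrite inE negbK in kK.
    have ab' : corr K tau tau' rho a (tau' m, B).
      by right; exists k, m; split=> //; rewrite mB -kA.
    by rewrite (corr_same H ab ab').
  by rewrite /= lK eqxx.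
have GX k A : k \in K -> g (phi (tau k, A)) = G (label k A).
  move=> kK; rewrite /G; case: pickP => [[m B] /= /andP[mK /eqP mB]|no].
    by apply/esym/gc; right; exists k, m.
  have [/eqP -> //|/eqP ne] := boolP (phi (tau k, A) == e0).
  have [b ab] := corr_exX ne.
  have [l lK [_ lA]] := corr_tau (a := (tau k, A)) H kK erefl ab.
  by have := no (l, b.2); rewrite /= lK -lA eqxx.
rewrite (sum_split _ (move_inj H)) (sum_split _ (move_inj' H)) -addrA; congr (_ + _).
  transitivity (\sum_(t' in rho @: ~: (tau @: K)) \sum_A g' (phi (t', A)) * v (t', A)).
    rewrite big_imset /=; last exact: move_outer_inj H.
    apply: eq_big => [t|t tS]; first by rewrite inE.
    apply: eq_bigr => A _; rewrite uvout //; congr (_ * _); apply/esym/gc.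
    by left.
  by rewrite (move_outer_im H); apply: eq_bigl => t; rewrite inE.
transitivity (\sum_B G B * \sum_(k in K) facet_val u (tau k) k B).
  under [RHS]eq_bigr => B _ do rewrite mulr_sumr.
  rewrite [RHS]exchange_big /=; apply: eq_bigr => k kK.
  by rewrite -sum_facet_val; apply: eq_bigr => A _; rewrite GX.
have -> : \sum_(l in ~: K) \sum_A g' (phi (tau' l, A)) * v (tau' l, A) =
    \sum_B G B * \sum_(l in ~: K) facet_val v (tau' l) l B.
  under [RHS]eq_bigr => B _ do rewrite mulr_sumr.
  rewrite [RHS]exchange_big /=; apply: eq_bigr => l lK.
  by rewrite -sum_facet_val; apply: eq_bigr => A _; rewrite GY.
rewrite (bigD1 (~: K)) //= addrC [in RHS](bigD1 (~: K)) //=.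
have -> : \sum_(l in ~: K) facet_val v (tau' l) l (~: K) = 0.
  apply: big1 => l lK; apply: big1 => A /eqP e.
  by have := notin_label l A; rewrite e lK.
rewrite mulr0 add0r; congr (_ + _).
  apply: eq_bigr => B BK; congr (_ * _); have [B2|B2] := eqVneq #|B| 2%N.
    by rewrite uvin.
  by rewrite !big1 // => l _; apply: facet_val0; apply/eqP.
congr (_ * _); rewrite /G; case: pickP => // -[m B] /= /andP[mK /eqP mB].
by have := notin_label m B; rewrite mB inE mK.
Qed.

End MoveEdges.

(** * Brackets in the facets of a 4-simplex *)

Section Facets.
Variables (R : realType).

Lemma sum_facet_label (Z : pseudo3) (u : corner Z -> R) t k A :
  facet_val u t k (label k A) = u (t, A).
Proof.
by rewrite /facet_val (big_pred1 A) // => B; rewrite /= (inj_eq (@label_inj k)).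
Qed.

Lemma facet_val_in (Z : pseudo3) (u : corner Z -> R) t k (B : {set 'I_5}) :
  k \in B -> facet_val u t k B = 0.
Proof.
by move=> kB; apply: big1 => A /eqP e; have := notin_label k A; rewrite e kB.
Qed.

(* The bracket of the edges P and Q of the facet opposite to k, for the orientations
   which the facets inherit from the 4-simplex. *)
Definition facet_bracket (s : bool) (k : 'I_5) (P Q : {set 'I_5}) : R :=
  \sum_(A : edge4 | label k A == P) \sum_(B : edge4 | label k B == Q)
    eps4 R (s (+) odd k) A B.

Lemma facet_bracket_label s k A B :
  facet_bracket s k (label k A) (label k B) = eps4 R (s (+) odd k) A B.
Proof.
rewrite /facet_bracket (big_pred1 A) => [|A']; last by rewrite /= (inj_eq (@label_inj k)).
by rewrite (big_pred1 B) // => B'; rewrite /= (inj_eq (@label_inj k)).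
Qed.

Lemma facet_bracketP s k (P Q : {set 'I_5}) : facet_bracket s k P Q = 0 \/
  exists A B, P = label k A /\ Q = label k B.
Proof.
case: (pickP (fun A : edge4 => label k A == P)) => [A /eqP eA|no]; last first.
  by left; rewrite /facet_bracket big_pred0.
case: (pickP (fun B : edge4 => label k B == Q)) => [B /eqP eB|no]; last first.
  by left; apply: big1 => A' _; rewrite big_pred0.
by right; exists A, B.
Qed.

Lemma facet_bracket_inl s k (P Q : {set 'I_5}) : k \in P -> facet_bracket s k P Q = 0.
Proof.
by move=> kP; have [//|[A [B [e _]]]] := facet_bracketP s k P Q;
  have := notin_label k A; rewrite -e kP.
Qed.

Lemma facet_bracket_inr s k (P Q : {set 'I_5}) : k \in Q -> facet_bracket s k P Q = 0.
Proof.
by move=> kP; have [//|[A [B [_ e]]]] := facet_bracketP s k P Q;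
  have := notin_label k B; rewrite -e kP.
Qed.

Lemma labelC k A : label k (edge4C A) = ~: (k |: label k A).
Proof.
apply/setP => x; rewrite !inE negb_or; have [->|xk] := eqVneq x k.
  by rewrite (negPf (notin_label _ _)).
by rewrite !mem_label //= inE.
Qed.

Lemma facet_bracket_asym s k P Q : facet_bracket s k P Q = - facet_bracket s k Q P.
Proof.
rewrite /facet_bracket [in RHS]exchange_big -sumrN; apply: eq_bigr => A _.
by rewrite -sumrN; apply: eq_bigr => B _; rewrite eps4_asym.
Qed.

Lemma facet_bracketC s k A Q :
  facet_bracket s k (~: (k |: label k A)) Q = facet_bracket s k (label k A) Q.
Proof.
rewrite -labelC; have [E1|[A1 [B [_ ->]]]] := facet_bracketP s k (label k A) Q; last first.
  by rewrite !facet_bracket_label eps4Cl.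
have [E2|[A1 [B [_ eQ]]]] := facet_bracketP s k (label k (edge4C A)) Q.
  by rewrite E1.
by rewrite eQ !facet_bracket_label eps4Cl.
Qed.

(** The identification of the common face has the parity given by [odd_vpos]; with the alternating
    signs of the facets it negates the orientation. *)
Lemma facet_bracket_face s k l (P Q : {set 'I_5}) : k != l -> k \notin P -> l \notin P ->
  k \notin Q -> l \notin Q -> facet_bracket s l P Q = - facet_bracket s k P Q.
Proof.
move=> kl kP lP kQ lQ.
have [P2|/eqP P2] := eqVneq #|P| 2%N; last first.
  have H j : facet_bracket s j P Q = 0.
    by have [//|[A [B [e _]]]] := facet_bracketP s j P Q; case: P2; rewrite e card_label.
  by rewrite !H oppr0.
have [Q2|/eqP Q2] := eqVneq #|Q| 2%N; last first.
  have H j : facet_bracket s j P Q = 0.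
    by have [//|[A [B [_ e]]]] := facet_bracketP s j P Q; case: Q2; rewrite e card_label.
  by rewrite !H oppr0.
have [A eA] := label_ex P2 kP; have [B eB] := label_ex Q2 kQ.
have lA : vpos k l \notin val A by rewrite -mem_label ?eA // eq_sym.
have lB : vpos k l \notin val B by rewrite -mem_label ?eB // eq_sym.
rewrite -eA -eB facet_bracket_label -(label_face kl lA) -(label_face kl lB).
rewrite facet_bracket_label eps4_img odd_lift_perm odd_perm1 addbF odd_vpos //.
rewrite -eps4N; congr eps4.
by case: s (odd k) (odd l) => [] [] [].
Qed.

(* Two edges of the 4-simplex with a common vertex lie in exactly two facets, which induce
   opposite orientations on their common face. *)
Lemma sum_facet_bracket s (P Q : {set 'I_5}) : \sum_j facet_bracket s j P Q = 0.
Proof.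
have [P2|/eqP P2] := eqVneq #|P| 2%N; last first.
  apply: big1 => j _; have [//|[A [B [e _]]]] := facet_bracketP s j P Q.
  by case: P2; rewrite e card_label.
have [Q2|/eqP Q2] := eqVneq #|Q| 2%N; last first.
  apply: big1 => j _; have [//|[A [B [_ e]]]] := facet_bracketP s j P Q.
  by case: Q2; rewrite e card_label.
have [PQ|PQ] := eqVneq P Q.
  apply: big1 => j _; have [//|[A [B [eA eB]]]] := facet_bracketP s j P Q.
  rewrite eA eB facet_bracket_label; have -> : A = B by apply: (@label_inj j); rewrite -eA -eB.
  exact: eps4_irr.
have I1 : (#|P :&: Q| <= 1)%N.
  rewrite leqNgt; apply/negP => I2; case/eqP: PQ; apply/eqP; rewrite eqEcard P2 Q2 leqnn andbT.
  apply/setIidPl/eqP; rewrite eqEcard subsetIl P2; exact: I2.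
have [I0|I0] := eqVneq (P :&: Q) set0.
  apply: big1 => j _; have [//|[A [B [eA eB]]]] := facet_bracketP s j P Q.
  rewrite eA eB facet_bracket_label.
  suff -> : B = edge4C A by exact: eps4_opp.
  apply: (@label_inj j); apply/eqP; rewrite eqEcard !card_label leqnn andbT labelC -eA -eB.
  apply/subsetP => x xQ; rewrite !inE negb_or; apply/andP; split.
    by apply: contraTneq xQ => ->; rewrite eB notin_label.
  by apply/negP => xP; move/setP: I0 => /(_ x); rewrite !inE xP xQ.
have cU : #|~: (P :|: Q)| = 2%N.
  rewrite cardsCs setCK cardsU P2 Q2 card_ord.
  by have : (0 < #|P :&: Q|)%N; [rewrite card_gt0 | case: #|_| I1 => [|[]]].
have /eqP/cards2P[x [y [xy eU]]] := cU.
have [xU yU] : x \in ~: (P :|: Q) /\ y \in ~: (P :|: Q) by rewrite eU !inE !eqxx orbT.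
rewrite (bigD1 x) //= (bigD1 y) 1?eq_sym //= [X in _ + (_ + X)]big1 ?addr0 => [|j /andP[jx jy]].
  move: xU yU; rewrite !inE !negb_or => /andP[xP xQ] /andP[yP yQ].
  by rewrite (facet_bracket_face s xy xP yP xQ yQ) subrr.
have : j \notin ~: (P :|: Q) by rewrite eU !inE negb_or jx.
by rewrite !inE negbK => /orP[jP|jQ]; [exact: facet_bracket_inl | exact: facet_bracket_inr].
Qed.

End Facets.

(** * The linear map of a 3-2 move and its Poisson property *)

Section MoveMatrix.
Variables (R : realType) (X Y : pseudo3) (K : {set 'I_5}).
Variables (tau : 'I_5 -> tet X) (tau' : 'I_5 -> tet Y) (rho : tet X -> tet Y).
Hypothesis H : move3 K tau tau' rho.
Variable s : bool.
Hypothesis pos_tau : forall k, k \in K -> positive (tau k) = s (+) odd k.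
Hypothesis pos_tau' : forall k, k \notin K -> positive (tau' k) = ~~ (s (+) odd k).
Hypothesis pos_rho : forall t, t \notin tau @: K -> positive (rho t) = positive t.
Hypothesis K3 : #|K| = 3%N.

(* The edge equal or opposite to A in the facet opposite to l which is not contained in K. *)
Definition apex_edge (l : 'I_5) (A : edge4) : {set 'I_5} :=
  if label l A \subset K then ~: (l |: label l A) else label l A.

(** Of two opposite edges of [tau' l], exactly one passes through the other vertex [j] outside [K].
    Containing [j] makes the facet opposite to [j] drop out of bracket sums. *)
Lemma apex_edge_in l A j : l \notin K -> j \notin K -> j != l -> j \in apex_edge l A.
Proof.
move=> lK jK jl; rewrite /apex_edge; case: ifPn => [sub|/subsetPn[x xA xK]].
  by rewrite !inE (negPf jl) /=; apply: contra jK => /(subsetP sub).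
have xl : x != l by apply: contraTneq xA => ->; rewrite notin_label.
have /eqP/cards2P[a [b [ab e]]] := cardCK K3.
have : [&& x \in ~: K, j \in ~: K & l \in ~: K] by rewrite !inE xK jK lK.
rewrite e !inE => /and3P[/pred2P[] ex /pred2P[] ej /pred2P[] el]; subst=> //;
  by rewrite ?eqxx in xl jl.
Qed.

Lemma facet_bracket_apex l A Q :
  facet_bracket R s l (apex_edge l A) Q = facet_bracket R s l (label l A) Q.
Proof. by rewrite /apex_edge; case: ifP => // _; exact: facet_bracketC. Qed.

(** At an edge through the other apex, the new angle is the sum of the old angles there. The old
    weight of an edge contained in [K] has to be split between the two new tetrahedra, and giving it
    the value of the opposite edge in each of them achieves this. *)
Definition move_rel (a : corner X) (b : corner Y) : bool :=
  ((a.1 \notin tau @: K) && (b == (rho a.1, a.2))) ||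
  [exists k in K, exists l in ~: K,
    [&& a.1 == tau k, b.1 == tau' l & label k a.2 == apex_edge l b.2]].

Lemma rho_outer t : t \notin tau @: K -> rho t \notin tau' @: (~: K).
Proof. by move=> tS; rewrite -in_setC -(move_outer_im H) imset_f // inE. Qed.

Lemma sum_move_rel_outer (F : corner X -> R) t A : t \notin tau @: K ->
  \sum_(a | move_rel a (rho t, A)) F a = F (t, A).
Proof.
move=> tS; apply: big_pred1 => -[t1 A1]; rewrite /move_rel /=.
apply/orP/eqP => [[/andP[t1S /eqP[e1 ->]]|/existsP[k /andP[_ /existsP[l /andP[lK]]]]]|[-> ->]].
- by rewrite (move_outer_inj H _ _ e1) ?inE.
- by move=> /and3P[_ /= /eqP e _]; have := rho_outer tS; rewrite e imset_f.
- by left; rewrite tS !eqxx.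
Qed.

Lemma sum_move_rel_inner (F : corner X -> R) l A : l \notin K ->
  \sum_(a | move_rel a (tau' l, A)) F a =
    \sum_(k in K) facet_val F (tau k) k (apex_edge l A).
Proof.
move=> lK; rewrite big_mkcond (sum_split _ (move_inj H)) /= big1 ?add0r => [|t tS]; last first.
  apply: big1 => B _; rewrite /move_rel /= tS /= xpair_eqE; case: ifP => // /orP[/andP[/eqP e _]|].
    by have := rho_outer tS; rewrite -e imset_f // inE.
  case/existsP => k /andP[kK /existsP[j /andP[_ /and3P[/eqP e _ _]]]].
  by rewrite e imset_f in tS.
apply: eq_bigr => k kK; rewrite /facet_val [RHS]big_mkcond /=; apply: eq_bigr => B _.
congr (if _ then _ else _); rewrite /move_rel /= imset_f //=.
apply/existsP/eqP => [[k' /andP[k'K /existsP[l' /andP[l'K /and3P[/eqP e1 /eqP e2 /eqP e3]]]]]|e].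
  have kk' := move_inj H kK k'K e1.
  have ll' : l = l' by apply: (move_inj' H) => //; rewrite inE.
  by rewrite kk' ll'.
by exists k; rewrite kK; apply/existsP; exists l; rewrite inE lK !eqxx /= e.
Qed.

(** The bracket on [X] of the pullback of the coordinate [b] with the coordinate [c]. *)
Definition dual_val (b : corner Y) (c : corner X) : R := \sum_(a | move_rel a b) bracket R a c.

Lemma dual_val_outer t A c : t \notin tau @: K -> dual_val (rho t, A) c = bracket R (t, A) c.
Proof. by move=> tS; exact: sum_move_rel_outer. Qed.

Lemma tau_eq k j : k \in K -> j \in K -> (tau k == tau j) = (k == j).
Proof. by move=> kK jK; apply/eqP/eqP => [/(move_inj H kK jK)|->]. Qed.

Lemma dual_val_inner l A : l \notin K ->
  (forall t C, t \notin tau @: K -> dual_val (tau' l, A) (t, C) = 0) /\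
  forall k P, k \in K -> facet_val (dual_val (tau' l, A)) (tau k) k P =
    facet_bracket R s k (apex_edge l A) P.
Proof.
move=> lK; split=> [t C tS|k P kK].
  rewrite /dual_val sum_move_rel_inner //; apply: big1 => k kK; apply: big1 => B _.
  rewrite /bracket /=; case: eqP => [e|_]; last by rewrite mul0r.
  by rewrite -e imset_f in tS.
rewrite /facet_val /facet_bracket [RHS]exchange_big /=. apply: eq_bigr => C _.
rewrite /dual_val sum_move_rel_inner // (bigD1 k) //= [X in _ + X]big1 ?addr0 => [|j /andP[jK jk]].
  by apply: eq_bigr => B _; rewrite /bracket /= eqxx mul1r pos_tau.
by apply: big1 => B _; rewrite /bracket /= tau_eq // (negPf jk) mul0r.
Qed.

(** In the vanishing sum over the five facets, the one outside [K] other than [l] contributes 0 by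
    [apex_edge_in]. *)
Lemma facet_bracket_sumK l A P : l \notin K ->
  \sum_(k in K) facet_bracket R s k (apex_edge l A) P = - facet_bracket R s l (label l A) P.
Proof.
move=> lK; have := sum_facet_bracket R s (apex_edge l A) P.
rewrite (bigID [in K]) /= [X in _ + X](bigD1 l) //= [X in _ + (_ + X)]big1 ?addr0.
  by rewrite facet_bracket_apex => /eqP; rewrite addr_eq0 => /eqP.
by move=> j /andP[jK jl]; apply: facet_bracket_inl; exact: apex_edge_in.
Qed.

Lemma facet_val_bracket l A P : l \notin K ->
  \sum_(j in ~: K) facet_val (bracket R (tau' l, A)) (tau' j) j P =
    - facet_bracket R s l (label l A) P.
Proof.
move=> lK; rewrite (bigD1 l) ?inE //= [X in _ + X]big1 ?addr0 => [|j /andP[]]; last first.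
  rewrite inE => jK jl; apply: big1 => B _; rewrite /bracket /=; case: eqP => [|_]; last by rewrite mul0r.
  by move=> /(move_inj' H) e; rewrite e ?eqxx ?inE in jl.
rewrite /facet_bracket (big_pred1 A) => [|A']; last by rewrite /= (inj_eq (@label_inj l)).
rewrite -sumrN; apply: eq_bigr => B _.
by rewrite /bracket /= eqxx mul1r pos_tau' // eps4N.
Qed.

(** For two new coordinates, [facet_bracket_sumK] leaves minus the bracket in the facet [l], which
    is the bracket of [tau' l] because the new tetrahedra carry the opposite signs. If the two new
    tetrahedra differ, the second apex edge contains [l] and the bracket is 0. *)
Lemma move_pform (phi psi : 'cV[R]_#|corner Y|) :
  pform (rel_mx R move_rel *m phi) (rel_mx R move_rel *m psi) = pform phi psi.
Proof.
apply: pform_rel_mx => b b'; rewrite exchange_big /=.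
rewrite -/(\sum_(a' | move_rel a' b') dual_val b a').
have outer t' : t' \notin tau' @: (~: K) -> exists2 t, t \notin tau @: K & t' = rho t.
  move=> cS; have : t' \in rho @: ~: (tau @: K) by rewrite (move_outer_im H) inE.
  by case/imsetP => t; rewrite inE => tS e; exists t.
have mixed t A l B : t \notin tau @: K -> l \notin K -> bracket R (rho t, A) (tau' l, B) = 0.
  move=> tS lK; rewrite /bracket /=; case: eqP => [e|_]; last by rewrite mul0r.
  by have := rho_outer tS; rewrite e imset_f // inE.
case: b b' => [t A] [t' A'].
have [/imsetP[l + ->]|/outer[t1 t1S ->]] := boolP (t \in tau' @: (~: K));
  have [/imsetP[l' + ->]|/outer[t2 t2S ->]] := boolP (t' \in tau' @: (~: K)).
- rewrite !inE => l'K lK; rewrite sum_move_rel_inner //.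
  have [_ h] := dual_val_inner A lK.
  under eq_bigr => k kK do rewrite h //.
  rewrite facet_bracket_sumK // /bracket /=; have [e|ne] := eqVneq (tau' l) (tau' l').
    have ll : l = l' by apply: (move_inj' H) => //; rewrite inE.
    rewrite -ll facet_bracket_asym facet_bracket_apex -facet_bracket_asym.
    by rewrite facet_bracket_label pos_tau' // eps4N mul1r.
  rewrite mul0r facet_bracket_inr ?oppr0 //; apply: apex_edge_in => //.
  by apply: contraNneq ne => ->.
- rewrite !inE => lK; rewrite sum_move_rel_outer //.
  by rewrite (proj1 (dual_val_inner A lK)) // bracket_asym mixed ?oppr0.
- rewrite !inE => l'K; rewrite sum_move_rel_inner // mixed //.
  apply: big1 => k kK; apply: big1 => B _; rewrite dual_val_outer // /bracket /=.
  case: eqP => [e|_]; last by rewrite mul0r.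
  by rewrite e imset_f in t1S.
- rewrite sum_move_rel_outer // dual_val_outer // /bracket /= pos_rho //.
  have [->|ne] := eqVneq t1 t2; first by rewrite !eqxx.
  case: eqP => [e|_]; last by rewrite !mul0r.
  by case/eqP: ne; apply: (move_outer_inj H) => //; rewrite inE.
Qed.

End MoveMatrix.

(** * Angles and weights in the bipyramid *)

Section FacetSums.
Variables (R : realType) (Z : pseudo3) (x : angles R Z) (t : tet Z).

Lemma uniq_vpos j a b c d : uniq [:: j; a; b; c; d] ->
  uniq [:: vpos j a; vpos j b; vpos j c; vpos j d].
Proof.
rewrite cons_uniq => /andP[jn u].
have <- : map (vpos j) [:: a; b; c; d] = [:: vpos j a; vpos j b; vpos j c; vpos j d] by [].
rewrite map_inj_in_uniq // => y z yin zin e.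
rewrite -(@vposK j y) ?e ?vposK //.
  by apply: contraNneq jn => <-.
by apply: contraNneq jn => <-.
Qed.

Lemma label_mkedge j a b : a != j -> b != j -> a != b ->
  label j (mkedge (vpos j a) (vpos j b)) = [set a; b].
Proof.
move=> aj bj ab; rewrite /label val_mkedge ?imsetU1 ?imset_set1 ?vposK //.
by apply: contra ab => /eqP e; rewrite -(vposK aj) e vposK.
Qed.

Lemma facet_val_mkedge (u : corner Z -> R) j a b : a != j -> b != j -> a != b ->
  facet_val u t j [set a; b] = u (t, mkedge (vpos j a) (vpos j b)).
Proof. by move=> aj bj ab; rewrite -(label_mkedge aj bj ab) sum_facet_label. Qed.

Lemma vertex_sum_facet j a b c d : uniq [:: j; a; b; c; d] ->
  vertex_sum t (vpos j a) x = facet_val (ang x) t j [set a; b] +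
    (facet_val (ang x) t j [set a; c] + facet_val (ang x) t j [set a; d]).
Proof.
move=> u; have := u; rewrite /= !inE !negb_or !andbT.
move=> /andP[/and4P[ja jb jc jd] /andP[/and3P[ab ac ad] _]].
rewrite /vertex_sum (sum_edge4_at _ (uniq_vpos u)).
by rewrite !facet_val_mkedge // eq_sym.
Qed.

End FacetSums.

Section FacetShapes.
Variables (R : realType) (Z : pseudo3) (x : angles R Z) (t : tet Z).
Hypothesis xg : gshapes R Z x.

Lemma facet_vertex j a b c d : uniq [:: j; a; b; c; d] ->
  facet_val (ang x) t j [set a; b] + (facet_val (ang x) t j [set a; c] +
    facet_val (ang x) t j [set a; d]) = pi.
Proof. by move=> u; rewrite -(vertex_sum_facet _ _ u); exact: xg. Qed.

(** Only vertex sums are imposed on generalized shapes: those at [a] and [b] minus those at [c] and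
    [d] give twice the difference of the two angles. *)
Lemma facet_opposite j a b c d : uniq [:: j; a; b; c; d] ->
  facet_val (ang x) t j [set a; b] = facet_val (ang x) t j [set c; d].
Proof.
move=> u.
have := facet_vertex u.
have /facet_vertex : uniq [:: j; b; a; c; d] by reorder u.
have /facet_vertex : uniq [:: j; c; a; b; d] by reorder u.
have /facet_vertex : uniq [:: j; d; a; b; c] by reorder u.
rewrite (setUC [set b] [set a]) (setUC [set c] [set a]) (setUC [set c] [set b]).
rewrite (setUC [set d] [set a]) (setUC [set d] [set b]) (setUC [set d] [set c]).
lra.
Qed.

End FacetShapes.

(** [p] and [q] are the apexes, joined by the central edge, and [k], [m], [n] the equatorial
    vertices. Exchanging and rotating the names carries one computation to all positions. *)
Definition bipyramid (K : {set 'I_5}) (p q k m n : 'I_5) : Prop :=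
  [/\ uniq [:: p; q; k; m; n], K = [set k; m; n] & ~: K = [set p; q]].

Section Bipyramid.
Variables (R : realType) (K : {set 'I_5}).

Lemma sum_bipyramid p q k m n (F : 'I_5 -> R) : bipyramid K p q k m n ->
  \sum_(j in K) F j = F k + (F m + F n) /\ \sum_(j in ~: K) F j = F p + F q.
Proof.
move=> [u eK eCK]; have := u; rewrite /= !inE !negb_or !andbT.
move=> /andP[/and4P[pq _ _ _] /andP[_ /andP[/andP[km kn] mn]]].
split; last by rewrite eCK big_setU1 ?big_set1 ?inE.
by rewrite eK -setUA big_setU1 ?inE ?negb_or ?km // big_setU1 ?big_set1 ?inE.
Qed.

Lemma bipyramid_swap p q k m n : bipyramid K p q k m n -> bipyramid K q p k m n.
Proof.
move=> [u eK eCK]; split=> //; last by rewrite eCK setUC.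
by reorder u.
Qed.

Lemma bipyramid_rot p q k m n : bipyramid K p q k m n -> bipyramid K p q m n k.
Proof.
move=> [u eK eCK]; split=> //; last by rewrite eK -setUA setUC.
by reorder u.
Qed.

Lemma bipyramid_tperm p q k m n : bipyramid K p q k m n -> bipyramid K p q k n m.
Proof.
move=> [u eK eCK]; split=> //; last by rewrite eK -setUA (setUC [set m]) setUA.
by reorder u.
Qed.

Lemma bipyramid_sub p q k m n : bipyramid K p q k m n ->
  [/\ p \notin K, q \notin K, k \in K, m \in K & n \in K].
Proof.
move=> [_ eK eCK]; split; first by rewrite -in_setC eCK !inE eqxx.
  by rewrite -in_setC eCK !inE eqxx orbT.
all: by rewrite eK !inE eqxx ?orbT.
Qed.

Lemma setC3 (p q k m n : 'I_5) : uniq [:: p; q; k; m; n] -> ~: [set p; m; n] = [set q; k].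
Proof.
move=> u; apply/eqP; rewrite eq_sym eqEcard; apply/andP; split.
  move: u; rewrite /= !inE !negb_or !andbT.
  move=> /andP[/and4P[pq pk pm pn] /andP[/and3P[qk qm qn] /andP[/andP[km kn] mn]]].
  apply/subsetP => x; rewrite !inE => /orP[] /eqP ->.
    by rewrite !negb_or eq_sym pq qm qn.
  by rewrite !negb_or eq_sym pk km kn.
move: u; rewrite /= !inE !negb_or !andbT.
move=> /andP[/and4P[pq pk pm pn] /andP[/and3P[qk qm qn] /andP[/andP[km kn] mn]]].
rewrite cards2 qk cardsCs setCK -setUA cardsU1 cards2 card_ord !inE negb_or pm pn mn.
by [].
Qed.

Lemma uniq_bipyramid (p q k m n : 'I_5) : uniq [:: p; q; k; m; n] ->
  [/\ uniq [:: p; m; n; q; k], uniq [:: k; q; p; m; n] , uniq [:: k; p; q; m; n] &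
    uniq [:: k; q; m; p; n]].
Proof.
by move=> u; split; reorder u.
Qed.

End Bipyramid.

Section MoveAngles.
Variables (R : realType) (X Y : pseudo3) (K : {set 'I_5}).
Variables (tau : 'I_5 -> tet X) (tau' : 'I_5 -> tet Y) (rho : tet X -> tet Y).
Hypothesis H : move3 K tau tau' rho.
Hypothesis K3 : #|K| = 3%N.
Local Notation M := (rel_mx R (move_rel K tau tau' rho)).

Lemma bipyramid_ex l k : l \notin K -> k \in K -> exists q m n, bipyramid K l q k m n.
Proof.
move=> lK kK.
have /cards1P[q eq] : #|~: K :\ l| == 1%N.
  by have := cardsD1 l (~: K); rewrite (cardCK K3) inE lK; lia.
have /cards2P[m [n [mn emn]]] : #|K :\ k| == 2%N.
  by have := cardsD1 k K; rewrite K3 kK; lia.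
have qP : q \in ~: K :\ l by rewrite eq inE.
have mP : m \in K :\ k by rewrite emn !inE eqxx.
have nP : n \in K :\ k by rewrite emn !inE eqxx orbT.
move: qP mP nP; rewrite !inE => /andP[ql qK] /andP[mk mK] /andP[nk nK].
have neq a b : a \notin K -> b \in K -> a != b by move=> aK; apply: contraTneq => <-.
exists q, m, n; split.
- rewrite /= !inE !negb_or (eq_sym l q) ql (neq l k) // (neq l m) // (neq l n) //.
  by rewrite (neq q k) // (neq q m) // (neq q n) // (eq_sym k m) (eq_sym k n) mk nk mn.
- by rewrite -setUA -emn setD1K.
- by rewrite -eq setD1K // inE.
Qed.

Lemma apex_edge1 (p q k m n : 'I_5) (A : edge4) : bipyramid K p q k m n -> label p A = [set q; k] ->
  apex_edge K p A = [set q; k].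
Proof.
move=> b e; have [_ qK _ _ _] := bipyramid_sub b; rewrite /apex_edge e.
by case: ifP => // /subsetP/(_ q); rewrite !inE eqxx (negPf qK) => /(_ isT).
Qed.

Lemma apex_edge2 (p q k m n : 'I_5) (A : edge4) : bipyramid K p q k m n -> label p A = [set m; n] ->
  apex_edge K p A = [set q; k].
Proof.
move=> b e; have [u eK _] := b; have [_ _ _ mK nK] := bipyramid_sub b.
rewrite /apex_edge e ifT; last by apply/subsetP => x; rewrite !inE => /orP[] /eqP ->.
by rewrite setUA (setC3 u).
Qed.

Lemma bipyramid_pair (P : {set 'I_5}) : #|P| = 2%N -> P != ~: K ->
  exists p q k m n, bipyramid K p q k m n /\ (P = [set m; n] \/ P = [set q; k]).
Proof.
move=> P2 PK; have [sub|/subsetPn[q qP qK]] := boolP (P \subset K).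
  have /cards1P[k ek] : #|K :\: P| == 1%N by rewrite cardsDS // K3 P2.
  have kP : k \in K :\: P by rewrite ek inE.
  move: kP; rewrite inE => /andP[kP kK].
  have [p pK] : exists p, p \notin K.
    have /card_gt0P[p] : (0 < #|~: K|)%N by rewrite (cardCK K3).
    by rewrite inE => pK; exists p.
  have [q [m [n b]]] := bipyramid_ex pK kK; exists p, q, k, m, n; split=> //; left.
  apply/eqP; rewrite eqEcard P2; have [u eK _] := b; apply/andP; split.
    apply/subsetP => y yP; have := subsetP sub y yP; rewrite eK !inE -orbA => /orP[/eqP yk|//].
    by rewrite -yk yP in kP.
  by rewrite cards2; case: (m == n).
have /cards1P[k ek] : #|P :\ q| == 1%N by have := cardsD1 q P; rewrite P2 qP; lia.
have eP : P = [set q; k] by rewrite -ek setD1K.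
have kK : k \in K.
  apply: contraNT PK => kK; rewrite eqEcard P2 (cardCK K3) leqnn andbT eP.
  by apply/subsetP => y; rewrite !inE => /orP[] /eqP ->.
have [p [m [n /bipyramid_swap b]]] := bipyramid_ex qK kK.
by exists p, q, k, m, n; split=> //; right.
Qed.

Lemma move_ang_outer x t A : t \notin tau @: K -> ang (x *m M) (rho t, A) = ang x (t, A).
Proof. by move=> tS; rewrite ang_rel_mx (sum_move_rel_outer H). Qed.

Lemma move_ang_inner x p q k m n : bipyramid K p q k m n ->
  facet_val (ang (x *m M)) (tau' p) p [set q; k] =
    \sum_(j in K) facet_val (ang x) (tau j) j [set q; k] /\
  facet_val (ang (x *m M)) (tau' p) p [set m; n] =
    \sum_(j in K) facet_val (ang x) (tau j) j [set q; k].
Proof.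
move=> b; have [u eK _] := b; have [pK _ _ _ _] := bipyramid_sub b.
have [v _ _ _] := uniq_bipyramid u.
have [A hA] : exists A, label p A = [set q; k].
  move: u; rewrite /= !inE !negb_or => /andP[/and4P[pq pk _ _] /andP[/and3P[qk _ _] _]].
  by apply: label_ex; rewrite ?cards2 ?qk // !inE negb_or pq.
have [B hB] : exists B, label p B = [set m; n].
  move: v; rewrite /= !inE !negb_or => /andP[/and4P[pm pn _ _] /andP[/and3P[mn _ _] _]].
  by apply: label_ex; rewrite ?cards2 ?mn // !inE negb_or pm.
split; first by rewrite -{1}hA sum_facet_label ang_rel_mx (sum_move_rel_inner H) // (apex_edge1 b hA).
by rewrite -hB sum_facet_label ang_rel_mx (sum_move_rel_inner H) // (apex_edge2 b hB).
Qed.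

Section Gshape.
Variable x : angles R X.
Hypothesis xg : gshapes R X x.
Local Notation V j P := (facet_val (ang x) (tau j) j P).
Hypothesis xe : \sum_(j in K) V j (~: K) = 2 * pi.
Local Notation W j P := (facet_val (ang (x *m M)) (tau' j) j P).

Lemma facet_val_selfs (Z : pseudo3) (u : corner Z -> R) t j a :
  facet_val u t j [set j; a] = 0 /\ facet_val u t j [set a; j] = 0.
Proof. by split; apply: facet_val_in; rewrite !inE eqxx ?orbT. Qed.

Lemma bipyramid_relations p q k m n : bipyramid K p q k m n ->
  [/\ V k [set q; m] + (V k [set q; n] + V k [set p; q]) = pi,
      V k [set p; q] = V k [set m; n],
      V k [set q; m] = V k [set p; n] &
      V k [set q; n] = V k [set p; m]].
Proof.
move=> [u _ _]; split.
- have /(facet_vertex (tau k) xg) : uniq [:: k; q; m; n; p] by reorder u.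
  by rewrite (setUC [set q] [set p]).
- have /(facet_opposite (tau k) xg) -> // : uniq [:: k; p; q; m; n] by reorder u.
- have /(facet_opposite (tau k) xg) -> // : uniq [:: k; q; m; p; n] by reorder u.
- have /(facet_opposite (tau k) xg) -> // : uniq [:: k; q; n; p; m] by reorder u.
Qed.

(** At an edge from an apex this is the definition of [M]. At the equatorial edge [mn], the vertex
    sums in [tau m] and [tau n] turn the new weight into [2 pi] minus their angles at the central
    edge, which is the angle of [tau k] at [pq], hence at [mn]. *)
Lemma move_bipyramid_weight (P : {set 'I_5}) : #|P| = 2%N -> P != ~: K ->
  \sum_(j in ~: K) W j P = \sum_(j in K) V j P.
Proof.
move=> P2 PK; have [p [q [k [m [n [b eP]]]]]] := bipyramid_pair P2 PK.
have [_ ->] := sum_bipyramid (fun j => W j P) b; case: eP => ->; last first.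
  have [E1 _] := move_ang_inner x b.
  by rewrite E1 (proj1 (facet_val_selfs _ _ _ _)) addr0.
have [_ _ eCK] := b.
have [-> _] := sum_bipyramid (fun j => V j [set m; n]) b.
have [_ E1] := move_ang_inner x b; have [_ E2] := move_ang_inner x (bipyramid_swap b).
have [F1 _] := sum_bipyramid (fun j => V j [set q; k]) b.
have [F2 _] := sum_bipyramid (fun j => V j [set p; k]) b.
have [F3 _] := sum_bipyramid (fun j => V j [set p; q]) b.
have [r1 r2 r3 r4] := bipyramid_relations b.
have [s1 s2 s3 s4] := bipyramid_relations (bipyramid_rot b).
have [t1 t2 t3 t4] := bipyramid_relations (bipyramid_rot (bipyramid_rot b)).
rewrite E1 E2 F1 F2; move: xe; rewrite eCK F3.
rewrite !(proj2 (facet_val_selfs _ _ _ _)) (proj1 (facet_val_selfs _ _ _ _)).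
by lra.
Qed.

Lemma move_gshapes : gshapes R Y (x *m M).
Proof.
move=> t' v; rewrite -/(vertex_sum t' v (x *m M)).
have [/imsetP[p + ->]|tS] := boolP (t' \in tau' @: (~: K)); last first.
  have : t' \in rho @: ~: (tau @: K) by rewrite (move_outer_im H) inE.
  case/imsetP => t; rewrite inE => tS' ->; rewrite -(xg t v).
  by apply: eq_bigr => A _; rewrite move_ang_outer.
rewrite inE => pK.
have [a ap ->] : exists2 a, a != p & v = vpos p a.
  by exists (lift p v); rewrite ?lift_vpos // eq_sym neq_lift.
have key q k m n : bipyramid K p q k m n ->
    [/\ W p [set q; k] = V m [set q; k] + V n [set q; k] ,
        W p [set m; n] = W p [set q; k] &
        V k [set p; q] + (V m [set p; q] + V n [set p; q]) = 2 * pi].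
  move=> b; have [E1 E2] := move_ang_inner x b; rewrite E1 E2; split=> //.
    have [-> _] := sum_bipyramid (fun j => V j [set q; k]) b.
    by rewrite (proj2 (facet_val_selfs _ _ _ _)) add0r.
  have [<- _] := sum_bipyramid (fun j => V j [set p; q]) b.
  by have [_ _ <-] := b.
(* By the vertex sum at [q], each old tetrahedron contributes [pi] minus its angle at the central
   edge; the total is [3 pi - 2 pi]. *)
have all3 q k m n : bipyramid K p q k m n ->
    W p [set q; k] + (W p [set q; m] + W p [set q; n]) = pi.
  move=> b; have [-> _ e] := key _ _ _ _ b.
  have [-> _ _] := key _ _ _ _ (bipyramid_rot b).
  have [-> _ _] := key _ _ _ _ (bipyramid_rot (bipyramid_rot b)).
  have [r1 r2 r3 r4] := bipyramid_relations b.
  have [s1 s2 s3 s4] := bipyramid_relations (bipyramid_rot b).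
  have [t1 t2 t3 t4] := bipyramid_relations (bipyramid_rot (bipyramid_rot b)).
  by lra.
have [aK|aK] := boolP (a \in K); last first.
  have [k kK] : exists k, k \in K by apply/card_gt0P; rewrite K3.
  have [q [m [n b]]] := bipyramid_ex pK kK.
  have <- : q = a.
    have [_ _ eCK] := b; have : a \in ~: K by rewrite inE.
    by rewrite eCK !inE (negPf ap) => /eqP.
  by have [u _ _] := b; rewrite (vertex_sum_facet _ _ u); exact: all3.
have [q [m [n b]]] := bipyramid_ex pK aK.
have u : uniq [:: p; a; q; m; n].
  by have [u _ _] := b; reorder u.
rewrite (vertex_sum_facet _ _ u) (setUC [set a] [set q]).
have [_ E1 _] := key _ _ _ _ (bipyramid_rot b).
have [_ E2 _] := key _ _ _ _ (bipyramid_rot (bipyramid_rot b)).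
rewrite (setUC [set a] [set n]) E2 E1 [X in _ + X]addrC.
exact: all3.
Qed.

End Gshape.
End MoveAngles.

(** * The square of the bracket; gauge directions and levels under a move *)

Section EpsSquare.
Variables (R : realType) (pos : bool).
Local Notation E := (eps4 R pos).

(* On the three pairs of opposite edges the bracket is a cyclic matrix of entries 0, 1, -1. *)
Lemma eps4_square (A : edge4) : exists A1 A2 : edge4,
  [/\ forall F : edge4 -> R, \sum_B F B = F A + (F A1 + (F A2 +
        (F (edge4C A) + (F (edge4C A1) + F (edge4C A2))))),
      E A1 A2 = E A A1, E A2 A = E A A1, E A A1 ^+ 2 = 1 &
      forall C, C \in [:: A; A1; A2; edge4C A; edge4C A1; edge4C A2]].
Proof.
have [a [b [ab ->]]] := edge4P A; have [c [d u]] := ex_uniq4 ab.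
exists (mkedge a c), (mkedge a d).
have u1 : uniq [:: a; c; b; d] by reorder u.
have u2 : uniq [:: a; d; b; c] by reorder u.
have u3 : uniq [:: a; c; d; b] by reorder u.
rewrite (mkedgeC4 u) (mkedgeC4 u1) (mkedgeC4 u2).
split.
- by move=> F; rewrite (sum_edge4 _ u).
- exact: eps4_turn.
- by rewrite (eps4_turn R pos u3); exact: eps4_turn.
- move: u; rewrite /= !inE !negb_or !andbT => /andP[/and3P[_ ac ad] /andP[/andP[bc bd] cd]].
  by apply: (eps4_sqr R pos ab ac bc); rewrite val_mkedge.
- by move=> C; exact: mkedgeP.
Qed.

(** On the three pairs, the square of the cyclic matrix has -2 on the diagonal and 1 elsewhere;
    summing over edges counts each pair twice. *)
Lemma eps4_square_same A : \sum_B E A B * E B A = - 4.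
Proof.
have [A1 [A2 [S e1 e2 sq _]]] := eps4_square A.
rewrite S !eps4Cl !eps4Cr !eps4_irr (eps4_asym R pos A A2) (eps4_asym R pos A1 A) e2.
move: sq; rewrite expr2 => sq; lra.
Qed.

Lemma eps4_square_other A C : C <> A -> C <> edge4C A -> \sum_B E A B * E B C = 2.
Proof.
move=> CA CAc; have [A1 [A2 [S e1 e2 + inl]]] := eps4_square A; rewrite expr2 => sq.
have : [\/ C = A1, C = A2, C = edge4C A1 | C = edge4C A2].
  move: (inl C); rewrite in_cons => /predU1P[//|]; rewrite in_cons => /predU1P[->|]; first by constructor 1.
  rewrite in_cons => /predU1P[->|]; first by constructor 2.
  rewrite in_cons => /predU1P[//|]; rewrite in_cons => /predU1P[->|]; first by constructor 3.
  by rewrite mem_seq1 => /eqP ->; constructor 4.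
have H1 : \sum_B E A B * E B A1 = 2.
  rewrite S !eps4Cl !eps4Cr !eps4_irr (eps4_asym R pos A A2) (eps4_asym R pos A2 A1) e2 e1; lra.
have H2 : \sum_B E A B * E B A2 = 2.
  rewrite S !eps4Cl !eps4Cr !eps4_irr (eps4_asym R pos A A2) e2 e1; lra.
have HC D : \sum_B E A B * E B (edge4C D) = \sum_B E A B * E B D.
  by apply: eq_bigr => B _; rewrite eps4Cr.
by case=> ->; [exact: H1 | exact: H2 | rewrite HC; exact: H1 | rewrite HC; exact: H2].
Qed.

End EpsSquare.

Section MoveGauge.
Variables (R : realType) (X Y : pseudo3) (K : {set 'I_5}).
Variables (tau : 'I_5 -> tet X) (tau' : 'I_5 -> tet Y) (rho : tet X -> tet Y).
Hypothesis H : move3 K tau tau' rho.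
Variable s : bool.
Hypothesis pos_tau : forall k, k \in K -> positive (tau k) = s (+) odd k.
Hypothesis pos_tau' : forall k, k \notin K -> positive (tau' k) = ~~ (s (+) odd k).
Hypothesis pos_rho : forall t, t \notin tau @: K -> positive (rho t) = positive t.
Hypothesis K3 : #|K| = 3%N.
Variable e0 : edge X.
Hypothesis e0E : central_edge K tau e0.
Hypothesis e0int : ~~ bd_edge e0.
Variables (i : edge X -> edge Y) (i' : edge Y -> edge X).
Hypothesis ii : forall a b, corr K tau tau' rho a b -> i (phi a) = phi b /\ i' (phi b) = phi a.
Local Notation M := (rel_mx R (move_rel K tau tau' rho)).

Lemma sum_central (F : corner X -> R) :
  \sum_(a | phi a == e0) F a = \sum_(k in K) facet_val F (tau k) k (~: K).
Proof.
rewrite big_mkcond (sum_split _ (move_inj H)) /= big1 ?add0r => [|t tS].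
  apply: eq_bigr => k kK; rewrite /facet_val [RHS]big_mkcond /=; apply: eq_bigr => A _.
  congr (if _ then _ else _); apply/eqP/eqP => [/(phi_central e0E)[k' [k'K /= e1 e2]]|e].
    by rewrite (move_inj H kK k'K e1).
  by apply/(phi_central e0E); exists k.
apply: big1 => A _; case: eqP => // /(phi_central e0E)[k [kK /= e _]].
by rewrite e imset_f in tS.
Qed.

Lemma wset_central x : wset [set e0] x ->
  gshapes R X x /\ \sum_(k in K) facet_val (ang x) (tau k) k (~: K) = 2 * pi.
Proof.
by move=> [xg xw]; split=> //; rewrite -sum_central -weightE xw // inE.
Qed.

Lemma central_wset x : gshapes R X x ->
  \sum_(k in K) facet_val (ang x) (tau k) k (~: K) = 2 * pi -> wset [set e0] x.
Proof.
by move=> xg xw; split=> // e; rewrite inE => /eqP ->; rewrite weightE sum_central.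
Qed.

Lemma move_weighted_sum x (g : edge X -> R) (g' : edge Y -> R) :
  (forall e, e <> e0 -> g' (i e) = g e) -> wset [set e0] x ->
  \sum_a g (phi a) * ang x a = \sum_b g' (phi b) * ang (x *m M) b + g e0 * (2 * pi).
Proof.
move=> gg' /wset_central[xg xe].
rewrite (move_sum H K3 e0E ii (v := ang (x *m M)) gg') ?xe //.
  by move=> t A tS; rewrite (move_ang_outer H).
by move=> P P2 PK; rewrite (move_bipyramid_weight H K3 xg xe).
Qed.

Lemma move_weight x e : wset [set e0] x -> e <> e0 -> weight (x *m M) (i e) = weight x e.
Proof.
move=> xD ee0.
have gg' e' : e' <> e0 -> (i e' == i e)%:R = (e' == e)%:R :> R.
  move=> h; congr (_%:R : R); congr nat_of_bool; apply/eqP/eqP => [/(congr1 i')|->//].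
  by rewrite !(move_edgeK K3 e0E ii).
have := move_weighted_sum (g := fun e' => (e' == e)%:R)
  (g' := fun e' => (e' == i e)%:R) gg' xD; have [e1|_] := eqVneq e0 e; first by case: ee0.
rewrite mul0r addr0 !weightE => h.
have E (Z : pseudo3) (u : corner Z -> R) (f : edge Z) :
    \sum_(a | phi a == f) u a = \sum_a (phi a == f)%:R * u a.
  by rewrite big_mkcond; apply: eq_bigr => a _; case: eqP; rewrite ?mul1r ?mul0r.
by rewrite !E h.
Qed.

(** [move_sum] for the brackets with one coordinate [b] of [Y]. No new tetrahedron contains the
    central edge, so the central term is 0 and the value of [g] at [e0] is forgotten. *)
Lemma move_gauge_dir (g : edge X -> R) (g' : edge Y -> R) :
  (forall e, e <> e0 -> g' (i e) = g e) -> gauge_dir g *m M = gauge_dir g'.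
Proof.
move=> gg'; apply: gauge_dir_rel_mx => b.
have [outs ins] : (forall t A, t \notin tau @: K ->
      bracket R b (rho t, A) = dual_val R K tau tau' rho b (t, A)) /\
    (forall P : {set 'I_5}, \sum_(l in ~: K) facet_val (bracket R b) (tau' l) l P =
      \sum_(k in K) facet_val (dual_val R K tau tau' rho b) (tau k) k P).
  case: b => t A; have [/imsetP[l + ->]|tS] := boolP (t \in tau' @: (~: K)).
    rewrite inE => lK; have [h1 h2] := dual_val_inner R H pos_tau A lK; split=> [t1 B t1S|P].
      rewrite h1 // /bracket /=; case: eqP => [e|_]; last by rewrite mul0r.
      by have := rho_outer H t1S; rewrite -e imset_f // inE.
    under [RHS]eq_bigr => k kK do rewrite h2 //.
    by rewrite (facet_val_bracket R H pos_tau') // (facet_bracket_sumK R s K3).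
  have : t \in rho @: ~: (tau @: K) by rewrite (move_outer_im H) inE.
  case/imsetP => t1; rewrite inE => t1S ->; split=> [t2 B t2S|P].
    rewrite (dual_val_outer R H) // /bracket /= pos_rho //; congr ((_ : bool)%:R * _).
    by apply/eqP/eqP => [|->//]; apply: (move_outer_inj H); rewrite inE.
  rewrite !big1 // => k kK; apply: big1 => B _.
    rewrite (dual_val_outer R H) // /bracket /=; case: eqP => [e|_]; last by rewrite mul0r.
    by rewrite e imset_f in t1S.
  rewrite /bracket /=; case: eqP => [e|_]; last by rewrite mul0r.
  by have := rho_outer H t1S; rewrite e imset_f.
have -> : \sum_c (\sum_(a | move_rel K tau tau' rho a b) bracket R a c) * g (phi c) =
    \sum_c g (phi c) * dual_val R K tau tau' rho b c.
  by apply: eq_bigr => c _; rewrite mulrC.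
rewrite (move_sum H K3 e0E ii (v := bracket R b) gg') //; last first.
have -> : \sum_(k in K) facet_val (dual_val R K tau tau' rho b) (tau k) k (~: K) = 0.
  rewrite -ins; apply: big1 => l lK; exact: facet_val_in.
by rewrite mulr0 addr0; apply: eq_bigr => c _; rewrite mulrC.
Qed.

(* The correction of the level in [leveled_pachner] has the opposite sign; only this one is
   compatible with [level_shift]. *)
Definition move_level : 'cV[R]_#|corner X| :=
  \col_k (- (12 * pi)^-1 * \sum_(a | phi a == e0) bracket R a (enum_val k)).

(** The coefficient of [g] in the level correction along [gauge_dir g]; the factor [pi] of gauge
    directions cancels the one in [move_level]. *)
Let w (c : corner X) : R :=
  - 12^-1 * \sum_(a | phi a == e0) \sum_b bracket R a b * bracket R b c.

Lemma pairing_move_level (g : edge X -> R) :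
  pairing (gauge_dir g) move_level = \sum_c g (phi c) * w c.
Proof.
rewrite pairingE.
transitivity (- 12^-1 * \sum_b (\sum_c bracket R b c * g (phi c)) *
    \sum_(a | phi a == e0) bracket R a b).
  rewrite mulr_sumr; apply: eq_bigr => b _; rewrite ang_gauge_dir mxE enum_rankK.
  have := gt_eqF (pi_gt0 R); move: (pi : R) => P P0; field; rewrite P0 //.
transitivity (- 12^-1 * \sum_c g (phi c) * \sum_(a | phi a == e0) \sum_b
    bracket R a b * bracket R b c); last first.
  by rewrite mulr_sumr; apply: eq_bigr => c _; rewrite /w mulrCA.
congr (_ * _); under eq_bigr => b _ do rewrite mulr_suml.
rewrite exchange_big /=; apply: eq_bigr => c _.
rewrite [in RHS]exchange_big mulr_sumr /=; apply: eq_bigr => b _.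
by rewrite -mulr_suml; ring.
Qed.

Lemma w_outer t A : t \notin tau @: K -> w (t, A) = 0.
Proof.
move=> tS; rewrite /w big1 ?mulr0 // => a /eqP /(phi_central e0E)[k [kK ak _]].
apply: big1 => b _; rewrite /bracket /=; have [e1|_] := eqVneq a.1 b.1; last by rewrite !mul0r.
have [e2|_] := eqVneq b.1 t; last by rewrite mul0r mulr0.
by rewrite -e2 -e1 ak imset_f in tS.
Qed.

Lemma w_inner k C : k \in K -> w (tau k, C) =
  - 12^-1 * \sum_(A : edge4 | label k A == ~: K) \sum_B
     eps4 R (positive (tau k)) A B * eps4 R (positive (tau k)) B C.
Proof.
move=> kK; rewrite /w sum_central; congr (_ * _).
rewrite (bigD1 k) //= [X in _ + X]big1 ?addr0 => [|j /andP[jK jk]].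
  apply: eq_bigr => A _; rewrite sum_bracket /=; apply: eq_bigr => B _.
  by rewrite /bracket /= eqxx mul1r.
apply: big1 => A _; rewrite sum_bracket /=; apply: big1 => B _.
by rewrite /bracket /= (tau_eq H) // (negPf jk) mul0r mulr0.
Qed.

(** The double brackets -4 and 2, multiplied by -1/12. *)
Lemma w_facet p q k m n : bipyramid K p q k m n ->
  [/\ facet_val w (tau k) k [set p; q] = 3^-1, facet_val w (tau k) k [set m; n] = 3^-1 &
      facet_val w (tau k) k [set q; m] = - 6^-1].
Proof.
move=> b; have [u eK eCK] := b; have [pK qK kK mK nK] := bipyramid_sub b.
have := u; rewrite /= !inE !negb_or !andbT.
move=> /andP[/and4P[pq pk pm pn] /andP[/and3P[qk qm qn] /andP[/andP[km kn] mn]]].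
have [A hA] : exists A, label k A = [set p; q].
  by apply: label_ex; rewrite ?cards2 ?pq // !inE negb_or ![k == _]eq_sym pk qk.
have [B hB] : exists B, label k B = [set m; n].
  by apply: label_ex; rewrite ?cards2 ?mn // !inE negb_or km kn.
have [C hC] : exists C, label k C = [set q; m].
  by apply: label_ex; rewrite ?cards2 ?qm // !inE negb_or (eq_sym k) qk km.
have EB : B = edge4C A.
  apply: (@label_inj k); rewrite labelC hA hB setUA; apply/esym.
  rewrite -setUA -[RHS]setCK; congr (~: _).
  apply/eqP; rewrite eqEcard; apply/andP; split.
    apply/subsetP => x; rewrite !inE => /or3P[] /eqP ->; rewrite negb_or.
    - by rewrite km kn.
    - by rewrite pm pn.
    - by rewrite qm qn.
  by rewrite cardsCs setCK cards2 mn card_ord cardsU1 cards2 pq !inE negb_or ![k == _]eq_sym pk qk.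
have S D : facet_val w (tau k) k (label k D) = - 12^-1 * \sum_B
     eps4 R (positive (tau k)) A B * eps4 R (positive (tau k)) B D.
  rewrite sum_facet_label w_inner // eCK -hA (big_pred1 A) //.
  by move=> A'; rewrite /= (inj_eq (@label_inj k)).
rewrite -hA -hB -hC !S EB.
under [X in [/\ _, _ * X = _ & _]]eq_bigr => D _ do rewrite eps4Cr.
rewrite eps4_square_same eps4_square_other.
- by split; lra.
- move=> e; have : m \in label k A by rewrite -e hC !inE eqxx orbT.
  by rewrite hA !inE (eq_sym m) (negPf pm) (eq_sym m) (negPf qm).
- rewrite -EB => e; have : q \in label k B by rewrite -e hC !inE eqxx.
  by rewrite hB !inE (negPf qm) (negPf qn).
Qed.

Lemma facet_val_cst (Z : pseudo3) (c : R) (t : tet Z) k (P : {set 'I_5}) :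
  #|P| = 2%N -> k \notin P -> facet_val (fun=> c) t k P = c.
Proof. by move=> P2 kP; have [A <-] := label_ex P2 kP; rewrite sum_facet_label. Qed.

Lemma facet_valD (Z : pseudo3) (u v : corner Z -> R) (t : tet Z) k (P : {set 'I_5}) :
  facet_val (fun a => u a + v a) t k P = facet_val u t k P + facet_val v t k P.
Proof. by rewrite /facet_val big_split. Qed.

(** Adding 1/3 to [w] gives 2/3 at the central edge and its opposites, and 1/6 at the other edges of
    the old tetrahedra. An equatorial edge has 2/3 from one old tetrahedron against twice 1/3 from
    two new ones; an edge from an apex has twice 1/6 against 1/3. At [e0] the total 2 cancels the
    weight [2 pi] divided by [pi]. *)
Lemma move_level_shift x (g : edge X -> R) (g' : edge Y -> R) :
  (forall e, e <> e0 -> g' (i e) = g e) -> wset [set e0] x ->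
  pairing (gauge_dir g) move_level + level_shift g x = level_shift g' (x *m M).
Proof.
move=> gg' xD.
have neqs p q k m n : bipyramid K p q k m n -> [/\ [&& p != q, q != k & m != n],
    (p \notin [set m; n]) && (q \notin [set m; n]), p \notin [set q; k],
    k \notin [set m; n] & (m \notin [set q; k]) && (n \notin [set q; k])].
  move=> [u _ _]; move: u; rewrite /= !inE !negb_or !andbT.
  move=> /andP[/and4P[pq pk pm pn] /andP[/and3P[qk qm qn] /andP[/andP[km kn] mn]]].
  by rewrite ![m == _]eq_sym ![n == _]eq_sym pq qk mn pm pn qm qn pk km kn.
have key := move_sum H K3 e0E ii (u := fun a => w a + 3^-1) (v := fun=> 3^-1) gg'.
have {key} key : \sum_a g (phi a) * (w a + 3^-1) = \sum_b g' (phi b) * 3^-1 + g e0 * 2.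
  rewrite key.
  - congr (_ + _ * _).
    have [p [q [k [m [n b]]]]] : exists p q k m n, bipyramid K p q k m n.
      have /card_gt0P[p] : (0 < #|~: K|)%N by rewrite (cardCK K3).
      have /card_gt0P[k kK] : (0 < #|K|)%N by rewrite K3.
      rewrite inE => pK; have [q [m [n b]]] := bipyramid_ex K3 pK kK.
      by exists p, q, k, m, n.
    have F p1 q1 k1 m1 n1 : bipyramid K p1 q1 k1 m1 n1 ->
        facet_val (fun a => w a + 3^-1) (tau k1) k1 (~: K) = 3^-1 + 3^-1.
      move=> b1; have [/and3P[pq _ _] _ _ _ _] := neqs _ _ _ _ _ b1.
      have [_ _ eCK] := b1; have [_ _ k1K _ _] := bipyramid_sub b1.
      rewrite facet_valD eCK; have [-> _ _] := w_facet b1; rewrite facet_val_cst ?cards2 ?pq //.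
      by rewrite -eCK inE k1K.
    have [-> _] := sum_bipyramid
      (fun j => facet_val (fun a => w a + 3^-1) (tau j) j (~: K)) b.
    rewrite (F _ _ _ _ _ b) (F _ _ _ _ _ (bipyramid_rot b)).
    by rewrite (F _ _ _ _ _ (bipyramid_rot (bipyramid_rot b))); lra.
  - by move=> t A tS; rewrite w_outer // add0r.
  move=> P P2 PK; have [p [q [k [m [n [b eP]]]]]] := bipyramid_pair K3 P2 PK.
  have [_ ->] := sum_bipyramid (fun j => facet_val (fun=> 3^-1 : R) (tau' j) j P) b.
  have [-> _] := sum_bipyramid (fun j => facet_val (fun a => w a + 3^-1) (tau j) j P) b.
  have [_ /andP[p1 p2] p3 p4 /andP[p5 p6]] := neqs _ _ _ _ _ b.
  case: eP => eP; rewrite eP in P2 *.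
    rewrite (proj1 (facet_val_selfs _ _ _ _)) (proj2 (facet_val_selfs _ _ _ _)) !facet_valD.
    by have [_ -> _] := w_facet b; rewrite !facet_val_cst //; lra.
  rewrite (proj1 (facet_val_selfs _ _ _ _)) (proj2 (facet_val_selfs _ _ _ _)) !facet_valD.
  have [_ _ ->] := w_facet (bipyramid_tperm (bipyramid_rot b)).
  have [_ _ ->] := w_facet (bipyramid_rot (bipyramid_rot b)).
  by rewrite !facet_val_cst //; lra.
have wsum := move_weighted_sum gg' xD.
rewrite pairing_move_level !level_shift_corners.
have E (Z : pseudo3) (f : edge Z -> R) (z : angles R Z) :
    \sum_a f (phi a) * (3^-1 - ang z a / pi) =
    \sum_a f (phi a) * 3^-1 - (\sum_a f (phi a) * ang z a) / pi.
  by rewrite mulr_suml -sumrB; apply: eq_bigr => a _; ring.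
have E' : \sum_a g (phi a) * (w a + 3^-1) = \sum_a g (phi a) * w a + \sum_a g (phi a) * 3^-1.
  by rewrite -big_split; apply: eq_bigr => a _; rewrite mulrDr.
rewrite !E wsum; move: key; rewrite E' => key.
have pi0 : pi != 0 :> R by rewrite gt_eqF ?pi_gt0.
rewrite [(_ + g e0 * (2 * pi)) / pi]mulrDl mulrA mulfK //.
by lra.
Qed.

Lemma ang_gauge_central (t : R) k A : k \in K ->
  ang (gauge_dir (fun e => if e == e0 then t else 0)) (tau k, A) =
    pi * t * facet_bracket R s k (label k A) (~: K).
Proof.
move=> kK; rewrite ang_gauge_dir -mulrA; congr (_ * _).
transitivity (t * \sum_(c | phi c == e0) bracket R (tau k, A) c).
  rewrite mulr_sumr [RHS]big_mkcond /=; apply: eq_bigr => c _.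
  by case: ifP => _; rewrite ?mulr0 // mulrC.
congr (_ * _); rewrite sum_central (bigD1 k) //= [X in _ + X]big1 ?addr0 => [|j /andP[jK jk]].
  rewrite /facet_bracket (big_pred1 A) => [|A']; last by rewrite /= (inj_eq (@label_inj k)).
  by apply: eq_bigr => B _; rewrite /bracket /= eqxx mul1r pos_tau.
by apply: big1 => B _; rewrite /bracket /= (tau_eq H) // eq_sym (negPf jk) mul0r.
Qed.

End MoveGauge.

(** * The fibres of the map of a move *)

Section FacetCases.
Variable R : realType.

Lemma facet_label_cases (j a b c d : 'I_5) (A : edge4) : uniq [:: j; a; b; c; d] ->
  label j A \in [:: [set a; b]; [set a; c]; [set a; d]; [set c; d]; [set b; d]; [set b; c]].
Proof.
move=> u; have := u; rewrite /= !inE !negb_or !andbT ![j == _]eq_sym.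
move=> /andP[/and4P[ja jb jc jd] /andP[/and3P[ab ac ad] /andP[/andP[bc bd] cd]]].
have := map_f (label j) (mkedgeP A (uniq_vpos u)).
by rewrite [map _ _]/= !label_mkedge // !inE.
Qed.

Lemma facet_bracket_vertex s (k a b c d : 'I_5) (Q : {set 'I_5}) : uniq [:: k; a; b; c; d] ->
  facet_bracket R s k [set a; b] Q + (facet_bracket R s k [set a; c] Q +
    facet_bracket R s k [set a; d] Q) = 0.
Proof.
move=> u; have := u; rewrite /= !inE !negb_or !andbT ![k == _]eq_sym.
move=> /andP[/and4P[ka kb kc kd] /andP[/and3P[ab ac ad] _]].
rewrite -(@label_mkedge k a b) // -(@label_mkedge k a c) // -(@label_mkedge k a d) //.
have [Bs|no] := pickP (fun B : edge4 => label k B == Q); last first.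
  have z P : facet_bracket R s k P Q = 0 by apply: big1 => A _; rewrite big_pred0.
  by rewrite !z !addr0.
move=> /eqP <-; rewrite !facet_bracket_label.
by rewrite -(sum_edge4_at (fun A => eps4 R _ A Bs) (uniq_vpos u)) eps4_vertex.
Qed.

Lemma facet_bracket_sqr s (k a b c d : 'I_5) : uniq [:: k; a; b; c; d] ->
  facet_bracket R s k [set a; b] [set a; c] ^+ 2 = 1.
Proof.
move=> u; have := uniq_vpos u; have := u; rewrite /= !inE !negb_or !andbT ![k == _]eq_sym.
move=> /andP[/and4P[ka kb kc kd] /andP[/and3P[ab ac ad] _]].
move=> /andP[/and3P[vab vac vad] /andP[/andP[vbc _] _]].
rewrite -(@label_mkedge k a b) // -(@label_mkedge k a c) // facet_bracket_label.
by apply: (eps4_sqr R _ vab vac vbc); rewrite val_mkedge.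
Qed.

Lemma facet_bracket_opposite s (k a b c d : 'I_5) (Q : {set 'I_5}) : uniq [:: k; a; b; c; d] ->
  facet_bracket R s k [set c; d] Q = facet_bracket R s k [set a; b] Q.
Proof.
move=> u; have := u; rewrite /= !inE !negb_or !andbT ![k == _]eq_sym.
move=> /andP[/and4P[ka kb kc kd] /andP[/and3P[ab ac ad] _]].
rewrite -(@label_mkedge k a b) // -facet_bracketC label_mkedge //; congr facet_bracket.
rewrite setUA; apply/esym/setC3.
by reorder u.
Qed.

Lemma facet_bracket_irr s k (P : {set 'I_5}) : facet_bracket R s k P P = 0.
Proof.
have [//|[A [B [-> e]]]] := facet_bracketP R s k P P.
by rewrite facet_bracket_label eps4_irr.
Qed.

End FacetCases.

Section BipyramidBracket.
Variables (R : realType) (K : {set 'I_5}) (s : bool).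
Local Notation F k P Q := (facet_bracket R s k P Q).

Lemma bipyramid_bracket p q k m n : bipyramid K p q k m n ->
  [/\ F k [set q; m] [set p; q] + F k [set q; n] [set p; q] = 0,
      F m [set q; k] [set p; q] + F n [set q; k] [set p; q] = 0,
      F k [set p; n] [set p; q] = F k [set q; m] [set p; q],
      F k [set p; m] [set p; q] = F k [set q; n] [set p; q] &
      F k [set m; n] [set p; q] = 0].
Proof.
move=> b; have [u eK eCK] := b.
split.
- have /(facet_bracket_vertex R s [set p; q]) : uniq [:: k; q; m; n; p].
    by reorder u.
  by rewrite (setUC [set q] [set p]) facet_bracket_irr addr0.
- have := sum_facet_bracket R s [set q; k] [set p; q]; rewrite (bigID [in K]) /=.
  have [-> _] := sum_bipyramid (fun j => F j [set q; k] [set p; q]) b.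
  rewrite [X in _ + X]big1 ?addr0 => [|j jK].
    by rewrite facet_bracket_inl ?add0r // !inE eqxx orbT.
  by apply: facet_bracket_inr; rewrite -eCK inE.
- by apply: facet_bracket_opposite; reorder u.
- by apply: facet_bracket_opposite; reorder u.
- rewrite (@facet_bracket_opposite R s k p q) ?facet_bracket_irr //.
  by reorder u.
Qed.

End BipyramidBracket.

Section MoveKernel.
Variables (R : realType) (X Y : pseudo3) (K : {set 'I_5}).
Variables (tau : 'I_5 -> tet X) (tau' : 'I_5 -> tet Y) (rho : tet X -> tet Y).
Hypothesis H : move3 K tau tau' rho.
Variable s : bool.
Hypothesis pos_tau : forall k, k \in K -> positive (tau k) = s (+) odd k.
Hypothesis K3 : #|K| = 3%N.
Variable e0 : edge X.
Hypothesis e0E : central_edge K tau e0.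
Hypothesis e0int : ~~ bd_edge e0.
Local Notation M := (rel_mx R (move_rel K tau tau' rho)).
Local Notation F k P Q := (facet_bracket R s k P Q).

(** The differences of angles vanish at the central edge. At the edges [qm] of the facets [k] they
    form a 3 by 3 array without diagonal, with zero row and column sums, hence with one free
    parameter. The brackets with the central edge satisfy the same relations ([bipyramid_bracket]),
    so the difference is a multiple of the gauge direction of [e0]. *)
Lemma move_kernel x x' : wset [set e0] x -> wset [set e0] x' -> x *m M = x' *m M ->
  exists g, [/\ gauge_param g, forall e, e \notin [set e0] -> g e = 0 & x' = x + gauge_dir g].
Proof.
move=> /(wset_central H e0E)[xg xe] /(wset_central H e0E)[x'g x'e] e.
have [p [q [k0 [k1 [k2 b]]]]] : exists p q k m n, bipyramid K p q k m n.
  have /card_gt0P[p] : (0 < #|~: K|)%N by rewrite (cardCK K3).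
  have /card_gt0P[k kK] : (0 < #|K|)%N by rewrite K3.
  rewrite inE => pK; have [q [m [n b]]] := bipyramid_ex K3 pK kK.
  by exists p, q, k, m, n.
pose V j P := facet_val (ang x) (tau j) j P.
pose V' j P := facet_val (ang x') (tau j) j P.
have sumV (P : {set 'I_5}) : #|P| = 2%N -> P != ~: K -> \sum_(j in K) V j P = \sum_(j in K) V' j P.
  move=> P2 PK; rewrite -(move_bipyramid_weight H K3 xg xe P2 PK).
  by rewrite -(move_bipyramid_weight H K3 x'g x'e P2 PK) e.
(* The angle at the central edge equals the one at the opposite edge [mn], which is the whole weight
   of [mn] and is determined by the image under [M]. *)
have same k m n : bipyramid K p q k m n -> V k [set p; q] = V' k [set p; q].
  move=> b'; have [u _ eCK] := b'; have [_ _ _ mK _] := bipyramid_sub b'.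
  have [_ r2 _ _] := bipyramid_relations tau xg b'.
  have [_ r2' _ _] := bipyramid_relations tau x'g b'.
  rewrite /V /V' r2 r2' -/(V k _) -/(V' k _).
  have := sumV [set m; n]; have [-> _] := sum_bipyramid (fun j => V j [set m; n]) b'.
  have [-> _] := sum_bipyramid (fun j => V' j [set m; n]) b'.
  rewrite /V /V' !(proj1 (facet_val_selfs _ _ _ _)) !(proj2 (facet_val_selfs _ _ _ _)) !addr0.
  apply; last by apply/eqP => /setP/(_ m); rewrite !inE eqxx mK.
  by move: u; rewrite cards2 /= !inE !negb_or !andbT => /and4P[_ _ _ /= ->].
have col k m n : bipyramid K p q k m n ->
    V m [set q; k] + V n [set q; k] = V' m [set q; k] + V' n [set q; k].
  move=> b'; have [u _ eCK] := b'; have [_ _ kK _ _] := bipyramid_sub b'.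
  have := sumV [set q; k]; have [-> _] := sum_bipyramid (fun j => V j [set q; k]) b'.
  have [-> _] := sum_bipyramid (fun j => V' j [set q; k]) b'.
  rewrite /V /V' !(proj2 (facet_val_selfs _ _ _ _)) !add0r.
  apply; last by apply/eqP => /setP/(_ k); rewrite !inE eqxx orbT kK.
  by move: u; rewrite cards2 /= !inE !negb_or !andbT => /and4P[_ /and3P[-> _ _] _ _].
have row k m n : bipyramid K p q k m n ->
    V k [set q; m] + V k [set q; n] = V' k [set q; m] + V' k [set q; n].
  move=> b'; have [r1 _ _ _] := bipyramid_relations tau xg b'.
  have [r1' _ _ _] := bipyramid_relations tau x'g b'; have := same _ _ _ b'.
  by move: r1 r1'; rewrite -/(V k _) -/(V k _) /V /V'; lra.
have [b1 b2] := (bipyramid_rot b, bipyramid_rot (bipyramid_rot b)).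
pose sg := F k0 [set q; k1] [set p; q].
have sg2 : sg * sg = 1.
  have [u _ _] := b; rewrite -expr2 /sg (setUC [set p]) (@facet_bracket_sqr R s k0 q k1 p k2) //.
  by reorder u.
(* The parameter, read off at one edge: [sg] is 1 or -1, so multiplying by it is dividing by it. The
   witness [c / pi] compensates the factor [pi] of gauge directions. *)
pose c := (V' k0 [set q; k1] - V k0 [set q; k1]) * sg.
exists (fun f => if f == e0 then c / pi else 0); split.
- by move=> f bf; case: eqP => // fe; rewrite fe (negPf e0int) in bf.
- by move=> f; rewrite inE => /negPf ->.
have facet k m n : bipyramid K p q k m n ->
    V' k [set q; m] = V k [set q; m] + c * F k [set q; m] [set p; q] ->
    V' k [set q; n] = V k [set q; n] + c * F k [set q; n] [set p; q] ->
    forall A, ang x' (tau k, A) = ang x (tau k, A) + c * F k (label k A) (~: K).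
  move=> b' E1 E2 A; have [u _ eCK] := b'; rewrite eCK.
  have [_ r2 r3 r4] := bipyramid_relations tau xg b'.
  have [_ r2' r3' r4'] := bipyramid_relations tau x'g b'.
  have [_ _ f3 f4 f5] := bipyramid_bracket R s b'.
  have E0 := same _ _ _ b'.
  have : uniq [:: k; p; q; m; n].
    by reorder u.
  move/(@facet_label_cases k p q m n A); rewrite !inE => cases.
  rewrite -(sum_facet_label (ang x) (tau k) k A) -(sum_facet_label (ang x') (tau k) k A).
  by move: r2 r3 r4 r2' r3' r4' E1 E2 E0; rewrite /V /V'; move: cases;
    do 5?[case/orP=> [/eqP ->|]]; last move/eqP => ->;
    rewrite ?f3 ?f4 ?f5 ?facet_bracket_irr; lra.
have [g1 g2 _ _ _] := bipyramid_bracket R s b.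
have [g3 g4 _ _ _] := bipyramid_bracket R s b1.
have [g5 g6 _ _ _] := bipyramid_bracket R s b2.
have := (col _ _ _ b, col _ _ _ b1, col _ _ _ b2, row _ _ _ b, row _ _ _ b1, row _ _ _ b2).
move=> [[[[[h1 h2] h3] h4] h5] h6].
have cs : c * sg = V' k0 [set q; k1] - V k0 [set q; k1] by rewrite /c -mulrA sg2 mulr1.
apply: angP => -[t A]; rewrite angD.
have [/imsetP[k kK ->]|tS] := boolP (t \in tau @: K); last first.
  rewrite -(move_ang_outer H x' A tS) -(move_ang_outer H x A tS) e [X in _ + X](_ : _ = 0) ?addr0 //.
  rewrite ang_gauge_dir big1 ?mulr0 // => d _; case: eqP => [/(phi_central e0E)[k [kK dk _]]|_].
    by rewrite /bracket /=; case: eqP => [tk|_]; [rewrite tk dk imset_f in tS | rewrite !mul0r].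
  by rewrite mulr0.
rewrite (ang_gauge_central H pos_tau) // [pi * _]mulrCA mulfV ?mulr1 ?gt_eqF ?pi_gt0 //.
have F01 : F k0 [set q; k1] [set p; q] = sg by [].
have F02 : F k0 [set q; k2] [set p; q] = - sg by lra.
have F21 : F k2 [set q; k1] [set p; q] = - sg by lra.
have F20 : F k2 [set q; k0] [set p; q] = sg by lra.
have F10 : F k1 [set q; k0] [set p; q] = - sg by lra.
have F12 : F k1 [set q; k2] [set p; q] = sg by lra.
have [_ eK _] := b; have := kK; rewrite {1}eK !inE -orbA => /or3P[] /eqP ->.
- apply: (facet _ _ _ b); rewrite ?F01 ?F02 ?mulrN cs; lra.
- by apply: (facet _ _ _ b1); rewrite ?F12 ?F10 ?mulrN cs; lra.
- by apply: (facet _ _ _ b2); rewrite ?F20 ?F21 ?mulrN cs; lra.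
Qed.

End MoveKernel.

Lemma linear_rV_mx (R : realType) m n (f : 'rV[R]_m -> 'rV[R]_n) :
  linear f -> exists N, forall y, f y = y *m N.
Proof.
move=> fl; exists (\matrix_i f (delta_mx ord0 i)) => y.
have fs (I : Type) (r : seq I) (c : I -> R) (z : I -> 'rV_m) :
    f (\sum_(i <- r) c i *: z i) = \sum_(i <- r) c i *: f (z i).
  elim: r => [|j r IHr]; last by rewrite !big_cons fl IHr.
  rewrite !big_nil; apply: (addIr (f 0)); rewrite add0r -{1}[f 0]scale1r -fl.
  by rewrite scaler0 addr0.
rewrite {1}(row_sum_delta y) fs mulmx_sum_row.
by apply: eq_bigr => j _; rewrite rowK.
Qed.

(** * A linear section of the map of a move *)

Section MoveSection.
Variables (R : realType) (X Y : pseudo3) (K : {set 'I_5}).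
Variables (tau : 'I_5 -> tet X) (tau' : 'I_5 -> tet Y) (rho : tet X -> tet Y).
Hypothesis H : move3 K tau tau' rho.
Hypothesis K3 : #|K| = 3%N.
Variable e0 : edge X.
Hypothesis e0E : central_edge K tau e0.
Local Notation M := (rel_mx R (move_rel K tau tau' rho)).
(** Both sides take equal values on opposite edges, so the three edges at the apex [r] suffice. *)
Lemma move_inner_eq x y l r k0 k1 k2 : gshapes R Y y -> bipyramid K l r k0 k1 k2 ->
  (forall k, k \in [:: k0; k1; k2] -> \sum_(j in K) facet_val (ang x) (tau j) j [set r; k] =
     facet_val (ang y) (tau' l) l [set r; k]) ->
  forall A, ang (x *m M) (tau' l, A) = ang y (tau' l, A).
Proof.
move=> yg b hs A; have [u _ _] := b.
have b1 := bipyramid_rot b; have b2 := bipyramid_rot b1.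
have [E0 E0'] := move_ang_inner H x b; have [E1 E1'] := move_ang_inner H x b1.
have [E2 E2'] := move_ang_inner H x b2.
rewrite hs ?inE ?eqxx // in E0 E0'; rewrite hs ?inE ?eqxx ?orbT // in E1 E1'.
rewrite hs ?inE ?eqxx ?orbT // in E2 E2'.
have opp k m n : bipyramid K l r k m n ->
    facet_val (ang y) (tau' l) l [set m; n] = facet_val (ang y) (tau' l) l [set r; k].
  by move=> [v _ _]; apply/esym; exact: (facet_opposite (tau' l) yg v).
have := facet_label_cases A u; rewrite !inE => cases.
rewrite -(sum_facet_label (ang (x *m M)) (tau' l) l A) -(sum_facet_label (ang y) (tau' l) l A).
move: cases; do 5?[case/orP=> [/eqP ->|]]; last move/eqP => ->.
- exact: E0.
- exact: E1.
- exact: E2.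
- by rewrite E0' (opp _ _ _ b).
- by rewrite (setUC [set k0]) E1' (opp _ _ _ b1).
- by rewrite E2' (opp _ _ _ b2).
Qed.

Variables p q k0 k1 k2 : 'I_5.
Hypothesis b : bipyramid K p q k0 k1 k2.

(* The angles c, u, u' at the three pairs of opposite edges of the facet opposite to the
   third element of K, in this order: pq and kk', qk and pk', qk' and pk. *)
Definition three_angles (k : 'I_5) (c u u' : R) (B : {set 'I_5}) : R :=
  if (p \in B) == (q \in B) then c else if (q \in B) == (k \in B) then u else u'.

Section Formula.
Variable y : angles R Y.
Local Notation yp k := (facet_val (ang y) (tau' p) p [set q; k]).
Local Notation yq k := (facet_val (ang y) (tau' q) q [set p; k]).
Local Notation total := (yp k0 + yp k1 + yp k2).

(* The angle of qk1 in the facet opposite to k0 is the free parameter of the fibre; it is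
   set to 0, and the other angles are forced. *)
Definition split_angle (a : corner X) : R :=
  let c k := yp k + yq k in
  let u20 := total - c k2 - yp k1 in
  let u10 := yp k0 - u20 in
  if a.1 == tau k0 then three_angles k1 (c k0) 0 (total - c k0) (label k0 a.2)
  else if a.1 == tau k1 then three_angles k2 (c k1) (total - c k1 - u10) u10 (label k1 a.2)
  else if a.1 == tau k2 then three_angles k0 (c k2) u20 (yp k1) (label k2 a.2)
  else ang y (rho a.1, a.2).

End Formula.

(** Linear and not merely affine because [total] is written where [pi] is meant; the two agree on
    generalized shapes. The section is thus given by a matrix. *)
Lemma split_angle_linear : linear (fun y => ang_row (split_angle y)).
Proof.
move=> s y z; apply: angP => a; rewrite angD angZ !ang_rowE /split_angle.
have fl t k P : facet_val (ang (s *: y + z)) t k P =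
    s * facet_val (ang y) t k P + facet_val (ang z) t k P.
  by rewrite /facet_val mulr_sumr -big_split; apply: eq_bigr => A _; rewrite angD angZ.
rewrite !fl angD angZ /three_angles.
by do 3?[case: ifP => _; first by do 2?[case: ifP => _]; ring].
Qed.

Variable y : angles R Y.
Hypothesis yg : gshapes R Y y.
Local Notation yp k := (facet_val (ang y) (tau' p) p [set q; k]).
Local Notation yq k := (facet_val (ang y) (tau' q) q [set p; k]).
Local Notation x := (ang_row (split_angle y)).
Local Notation V j P := (facet_val (ang x) (tau j) j P).

Lemma split_angle_outer t A : t \notin tau @: K -> ang x (t, A) = ang y (rho t, A).
Proof.
move=> tS; rewrite ang_rowE /split_angle /=.
have [_ _ kK mK nK] := bipyramid_sub b.
have ne j : j \in K -> (t == tau j) = false.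
  by move=> jK; apply: contraNF tS => /eqP ->; rewrite imset_f.
by rewrite !ne.
Qed.

Lemma three_angles_facet k m n (c u u' : R) : bipyramid K p q k m n ->
  (forall A, ang x (tau k, A) = three_angles m c u u' (label k A)) ->
  [/\ V k [set p; q] = c /\ V k [set m; n] = c,
      V k [set q; m] = u /\ V k [set p; n] = u &
      V k [set q; n] = u' /\ V k [set p; m] = u'].
Proof.
move=> b' hx; have [u5 _ _] := b'; move: u5; rewrite /= !inE !negb_or !andbT.
rewrite ![_ == k]eq_sym.
move=> /andP[/and4P[pq kp pm pn] /andP[/and3P[kq qm qn] /andP[/andP[km kn] mn]]].
have E a' c' : k != a' -> k != c' -> a' != c' -> V k [set a'; c'] = three_angles m c u u' [set a'; c'].
  move=> h1 h2 h3; have [A hA] : exists A, label k A = [set a'; c'].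
    by apply: label_ex; rewrite ?cards2 ?h3 // !inE negb_or h1.
  by rewrite -hA sum_facet_label hx.
by split; split; rewrite E // /three_angles !inE ?eqxx ?(eq_sym q p) ?(eq_sym m p) ?(eq_sym m q)
  ?(eq_sym n p) ?(eq_sym n q) ?(eq_sym n m)
  ?(negPf pq) ?(negPf pm) ?(negPf pn) ?(negPf qm) ?(negPf qn) ?(negPf mn) ?orbT.
Qed.

Lemma sum_yp l r k m n : bipyramid K l r k m n ->
  facet_val (ang y) (tau' l) l [set r; k] + (facet_val (ang y) (tau' l) l [set r; m] +
    facet_val (ang y) (tau' l) l [set r; n]) = pi.
Proof. by move=> b'; have [u _ _] := b'; exact: (facet_vertex (tau' l) yg u). Qed.

Let bp := sum_yp b.
Let bq := sum_yp (bipyramid_swap b).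

(** The value [c k] is forced: the angle of [tau k] at [pq] is its angle at [mn], the whole weight
    of [mn], and the angles of [y] at [mn] are those at the opposite edges [qk] and [pk]. *)
Lemma split_angle_facets :
  let c k := yp k + yq k in
  let u20 := pi - c k2 - yp k1 in
  let u10 := yp k0 - u20 in
  [/\ [/\ V k0 [set p; q] = c k0 /\ V k0 [set k1; k2] = c k0,
      V k0 [set q; k1] = 0 /\ V k0 [set p; k2] = 0 &
      V k0 [set q; k2] = pi - c k0 /\ V k0 [set p; k1] = pi - c k0],
   [/\ V k1 [set p; q] = c k1 /\ V k1 [set k2; k0] = c k1,
      V k1 [set q; k2] = pi - c k1 - u10 /\ V k1 [set p; k0] = pi - c k1 - u10 &
      V k1 [set q; k0] = u10 /\ V k1 [set p; k2] = u10] &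
   [/\ V k2 [set p; q] = c k2 /\ V k2 [set k0; k1] = c k2,
      V k2 [set q; k0] = u20 /\ V k2 [set p; k1] = u20 &
      V k2 [set q; k1] = yp k1 /\ V k2 [set p; k0] = yp k1]].
Proof.
move=> c u20 u10; have T : yp k0 + yp k1 + yp k2 = pi by rewrite -addrA; exact: bp.
have [_ _ kK mK nK] := bipyramid_sub b.
have [u5 _ _] := b; move: u5; rewrite /= !inE !negb_or !andbT.
move=> /andP[_ /andP[_ /andP[/andP[km kn] mn]]].
have ne j l : j \in K -> l \in K -> (tau j == tau l) = (j == l) by move=> jK lK; exact: (tau_eq H).
split.
- apply: (three_angles_facet b) => A; rewrite ang_rowE /split_angle /= eqxx.
  by rewrite -T.
- apply: (three_angles_facet (bipyramid_rot b)) => A; rewrite ang_rowE /split_angle /=.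
  by rewrite ne // (eq_sym k1) (negPf km) eqxx /u10 /u20 -T.
- apply: (three_angles_facet (bipyramid_rot (bipyramid_rot b))) => A.
  rewrite ang_rowE /split_angle /= !ne // (eq_sym k2 k0) (negPf kn) (eq_sym k2) (negPf mn) eqxx.
  by rewrite /u20 -T.
Qed.

Lemma split_angle_gshapes : gshapes R X x.
Proof.
move=> t v; rewrite -/(vertex_sum t v x).
have [/imsetP[k kK ->]|tS] := boolP (t \in tau @: K); last first.
  by rewrite -(yg (rho t) v); apply: eq_bigr => A _; rewrite split_angle_outer.
have [a ak ->] : exists2 a, a != k & v = vpos k a.
  by exists (lift k v); rewrite ?lift_vpos // eq_sym neq_lift.
have facet k' m n : bipyramid K p q k' m n ->
    V k' [set p; q] = V k' [set m; n] -> V k' [set q; m] = V k' [set p; n] ->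
    V k' [set q; n] = V k' [set p; m] ->
    V k' [set p; q] + V k' [set q; m] + V k' [set q; n] = pi ->
    a != k' -> vertex_sum (tau k') (vpos k' a) x = pi.
  move=> b' e1 e2 e3 e4 ak'; have [u eK eCK] := b'.
  have : a \in [:: p; q; m; n].
    have : a \in K :|: ~: K by rewrite setUCr inE.
    by rewrite eCK eK !inE (negPf ak') /=; case: (a == p); case: (a == q);
      case: (a == m); case: (a == n).
  rewrite !inE => /or4P[] /eqP ->.
  - have w : uniq [:: k'; p; q; m; n] by reorder u.
    by rewrite (vertex_sum_facet _ _ w) -e2 -e3; lra.
  - have w : uniq [:: k'; q; p; m; n] by reorder u.
    by rewrite (vertex_sum_facet _ _ w) (setUC [set q] [set p]); lra.
  - have w : uniq [:: k'; m; p; q; n] by reorder u.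
    rewrite (vertex_sum_facet _ _ w) (setUC [set m] [set p]) (setUC [set m] [set q]) -e3 -e1.
    by lra.
  - have w : uniq [:: k'; n; p; q; m] by reorder u.
    rewrite (vertex_sum_facet _ _ w) (setUC [set n] [set p]) (setUC [set n] [set q]).
    by rewrite (setUC [set n] [set m]) -e2 -e1; lra.
have [] := split_angle_facets.
move=> [[f1 f2] [f3 f4] [f5 f6]] [[g1 g2] [g3 g4] [g5 g6]] [[h1 h2] [h3 h4] [h5 h6]].
have [_ eK _] := b; move: kK ak; rewrite eK !inE -orbA => /or3P[] /eqP -> ak.
- by apply: (facet _ _ _ b) => //; rewrite ?f1 ?f2 ?f3 ?f4 ?f5 ?f6 //; lra.
- by apply: (facet _ _ _ (bipyramid_rot b)) => //; rewrite ?g1 ?g2 ?g3 ?g4 ?g5 ?g6 //; lra.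
- by apply: (facet _ _ _ (bipyramid_rot (bipyramid_rot b))) => //;
    rewrite ?h1 ?h2 ?h3 ?h4 ?h5 ?h6 //; lra.
Qed.

(** The angles at the central edge collect the vertex sums of [y] at [q] in [tau' p] and at [p] in
    [tau' q], each equal to [pi]. *)
Lemma split_angle_wset : wset [set e0] x.
Proof.
apply: (central_wset H e0E); first exact: split_angle_gshapes.
have [_ _ eCK] := b; have [-> _] := sum_bipyramid (fun j => V j (~: K)) b; rewrite eCK.
have [[[-> _] _ _] [[-> _] _ _] [[-> _] _ _]] := split_angle_facets.
by move: bp bq; lra.
Qed.

Lemma split_angleK : x *m M = y.
Proof.
apply: angP => -[t' A].
have [/imsetP[l + ->]|tS] := boolP (t' \in tau' @: (~: K)); last first.
  have : t' \in rho @: ~: (tau @: K) by rewrite (move_outer_im H) inE.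
  case/imsetP => t; rewrite inE => tS' ->.
  by rewrite (move_ang_outer H) // split_angle_outer.
rewrite inE => lK.
have [] := split_angle_facets.
move=> [[f1 f2] [f3 f4] [f5 f6]] [[g1 g2] [g3 g4] [g5 g6]] [[h1 h2] [h3 h4] [h5 h6]].
have sb P : \sum_(j in K) V j P = V k0 P + (V k1 P + V k2 P).
  by have [-> _] := sum_bipyramid (fun j => V j P) b.
have self j a : V j [set a; j] = 0 by exact: (proj2 (facet_val_selfs _ _ _ _)).
have [_ _ eCK] := b; have : l \in ~: K by rewrite inE.
rewrite eCK !inE => /orP[] /eqP el; subst l.
  apply: (move_inner_eq yg b) => k; rewrite !inE => /or3P[] /eqP ->; rewrite sb self.
  - by rewrite g5 h3; lra.
  - by rewrite f3 h5; lra.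
  - by rewrite f5 g3; move: bp bq; lra.
apply: (move_inner_eq yg (bipyramid_swap b)) => k; rewrite !inE => /or3P[] /eqP ->; rewrite sb self.
- by rewrite g4 h6; move: bp bq; lra.
- by rewrite f6 h4; move: bp bq; lra.
- by rewrite f4 g6; move: bp bq; lra.
Qed.

End MoveSection.

(** * Moves, refinements and equivalences as reduced isomorphisms *)

Section PachnerReduced.
Variable R : realType.

Lemma replaces_move3 (X Y : pseudo3) (K : {set 'I_5}) (tau : 'I_5 -> tet X)
    (tau' : 'I_5 -> tet Y) (rho : tet X -> tet Y) :
  replaces K tau tau' rho -> move3 K tau tau' rho.
Proof. by move=> [_ [h1 h2] [h3 h4] _ [h5 h6 h7]]. Qed.

Lemma pachner_reduced (X Y : shaped R) : pachner X Y ->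
  exists e0 i i' M M' q q',
    reduced_iso [set e0] (set0 : {set edge Y}) i i' M M' q q' (shape X) (shape Y).
Proof.
move=> [e0 [[e0int e0w] [K [tau [tau' [rho [rep e0E [outer inner]]]]]]]].
have H := replaces_move3 rep.
have [K3 _ _ [s [pos_tau pos_tau' pos_rho]] _] := rep.
have [i [i' ii]] := move_edges H K3 e0E.
have [xg yg] := ((shapeP X).1, (shapeP Y).1).
have [p [q [k0 [k1 [k2 b]]]]] : exists p q k m n, bipyramid K p q k m n.
  have /card_gt0P[p] : (0 < #|~: K|)%N by rewrite (cardCK K3).
  have /card_gt0P[k kK] : (0 < #|K|)%N by rewrite K3.
  rewrite inE => pK; have [q [m [n b]]] := bipyramid_ex K3 pK kK.
  by exists p, q, k, m, n.
pose M := rel_mx R (move_rel K tau tau' rho).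
have [M' hM'] := linear_rV_mx (split_angle_linear (R := R) tau tau' rho p q k0 k1 k2).
exists e0, i, i', M, M', (move_level R e0), (- (M' *m move_level R e0)).
apply: reduced_iso_section.
- by move=> e; rewrite inE => /eqP ->.
- move=> e; rewrite inE => /eqP ee0; split; first exact: (move_edgeK K3 e0E ii).
  exact: (move_bd H K3 e0E ii).
- move=> e; have [h1 h2] := move_edgeK' H K3 e0E ii e.
  by rewrite inE; split=> //; apply/eqP.
- by move=> x /(wset_central H e0E)[h1 h2]; exact: (move_gshapes H K3 h1 h2).
- move=> y hy; rewrite -hM'; split; first exact: (split_angle_wset H e0E b hy).
  exact: (split_angleK H b hy).
- by move=> x e xD; rewrite inE => /eqP ee0; exact: (move_weight H K3 e0E ii xD).
- move=> g g' gg'.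
  have gg0 e : e <> e0 -> g' (i e) = g e by move=> /eqP ee0; apply: gg'; rewrite inE.
  split; first exact: (move_gauge_dir H pos_tau pos_tau' pos_rho K3 e0E ii gg0).
  by move=> x xD; exact: (move_level_shift H K3 e0E ii gg0 xD).
- exact: (move_kernel H pos_tau K3 e0E e0int).
- exact: (move_pform H pos_tau pos_tau' pos_rho K3).
- by split=> // e; rewrite inE => /eqP ->.
apply: angP => -[t' A].
have [/imsetP[l + ->]|tS] := boolP (t' \in tau' @: (~: K)); last first.
  have : t' \in rho @: ~: (tau @: K) by rewrite (move_outer_im H) inE.
  case/imsetP => t; rewrite inE => tS' ->.
  by rewrite (move_ang_outer H) // outer.
rewrite inE => lK; have [k kK] : exists k, k \in K by apply/card_gt0P; rewrite K3.
have [r [m [n b']]] := bipyramid_ex K3 lK kK.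
(* An edge from the other apex [r] lies in the single new tetrahedron [tau' l], so the prescribed
   weight is its angle; this is the uniqueness of the shape on [S_e]. *)
apply: (move_inner_eq H yg b') => j jin.
have [_ eK eCK] := b'.
have jK : j \in K by rewrite eK; move: jin; rewrite !inE -orbA.
have rK : r \notin K by have [] := bipyramid_sub b'.
have rj : r != j by apply: contraNneq rK => ->.
have rjK : [set r; j] != ~: K by apply/eqP => /setP/(_ j); rewrite !inE eqxx orbT jK.
have rj2 : #|[set r; j]| = 2%N by rewrite cards2 rj.
apply: etrans (esym (inner _ rj2 rjK)) _.
have [_ E] := sum_bipyramid (fun l' => facet_val (ang (shape Y)) (tau' l') l' [set r; j]) b'.
by apply: etrans E _; rewrite (proj1 (facet_val_selfs _ _ _ _)) addr0.
Qed.

Lemma gauge_equivalent_refl (X : shaped R) : gauge_equivalent X X.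
Proof.
unshelve eexists (@Iso3 X X id (fun=> 1%g) _ _ _ _); try by move=> *.
- by exists id.
- by move=> t; rewrite odd_perm1 addbF.
- by move=> t i; rewrite perm1; case: glue => // -[t' j] /=; rewrite perm1.
- by move=> t i t' j _; rewrite mulg1 mul1g !perm1.
exists (fun=> 0); split=> // a; rewrite angle_shiftE big1 => [|c _]; last by rewrite mulr0.
by rewrite mulr0 addr0; case: a => t A; rewrite /iso_corner /= edge4_img1.
Qed.

Lemma refines_reduced (X Y : shaped R) : refines X Y ->
  exists (D : {set edge X}) i i' M M' q q',
    reduced_iso D (set0 : {set edge Y}) i i' M M' q q' (shape X) (shape Y).
Proof.
elim=> {X Y} [X|X Y Z XY _ [D [i [i' [M [M' [q [q' h]]]]]]]].
  by exists set0; exact: gauge_equivalent_reduced (gauge_equivalent_refl X).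
have [e0 [j [j' [N [N' [r [r' h1]]]]]]] := pachner_reduced XY.
(* The edges constrained by the later moves have weight [2 pi] in the shape of [Y], so the first
   move can be restricted to their level set. *)
have hD e : e \in D -> [/\ e \notin (set0 : {set edge Y}), ~~ bd_edge e & weight (shape Y) e = 2 * pi].
  move=> eD; rewrite inE; split=> //; first exact: (half_internal h.1).
  by have [_] := half_base h.1; apply.
have := reduced_iso_sym (reduced_iso_restrict (reduced_iso_sym h1) hD).
rewrite set0U => h2.
exists ([set e0] :|: j' @: D); do 6!eexists; exact: reduced_iso_trans h2 h.
Qed.

End PachnerReduced.

Lemma leveled_equivalent_equivalent (R : realType) (X Y : leveled R) :
  leveled_equivalent X Y -> equivalent X.1 Y.1.
Proof.
have ref (Z W : leveled R) : leveled_refines Z W -> refines Z.1 W.1.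
  elim=> {Z W} [Z|Z W V [e he _] _ IH]; first exact: Relation_Operators.rt1n_refl.
  by apply: Relation_Operators.rt1n_trans IH; exists e.
move=> [X' [Y' [/ref h1 /ref h2 [h [g [h3 h4 _]]]]]].
by exists X'.1, Y'.1; split=> //; exists h, g.
Qed.

(** Inside the refinement [X'], the reduced space of [X] is the level set of [D1] and that of [Y]
    the level set of [D3], the preimage of [D2]. Both are restricted to [D1 :|: D3]; so [D] comes
    from edges destroyed only on the side of [Y], and [D'] from those destroyed only on the side of
    [X]. *)
Lemma equivalent_reduced (R : realType) (X Y : shaped R) : equivalent X Y ->
  exists (D : {set edge X}) (D' : {set edge Y}) i i' M M' q q',
    reduced_iso D D' i i' M M' q q' (shape X) (shape Y).
Proof.
move=> [X' [Y' [/refines_reduced hX /refines_reduced hY /gauge_equivalent_reduced hXY]]].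
move: hX hY hXY => [D1 [i1 [i1' [M1 [M1' [q1 [q1' h1]]]]]]].
move=> [D2 [i2 [i2' [M2 [M2' [q2 [q2' h2]]]]]]] [i3 [i3' [M3 [M3' [q3 [q3' h3]]]]]].
have hD2 e : e \in D2 -> [/\ e \notin (set0 : {set edge Y'}), ~~ bd_edge e & weight (shape Y') e = 2 * pi].
  move=> eD; rewrite inE; split=> //; first exact: (half_internal h2.1).
  by have [_] := half_base h2.1; apply.
have := reduced_iso_sym (reduced_iso_restrict (reduced_iso_sym h3) hD2).
rewrite !set0U => h4.
have {h4} h4 := reduced_iso_trans h4 h2.
set D3 := i3' @: D2 in h4.
have hE (Da Db : {set edge X'}) (Z : pseudo3) (Dz : {set edge Z}) i i' M M' q q' z0 :
    reduced_iso Db Dz i i' M M' q q' (shape X') z0 -> forall e, e \in Db :\: Da ->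
    [/\ e \notin Da, ~~ bd_edge e & weight (shape X') e = 2 * pi].
  move=> [h _] e; rewrite inE => /andP[eDa eDb]; split=> //; first exact: half_internal h _ eDb.
  by have [_] := half_base h; apply.
have h5 := reduced_iso_restrict h1 (hE D1 D3 _ _ _ _ _ _ _ _ _ h4).
have h6 := reduced_iso_restrict h4 (hE D3 D1 _ _ _ _ _ _ _ _ _ h1).
have eD : D3 :|: D1 :\: D3 = D1 :|: D3 :\: D1.
  by apply/setP => e; rewrite !inE; case: (e \in D1); case: (e \in D3).
rewrite eD in h6; have := reduced_iso_trans (reduced_iso_sym h5) h6.
by move=> h7; do 8!eexists; exact: h7.
Qed.

From mathcomp Require Import all_classical all_reals all_analysis.
Require Import Defs.
Import numFieldNormedType.Exports.
Local Open Scope classical_set_scope.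

(** * Smooth functions *)

Section Smooth.
Variables (R : realType).

Section OneSpace.
Variable V : normedModType R.
Implicit Types (f g h : V -> R^o) (v x : V).

Lemma smooth_differentiable f x : smooth f -> differentiable f x.
Proof. by move/(_ [::] x). Qed.

Lemma smooth_derivable f x v : smooth f -> derivable f x v.
Proof. by move=> /smooth_differentiable h; exact: diff_derivable. Qed.

Lemma smooth_derive f v : smooth f -> smooth ('D_v f : V -> R^o).
Proof. by move=> hf vs x; have := hf (rcons vs v) x; rewrite foldr_rcons. Qed.

(* Closed under directional derivatives, by the Leibniz rule. *)
Inductive smooth_products : (V -> R^o) -> Prop :=
| smooth_product f g : smooth f -> smooth g -> smooth_products (f * g)
| smooth_product_add f g :
    smooth_products f -> smooth_products g -> smooth_products (f + g).

Lemma smooth_products_differentiable f x : smooth_products f -> differentiable f x.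
Proof.
elim=> {f} [f g hf hg|f g _ hf _ hg]; last exact: differentiableD.
by apply: differentiableM; exact: smooth_differentiable.
Qed.

Lemma smooth_products_derive f v :
  smooth_products f -> smooth_products ('D_v f : V -> R^o).
Proof.
elim=> {f} [f g hf hg|f g hf hf' hg hg'].
  suff -> : 'D_v (f * g) = f * 'D_v g + 'D_v f * g :> (V -> R^o).
    by apply: smooth_product_add; apply: smooth_product => //; exact: smooth_derive.
  apply/funext => x; rewrite deriveM; [|exact: smooth_derivable..].
  by rewrite [in RHS]/GRing.add /= /GRing.mul /= /GRing.scale /= [g x * _]mulrC.
suff -> : 'D_v (f + g) = 'D_v f + 'D_v g :> (V -> R^o).
  exact: smooth_product_add.
apply/funext => x; rewrite deriveD //;
  by apply: diff_derivable; exact: smooth_products_differentiable.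
Qed.

Lemma smooth_products_smooth f : smooth_products f -> smooth f.
Proof.
move=> hf vs x; apply: smooth_products_differentiable.
by elim: vs => //= v vs; exact: smooth_products_derive.
Qed.

Lemma smooth_cst (k : R^o) : smooth (cst k : V -> R^o).
Proof.
move=> vs x; suff [c ->] : exists c, foldr (fun v h => 'D_v h) (cst k : V -> R^o) vs = cst c.
  exact: differentiable_cst.
elim: vs => [|v vs [c /= ->]]; first by exists k.
by exists 0; apply/funext => y; rewrite derive_cst.
Qed.

Lemma smoothM f g : smooth f -> smooth g -> smooth (f * g).
Proof. by move=> hf hg; exact/smooth_products_smooth/smooth_product. Qed.

Lemma smoothD f g : smooth f -> smooth g -> smooth (f + g).
Proof.
move=> hf hg; apply: smooth_products_smooth.
have -> : f + g = (cst 1 : V -> R^o) * f + (cst 1 : V -> R^o) * g.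
  by rewrite !mul1r.
by apply: smooth_product_add; apply: smooth_product => //; exact: smooth_cst.
Qed.

Lemma smooth_sum (I : finType) (F : I -> V -> R^o) :
  (forall i, smooth (F i)) -> smooth (fun x => \sum_i F i x : R^o).
Proof.
move=> hF; rewrite -[X in smooth X]/(fun x => \sum_i F i x).
have -> : (fun x => \sum_i F i x : R^o) = \sum_i F i.
  by apply/funext => x; rewrite fct_sumE.
exact: (big_ind (@smooth R V) (smooth_cst 0) (@smoothD)).
Qed.

End OneSpace.

Section Linear.
Variables (V W : normedModType R) (N : {linear V -> W}).
Hypothesis Ncont : continuous N.

Lemma derive_linear_comp (f : W -> R^o) v : 'D_v (f \o N) = ('D_(N v) f \o N) :> (V -> R^o).
Proof.
apply/funext => x; rewrite /derive /=.
by under eq_fun => h do rewrite linearP.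
Qed.

Lemma smooth_linear_comp (f : W -> R^o) : smooth f -> smooth (f \o N).
Proof.
move=> hf vs x.
have -> : foldr (fun v (h : V -> R^o) => 'D_v h) (f \o N) vs =
    foldr (fun v (h : W -> R^o) => 'D_v h) f (map N vs) \o N.
  by elim: vs => //= v vs ->; rewrite derive_linear_comp.
apply: differentiable_comp; last exact: hf.
exact: linear_differentiable.
Qed.

End Linear.

Lemma derive_shift (V : normedModType R) (f : V -> R^o) (w v x : V) :
  'D_v (f \o +%R w) x = 'D_v f (w + x).
Proof. by rewrite /derive /=; under eq_fun => h do rewrite addrCA. Qed.

Lemma smooth_shift (V : normedModType R) (f : V -> R^o) (w : V) :
  smooth f -> smooth (f \o +%R w).
Proof.
move=> hf vs x.
have -> : foldr (fun v (h : V -> R^o) => 'D_v h) (f \o +%R w) vs =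
    foldr (fun v (h : V -> R^o) => 'D_v h) f vs \o +%R w.
  by elim: vs => //= v vs ->; apply/funext => y; exact: derive_shift.
apply: differentiable_comp; last exact: hf.
have -> : +%R w = cst w + id :> (V -> V) by [].
by apply: differentiableD; [exact: differentiable_cst | exact: ex_diff].
Qed.

Lemma mulmx_continuous m n (M : 'M[R]_(m, n)) :
  continuous (mulmx^~ M : 'rV[R]_m -> 'rV[R]_n).
Proof.
have -> : mulmx^~ M = (fun x : 'rV[R]_m => \sum_i x ord0 i *: row i M).
  by apply/funext => x; rewrite mulmx_sum_row.
have addc : continuous (fun z : 'rV[R]_n * 'rV[R]_n => z.1 + z.2) by exact: add_continuous.
apply: continuous_big => // i _ x.
apply: cvgZr_tmp; first exact: (nbhs_filter x).
exact: (@coord_continuous R 1 m ord0 i x).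
Qed.

Lemma differentiable_rV n (f : 'rV[R]_n -> R^o) x v : differentiable f x ->
  'D_v f x = \sum_i v ord0 i * 'D_(delta_mx ord0 i) f x.
Proof.
move=> hf; rewrite deriveE // {1}(row_sum_delta v) linear_sum.
by apply: eq_bigr => i _; rewrite linearZ deriveE.
Qed.

End Smooth.

(** * Maps of reduced spaces *)

Section Classes.
Variables (R : realType) (X : pseudo3).
Implicit Types (x y v : angles R X) (D : {set edge X}).

Lemma gauge_class_eq x y : based_gauge x y -> gauge_class x = gauge_class y.
Proof.
move=> xy; apply/seteqP; split=> z /= h.
  exact: based_gauge_trans (based_gauge_sym xy) h.
exact: based_gauge_trans xy h.
Qed.

Lemma gauge_class_refl x : gauge_class x x.
Proof. exact: based_gauge_refl. Qed.

Lemma get_gauge_class x : based_gauge x (get (gauge_class x)).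
Proof. by apply: (@getPex _ (gauge_class x)); exists x; exact: gauge_class_refl. Qed.

Lemma wset_based D x y : based_gauge x y -> wset D x -> wset D y.
Proof. by case/based_gaugeP => g hg ->; exact: wset_gauge. Qed.

Lemma weight_r_class x e : weight_r (gauge_class x) e = weight x e.
Proof.
rewrite /weight_r; have /based_gaugeP[g hg ->] := get_gauge_class x.
by rewrite weightD weight_gauge_dir // addr0.
Qed.

Lemma level_setP D c : level_set R D c <-> exists2 x, wset D x & c = gauge_class x.
Proof.
split=> [[[x hx <-] hD]|[x [h1 h2] ->]].
  by exists x => //; split=> // e /hD; rewrite weight_r_class.
by split; [exists x | move=> e /h2; rewrite weight_r_class].
Qed.

Lemma level_set_class D x : wset D x -> level_set R D (gauge_class x).
Proof. by move=> h; apply/level_setP; exists x. Qed.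

Lemma level_set_mem D c x : level_set R D c -> c x -> wset D x /\ c = gauge_class x.
Proof.
move=> /level_setP[y yD ->] yx; split; first exact: wset_based yx yD.
exact: gauge_class_eq.
Qed.

Lemma derive_ext (f h : angles R X -> R^o) v x :
  (forall s, f (s *: v + x) = h (s *: v + x)) -> 'D_v f x = 'D_v h x.
Proof.
move=> e; rewrite /derive /=.
have := e 0; rewrite scale0r add0r => ->.
by under eq_fun => s do rewrite e.
Qed.

Definition grad (f : angles R X -> R^o) x : 'cV[R]_#|corner X| :=
  \col_i 'D_(delta_mx ord0 i) f x.

Lemma nz_bracketE f g x : nz_bracket f g x = pform (grad f x) (grad g x).
Proof.
apply: eq_bigr => a _; apply: eq_bigr => b _.
by rewrite /partial epsE !mxE.
Qed.

Lemma pairing_grad f v x : smooth f -> pairing v (grad f x) = 'D_v f x.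
Proof.
move=> hf; rewrite differentiable_rV; last exact: smooth_differentiable.
by rewrite /pairing mxE; apply: eq_bigr => i _; rewrite mxE.
Qed.

Lemma tangentZ D (s : R) v : tangent D v -> tangent D (s *: v).
Proof.
by move=> [h1 h2]; split=> [t i|e /h2]; rewrite ?vertex_sumZ ?h1 ?weightZ ?mulr0 // => ->;
  rewrite mulr0.
Qed.

(** Along the line through [x] in a gauge direction the class is constant, hence so is the lift. *)
Lemma lift_kills_gauge D F f x :
  smooth_lift (level_set R D) F f -> wset D x -> kills_gauge (grad f x).
Proof.
move=> [fs fF] xD g hg; rewrite pairing_grad // (derive_ext (h := cst (f x))) ?derive_cst //.
move=> s; rewrite addrC -gauge_dirZ /cst.
have cD := level_set_class xD.
rewrite -(fF _ cD x (gauge_class_refl x)) -(fF _ cD) //.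
by apply/based_gaugeP; exists (fun e => s * g e) => //; exact: gauge_paramZ.
Qed.

(** Two lifts agree on [wset D], so their gradients differ by a covector that vanishes on tangent
    vectors; [pform_conormal] applies to one argument at a time. *)
Lemma lift_bracket D F G f1 f2 g1 g2 x :
  (forall e, e \in D -> ~~ bd_edge e) -> wset D x ->
  smooth_lift (level_set R D) F f1 -> smooth_lift (level_set R D) F f2 ->
  smooth_lift (level_set R D) G g1 -> smooth_lift (level_set R D) G g2 ->
  nz_bracket f1 g1 x = nz_bracket f2 g2 x.
Proof.
move=> Dint xD.
have H F' G' f1' f2' g' : smooth_lift (level_set R D) F' f1' ->
    smooth_lift (level_set R D) F' f2' -> smooth_lift (level_set R D) G' g' ->
    pform (grad f1' x) (grad g' x) = pform (grad f2' x) (grad g' x).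
  move=> l1 l2 lg; apply/eqP; rewrite -subr_eq0 -pformBl; apply/eqP.
  apply: pform_conormal Dint _ (lift_kills_gauge lg xD) => v vD.
  rewrite pairingDr pairingNr !pairing_grad; [|exact: l2.1|exact: l1.1].
  apply/eqP; rewrite subr_eq0; apply/eqP/derive_ext => s.
  have sD : wset D (s *: v + x) by rewrite addrC; apply: wsetD => //; exact: tangentZ.
  have cD := level_set_class sD.
  by rewrite -(l1.2 _ cD _ (gauge_class_refl _)) -(l2.2 _ cD _ (gauge_class_refl _)).
move=> lf1 lf2 lg1 lg2; rewrite !nz_bracketE (H _ _ _ _ _ lf1 lf2 lg1).
by rewrite pform_asym [RHS]pform_asym (H _ _ _ _ _ lg1 lg2 lf2).
Qed.

Lemma nz_bracket_shift f g x w :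
  nz_bracket f g (w + x) = nz_bracket (f \o +%R w) (g \o +%R w) x.
Proof.
by rewrite !nz_bracketE; congr pform; apply/colP => i; rewrite !mxE derive_shift.
Qed.

Lemma smooth_nz_bracket (f g : angles R X -> R^o) : smooth f -> smooth g -> smooth (nz_bracket f g : angles R X -> R^o).
Proof.
move=> fs gs; apply: smooth_sum => a; apply: smooth_sum => b.
apply: (@smoothM R _ (fun x => _ : R^o) (partial b g)); last exact: smooth_derive.
by apply: (@smoothM R _ (cst _) (partial a f)); [exact: smooth_cst | exact: smooth_derive].
Qed.

Lemma level_set_poisson D :
  (forall e, e \in D -> ~~ bd_edge e) -> poisson_submanifold (level_set R D).
Proof.
move=> Dint F G [f lf] [g lg].
have inv c x : level_set R D c -> c x -> nz_bracket f g (get c) = nz_bracket f g x.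
  move=> cD cx; have [xD cE] := level_set_mem cD cx.
  have /based_gaugeP[t ht e] : based_gauge x (get c) by rewrite cE; exact: get_gauge_class.
  (* Translating a lift along a gauge direction gives another lift of the same function, so
     [lift_bracket] also yields independence of the representative. *)
  have shift_lift F' f' : smooth_lift (level_set R D) F' f' ->
      smooth_lift (level_set R D) F' (f' \o +%R (gauge_dir t)).
    move=> [h1 h2]; split; first exact: smooth_shift.
    move=> c' c'D y c'y; apply: h2 => //; have [yD ->] := level_set_mem c'D c'y.
    by apply/based_gaugeP; exists t => //; rewrite addrC.
  rewrite e addrC nz_bracket_shift.
  exact: lift_bracket Dint xD (shift_lift _ _ lf) lf (shift_lift _ _ lg) lg.
exists (fun c => nz_bracket f g (get c)).
  by exists (nz_bracket f g); split; [apply: smooth_nz_bracket; [exact: lf.1|exact: lg.1]|move=> c cD x cx; exact: inv].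
move=> f1 g1 lf1 lg1 c cD x cx; rewrite (inv _ _ cD cx).
by have [xD _] := level_set_mem cD cx; exact: lift_bracket Dint xD lf lf1 lg lg1.
Qed.

Lemma based_lgaugeP (z w : angles R X * R^o) : based_lgauge z w <->
  exists2 g, gauge_param g & w = (z.1 + gauge_dir g, z.2 + level_shift g z.1).
Proof.
split=> [[g [h1 h2 h3]]|[g h1 ->]].
  exists g => //; rewrite [w]surjective_pairing h3; congr (_, _).
  by apply: angP => a; rewrite h2 angD ang_rowE.
by exists g; split=> //= a; rewrite angD ang_rowE.
Qed.

Lemma based_lgauge_refl (z : angles R X * R^o) : based_lgauge z z.
Proof.
apply/based_lgaugeP; exists (fun=> 0) => //.
by rewrite gauge_dir0 level_shift0 !addr0 -surjective_pairing.
Qed.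

Lemma based_lgauge_sym (z w : angles R X * R^o) : based_lgauge z w -> based_lgauge w z.
Proof.
case/based_lgaugeP => g hg ->; apply/based_lgaugeP; exists (fun e => - g e).
  exact: gauge_paramN.
by rewrite gauge_dirN level_shiftN /= level_shift_gauge // !addrK -surjective_pairing.
Qed.

Lemma based_lgauge_trans (z w u : angles R X * R^o) :
  based_lgauge z w -> based_lgauge w u -> based_lgauge z u.
Proof.
case/based_lgaugeP => g hg -> /based_lgaugeP[g' hg' ->]; apply/based_lgaugeP.
exists (fun e => g e + g' e); first exact: gauge_paramD.
by rewrite gauge_dirD level_shiftD /= level_shift_gauge // !addrA.
Qed.

Lemma lgauge_class_eq (z w : angles R X * R^o) :
  based_lgauge z w -> lgauge_class z = lgauge_class w.
Proof.
move=> zw; apply/seteqP; split=> u /= h.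
  exact: based_lgauge_trans (based_lgauge_sym zw) h.
exact: based_lgauge_trans zw h.
Qed.

Lemma get_lgauge_class (z : angles R X * R^o) : based_lgauge z (get (lgauge_class z)).
Proof. by apply: (@getPex _ (lgauge_class z)); exists z; exact: based_lgauge_refl. Qed.

Lemma forget_lgauge_class (z : angles R X * R^o) :
  forget_level (lgauge_class z) = gauge_class z.1.
Proof.
apply/seteqP; split=> [_ [w /based_lgaugeP[g hg ->] <-]|x /based_gaugeP[g hg ->]].
  by apply/based_gaugeP; exists g.
exists (z.1 + gauge_dir g, z.2 + level_shift g z.1) => //.
by apply/based_lgaugeP; exists g.
Qed.

Lemma translate_lgauge_class s (z : angles R X * R^o) :
  translate s (lgauge_class z) = lgauge_class (z.1, z.2 + s).
Proof.
apply/seteqP; split=> [_ [w /based_lgaugeP[g hg ->] <-]|w /based_lgaugeP[g hg ->]].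
  by apply/based_lgaugeP; exists g => //=; rewrite addrAC.
exists (z.1 + gauge_dir g, z.2 + level_shift g z.1); last by rewrite /= addrAC.
by apply/based_lgaugeP; exists g.
Qed.

Lemma levels_overP D c : levels_over (level_set R D) c <->
  exists2 z, wset D z.1 & c = lgauge_class z.
Proof.
split=> [[[z zg <-]]|[z zD ->]].
  rewrite forget_lgauge_class => h; exists z => //.
  by have [] := level_set_mem h (gauge_class_refl _).
split; first by exists z => //; exact: zD.1.
by rewrite forget_lgauge_class; exact: level_set_class.
Qed.

Lemma levels_over_mem D c z : levels_over (level_set R D) c -> c z ->
  wset D z.1 /\ c = lgauge_class z.
Proof.
move=> /levels_overP[w wD ->] wz; split; last exact: lgauge_class_eq.
by case/based_lgaugeP: wz => g hg ->; exact: wset_gauge.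
Qed.

End Classes.

Section Maps.
Variables (R : realType) (X Y : pseudo3).
Variables (M : 'M[R]_(#|corner X|, #|corner Y|)) (q : 'cV[R]_#|corner X|).

Definition class_map (c : set (angles R X)) : set (angles R Y) := gauge_class (get c *m M).

Definition lev_fun (z : angles R X * R^o) : angles R Y * R^o :=
  (z.1 *m M, z.2 + pairing z.1 q).

Fact lev_fun_linear : linear lev_fun.
Proof.
move=> s z w; congr (_, _) => /=; first by rewrite mulmxDl scalemxAl.
by rewrite pairingD pairingZ /GRing.scale /=; ring.
Qed.

HB.instance Definition _ := GRing.isLinear.Build R _ _ _ lev_fun lev_fun_linear.

Lemma lev_fun_continuous : continuous lev_fun.
Proof.
have hq : continuous (fun x : angles R X => pairing x q : R).
  move=> x; have h1 := @mulmx_continuous R _ _ q x.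
  have h2 := @coord_continuous R 1 1 ord0 ord0 (x *m q).
  exact: (continuous_comp h1 h2).
move=> z; have c1 : (fun w : angles R X * R^o => w.1 *m M) w @[w --> z] --> z.1 *m M.
  apply: (@cvg_comp _ _ _ fst (mulmx^~ M)); last exact: mulmx_continuous.
  exact: cvg_fst.
have c2 : (fun w : angles R X * R^o => w.2 + pairing w.1 q : R^o) w @[w --> z] -->
    (z.2 + pairing z.1 q : R^o).
  apply: cvgD; first exact: cvg_snd.
  apply: (@cvg_comp _ _ _ fst (fun x : angles R X => pairing x q : R)); last exact: hq.
  exact: cvg_fst.
exact: cvg_pair c1 c2.
Qed.

Definition lclass_map (c : set (angles R X * R^o)) : set (angles R Y * R^o) :=
  lgauge_class (lev_fun (get c)).

Variables (D : {set edge X}) (D' : {set edge Y}) (i : edge X -> edge Y) (i' : edge Y -> edge X)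
    (M' : 'M[R]_(#|corner Y|, #|corner X|)) (q' : 'cV[R]_#|corner Y|)
    (x0 : angles R X) (y0 : angles R Y).
Hypothesis H : half_iso D D' i i' M M' q q' x0 y0.

Lemma based_mulmx x y : based_gauge x y -> based_gauge (x *m M) (y *m M).
Proof.
case/based_gaugeP => g hg ->; have [g' [hg' e _]] := half_gauge H hg.
by apply/based_gaugeP; exists g' => //; rewrite mulmxDl e.
Qed.

Lemma class_mapE x : class_map (gauge_class x) = gauge_class (x *m M).
Proof. exact/esym/gauge_class_eq/based_mulmx/get_gauge_class. Qed.

Lemma class_map_level_set c : level_set R D c -> level_set R D' (class_map c).
Proof.
case/level_setP => x xD ->; rewrite class_mapE; apply: level_set_class.
exact: half_wset H _ xD.
Qed.

Lemma class_map_mem c x : level_set R D c -> c x -> class_map c (x *m M).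
Proof.
move=> cD cx; have [_ ->] := level_set_mem cD cx.
rewrite class_mapE; exact: gauge_class_refl.
Qed.

Lemma lift_comp (F : set (angles R Y) -> R) f : smooth_lift (level_set R D') F f ->
  smooth_lift (level_set R D) (F \o class_map) (f \o mulmx^~ M).
Proof.
move=> [fs fF]; split.
  by apply: (smooth_linear_comp (N := mulmxr M)) fs; exact: mulmx_continuous.
move=> c cD x cx /=; apply: fF; first exact: class_map_level_set.
exact: class_map_mem.
Qed.

Lemma class_map_smooth : smooth_map (level_set R D) (level_set R D') class_map.
Proof.
split; first exact: class_map_level_set.
by move=> F [f lf]; exists (f \o mulmx^~ M); exact: lift_comp.
Qed.

(** The last clause of [half_gauge] serves here: the correction [q] along the gauge direction makes
    up the difference of the two level shifts. *)
Lemma based_lev_fun z w : wset D z.1 -> based_lgauge z w ->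
  based_lgauge (lev_fun z) (lev_fun w).
Proof.
move=> zD /based_lgaugeP[g hg ->]; have [g' [hg' e l]] := half_gauge H hg.
apply/based_lgaugeP; exists g' => //; congr (_, _) => /=; first by rewrite mulmxDl e.
by rewrite -l // pairingD; ring.
Qed.

Lemma lclass_mapE z : wset D z.1 -> lclass_map (lgauge_class z) = lgauge_class (lev_fun z).
Proof.
by move=> zD; apply/esym/lgauge_class_eq/based_lev_fun => //; exact: get_lgauge_class.
Qed.

Lemma lclass_map_smooth : smooth_map (levels_over (level_set R D))
  (levels_over (level_set R D')) lclass_map.
Proof.
have lev c : levels_over (level_set R D) c -> levels_over (level_set R D') (lclass_map c).
  case/levels_overP => z zD ->; rewrite lclass_mapE //; apply/levels_overP.
  by exists (lev_fun z) => //; exact: half_wset H _ zD.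
split=> // F [f [fs fF]]; exists (f \o lev_fun); split.
  by apply: smooth_linear_comp fs; exact: lev_fun_continuous.
move=> c cD z cz; apply: fF; first exact: lev.
have [zD ->] := levels_over_mem cD cz; rewrite lclass_mapE //; exact: based_lgauge_refl.
Qed.

End Maps.

(** * Brackets, convexity and openness for the induced maps *)

Section Conclusion.
Variables (R : realType).

Lemma grad_mulmx X Y (M : 'M[R]_(#|corner X|, #|corner Y|)) f x : smooth f ->
  grad (f \o mulmx^~ M) x = M *m grad f (x *m M).
Proof.
move=> fs; apply/colP => k; rewrite !mxE.
apply: etrans (congr1 (fun h => h x) (derive_linear_comp (mulmxr M) f _)) _ => /=.
rewrite differentiable_rV; last exact: smooth_differentiable.
by apply: eq_bigr => j _; rewrite -rowE !mxE.
Qed.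

Section Convex.
Variables (X : pseudo3) (D : {set edge X}).

(** Positive representatives are combined with the same coefficients; the gauge parameters combine
    linearly as well. *)
Lemma shape_classes_convex c0 c1 (x z : angles R X) (s : R) :
  shape_classes R X c0 -> shape_classes R X c1 -> c0 x -> c1 z -> 0 <= s <= 1 ->
  shape_classes R X (gauge_class ((1 - s) *: x + s *: z)).
Proof.
move=> [x1 [x1g x1p] <-] [z1 [z1g z1p] <-] /based_gaugeP[g hg ->] /based_gaugeP[h hh ->].
move=> /andP[s0 s1]; exists ((1 - s) *: x1 + s *: z1).
  split=> [t v|a].
    have -> : forall w, \sum_(A : edge4 | v \in \val A) ang w (t, A) = vertex_sum t v w by [].
    rewrite vertex_sumD !vertex_sumZ (x1g t v : vertex_sum t v x1 = pi).
    by rewrite (z1g t v : vertex_sum t v z1 = pi); ring.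
  rewrite angD !angZ; have := x1p a; have := z1p a.
  case: (eqVneq s 0) => [->|sn0] ha hb; first by rewrite subr0 mul1r mul0r addr0.
  have sp : 0 < s by rewrite lt_def sn0.
  by rewrite ltr_wpDl ?mulr_gt0 ?mulr_ge0 ?subr_ge0 // ltW.
apply: gauge_class_eq; apply/based_gaugeP.
exists (fun e => (1 - s) * g e + s * h e).
  by apply: gauge_paramD; exact: gauge_paramZ.
by rewrite gauge_dirD !gauge_dirZ !scalerDr addrACA.
Qed.

Lemma wset_convex (x z : angles R X) (s : R) : wset D x -> wset D z ->
  wset D ((1 - s) *: x + s *: z).
Proof.
move=> [x1 x2] [z1 z2]; split=> [t v|e eD].
  have -> : forall w, \sum_(A : edge4 | v \in \val A) ang w (t, A) = vertex_sum t v w by [].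
  rewrite vertex_sumD !vertex_sumZ (x1 t v : vertex_sum t v x = pi).
  by rewrite (z1 t v : vertex_sum t v z = pi); ring.
by rewrite weightD !weightZ x2 // z2 //; ring.
Qed.

End Convex.

Section HalfConclusion.
Variables (X Y : pseudo3) (D : {set edge X}) (D' : {set edge Y})
    (i : edge X -> edge Y) (i' : edge Y -> edge X)
    (M : 'M[R]_(#|corner X|, #|corner Y|)) (M' : 'M[R]_(#|corner Y|, #|corner X|))
    (q : 'cV[R]_#|corner X|) (q' : 'cV[R]_#|corner Y|) (x0 : angles R X) (y0 : angles R Y).
Hypothesis H : half_iso D D' i i' M M' q q' x0 y0.
Hypothesis H' : half_iso D' D i' i M' M q' q y0 x0.

Lemma class_mapK c : level_set R D c -> class_map M' (class_map M c) = c.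
Proof.
case/level_setP => x xD ->; rewrite (class_mapE H) (class_mapE H').
have [g [hg -> _]] := half_round H xD; apply/esym/gauge_class_eq/based_gaugeP.
by exists g.
Qed.

Lemma lclass_mapK c : levels_over (level_set R D) c ->
  lclass_map M' q' (lclass_map M q c) = c.
Proof.
case/levels_overP => z zD ->; rewrite (lclass_mapE H) // (lclass_mapE H'); last first.
  exact: half_wset H _ zD.
have [g [hg e l]] := half_round H zD; apply/esym/lgauge_class_eq/based_lgaugeP.
exists g => //; congr (_, _) => //=.
by rewrite -l addrA.
Qed.

Lemma class_map_weight c : level_set R D c -> forall e, e \notin D ->
  weight_r (class_map M c) (i e) = weight_r c e.
Proof.
case/level_setP => x xD -> e eD; rewrite (class_mapE H) !weight_r_class.
exact: half_weight H _ _ xD eD.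
Qed.

(** Arbitrary lifts are first replaced by pulled-back ones, whose gradients are [M] times gradients
    on [Y]; these kill gauge directions, as [half_pform] requires. *)
Lemma class_map_bracket F G K : smooth_on (level_set R D') F -> smooth_on (level_set R D') G ->
  is_bracket (level_set R D') F G K ->
  is_bracket (level_set R D) (F \o class_map M) (G \o class_map M) (K \o class_map M).
Proof.
move=> [f lf] [g lg] FGK f1 g1 lf1 lg1 c cD x cx /=.
have [xD _] := level_set_mem cD cx.
have xMD := half_wset H xD.
rewrite (FGK f g lf lg _ (class_map_level_set H cD) _ (class_map_mem H cD cx)).
rewrite (lift_bracket (half_internal H) xD lf1 (lift_comp H lf) lg1 (lift_comp H lg)).
rewrite !nz_bracketE !grad_mulmx; [|exact: lg.1|exact: lf.1].
by rewrite (half_pform H); [|exact: lift_kills_gauge lf xMD|exact: lift_kills_gauge lg xMD].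
Qed.

(** The induced map need not preserve positivity of angles, so [U] collects the classes that contain
    a shape structure on both sides. *)
Definition shared_shapes : set (set (angles R X)) :=
  [set c | (shape_classes R X `&` level_set R D) c /\ shape_classes R Y (class_map M c)].

Lemma shared_shapes_convex : convex_classes shared_shapes.
Proof.
move=> c0 c1 x z s [[s0 l0] t0] [[s1 l1] t1] cx cz hs.
have [xD _] := level_set_mem l0 cx; have [zD _] := level_set_mem l1 cz.
split; first split.
- exact: shape_classes_convex s0 s1 cx cz hs.
- exact/level_set_class/wset_convex.
rewrite (class_mapE H) mulmxDl -!scalemxAl.
apply: shape_classes_convex t0 t1 _ _ hs; exact: class_map_mem H _ _ _ _.
Qed.

Lemma shared_shapes_open : open_in (shape_classes R X `&` level_set R D) shared_shapes.
Proof.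
split=> [c []//|].
pose P (g : edge Y -> R) := [set w : angles R Y | forall a, - ang (gauge_dir g) a < ang w a].
have Popen g : open (P g).
  rewrite openE => w wP; apply: (@filter_forall _ _
    (fun a (w : angles R Y) => - ang (gauge_dir g) a < ang w a) (nbhs w) (nbhs_filter w)) => a.
  have ha : open ((fun w : angles R Y => w ord0 (enum_rank a)) @^-1`
      [set t | - ang (gauge_dir g) a < t]).
    apply: open_comp => [w' _|]; last exact: open_gt.
    exact: (@coord_continuous R 1 _ ord0 (enum_rank a) w').
  by move: ha; rewrite openE; apply; exact: wP.
(* The image class contains a shape structure when some gauge translate of [x *m M] is positive;
   each [g] gives an open condition on [x]. *)
exists (\bigcup_(g in [set g | gauge_param g]) (mulmx^~ M @^-1` P g)).
  apply: bigcup_open => g _; apply: open_comp => // x _; exact: mulmx_continuous.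
move=> c [cS cD] x cx; have [xD cE] := level_set_mem cD cx.
have yg := (half_wset H xD).1.
rewrite cE /shared_shapes /= (class_mapE H); split.
  move=> [_ [y [_ yP] /esym yE]].
  have : gauge_class (x *m M) y by rewrite yE; exact: gauge_class_refl.
  case/based_gaugeP => g hg e; exists g => //= a.
  by rewrite -subr_gt0 opprK -angD -e.
move=> [g hg gP]; split; first by split; [rewrite -cE | exact: level_set_class].
exists (x *m M + gauge_dir g); first split; first exact/gshapes_gauge.
  by move=> a; rewrite angD -[ang (gauge_dir g) a]opprK subr_gt0; exact: gP.
by apply/esym/gauge_class_eq/based_gaugeP; exists g.
Qed.


End HalfConclusion.

Lemma reduced_iso_conclusion (X Y : pseudo3) (D : {set edge X}) (D' : {set edge Y})
    i i' M M' (q : 'cV[R]_#|corner X|) (q' : 'cV[R]_#|corner Y|) x0 y0 :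
  reduced_iso D D' i i' M M' q q' x0 y0 -> shapes R X x0 -> shapes R Y y0 ->
  exists (D : {set edge X}) (D' : {set edge Y})
         (i : edges_off D -> edges_off D') (i' : edges_off D' -> edges_off D)
         (Rr : set (angles R X) -> set (angles R Y)),
    let ZX := level_set R D in
    let ZY := level_set R D' in
    (cancel i i' /\ cancel i' i) /\
    poisson_iso ZX ZY Rr /\
    (exists Psi, affine_bundle_iso_over ZX ZY Rr Psi) /\
    (forall c, ZX c ->
       proj_off D (weight_r c) \o i' = proj_off D' (weight_r (Rr c))) /\
    exists (U : set (set (angles R X))) (U' : set (set (angles R Y))),
      [/\ open_in (shape_classes R X `&` ZX) U /\ convex_classes U,
          open_in (shape_classes R Y `&` ZY) U' /\ convex_classes U',
          Rr @` U = U',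
          shape_classes R X !=set0 <-> shape_classes R Y !=set0 &
          shape_classes R X !=set0 -> U !=set0 /\ U' !=set0].
Proof.
move=> [h h'] x0P y0P.
have [ie ie'] := (half_edge h, half_edge h').
pose j (e : edges_off D) : edges_off D' :=
  exist _ (i (val e)) (let: And3 p _ _ := ie _ (valP e) in p).
pose j' (e : edges_off D') : edges_off D :=
  exist _ (i' (val e)) (let: And3 p _ _ := ie' _ (valP e) in p).
have rK := class_mapK h h'; have rK' := class_mapK h' h.
exists D, D', j, j', (class_map M); split; [|split; [|split; [|split]]].
- split=> e; apply/val_inj => /=; first by have [_ -> _] := ie _ (valP e).
  by have [_ -> _] := ie' _ (valP e).
- split.
  + exact/level_set_poisson/(half_internal h).
  + exact/level_set_poisson/(half_internal h').
  + by exists (class_map M'); split=> //; [exact: class_map_smooth h|exact: class_map_smooth h'].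
  + by move=> F G K; apply: class_map_bracket h _ _ _.
- exists (lclass_map M q); split.
  + exists (lclass_map M' q'); split.
    * exact: lclass_map_smooth h.
    * exact: lclass_map_smooth h'.
    * exact: lclass_mapK h h'.
    * exact: lclass_mapK h' h.
  + move=> c /levels_overP[z zD ->].
    by rewrite (lclass_mapE h) // !forget_lgauge_class (class_mapE h).
  + move=> c s /levels_overP[z zD ->].
    rewrite translate_lgauge_class !(lclass_mapE h) // translate_lgauge_class.
    by congr (lgauge_class (_, _)); rewrite /= addrAC.
- move=> c cD; apply/funext => e /=; rewrite /proj_off /=.
  have [p q1 _] := ie' _ (valP e).
  by rewrite -(class_map_weight h cD p) q1.
(* The base points are shape structures whose classes correspond to each other, which makes [U]
   non-empty. *)
have base : shared_shapes D M (gauge_class x0).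
  split; first by split; [exists x0 | exact/level_set_class/(half_base h)].
  by rewrite (class_mapE h); exists y0 => //; exact/esym/gauge_class_eq/(half_base_map h).
have img c : shared_shapes D M c -> shared_shapes D' M' (class_map M c).
  move=> [[cS cD] cS']; split; last by rewrite rK.
  by split=> //; exact: class_map_level_set h _ cD.
exists (shared_shapes D M), (shared_shapes D' M'); split.
- by split; [exact: shared_shapes_open h | exact: shared_shapes_convex h].
- by split; [exact: shared_shapes_open h' | exact: shared_shapes_convex h'].
- apply/seteqP; split=> [_ [c cU <-]|c [[cS cD] cS']]; first exact: img.
  exists (class_map M' c); last exact: rK'.
  split; last by rewrite rK'.
  by split=> //; exact: class_map_level_set h' _ cD.
- by split=> _; [exists (gauge_class y0), y0 | exists (gauge_class x0), x0].
- by move=> _; split; [exists (gauge_class x0) | exists (class_map M (gauge_class x0)); exact: img].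
Qed.

End Conclusion.

Theorem theorem3 (R : realType) (X Y : shaped R)
  (XY : equivalent X Y \/
        exists lX lY : R, @leveled_equivalent R (X, lX) (Y, lY)) :
  exists (D : {set edge X}) (D' : {set edge Y})
         (i : edges_off D -> edges_off D') (i' : edges_off D' -> edges_off D)
         (Rr : set (angles R X) -> set (angles R Y)),
    let ZX := level_set R D in
    let ZY := level_set R D' in
    (cancel i i' /\ cancel i' i) /\
    poisson_iso ZX ZY Rr /\
    (exists Psi, affine_bundle_iso_over ZX ZY Rr Psi) /\
    (forall c, ZX c ->
       proj_off D (weight_r c) \o i' = proj_off D' (weight_r (Rr c))) /\
    exists (U : set (set (angles R X))) (U' : set (set (angles R Y))),
      [/\ open_in (shape_classes R X `&` ZX) U /\ convex_classes U,
          open_in (shape_classes R Y `&` ZY) U' /\ convex_classes U',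
          Rr @` U = U',
          shape_classes R X !=set0 <-> shape_classes R Y !=set0 &
          shape_classes R X !=set0 -> U !=set0 /\ U' !=set0].
Proof.
have {XY} : equivalent X Y.
  by case: XY => // -[lX [lY]]; exact: (@leveled_equivalent_equivalent R (X, lX) (Y, lY)).
move=> /equivalent_reduced[D [D' [i [i' [M [M' [q [q' h]]]]]]]].
exact: reduced_iso_conclusion h (shapeP X) (shapeP Y).
Qed.
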